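(* Let $p^+,p^-\ge0$ be fixed integers. For each $n\ge1$, under the conditional spectral Haar measure on $SO(2n+2p^++2p^-)$ (conditioned to have $2p^+$ eigenvalues at $1$ and $2p^-$ eigenvalues at $-1$), let $Z_{SO}^{(2p^+)}$ and $Z_{SO}^{(2p^-)}$ denote respectively the $2p^+$-th derivative at $1$ and the $2p^-$-th derivative at $-1$ of the characteristic polynomial. Then, as $n\to\infty$, $$\left(\frac{\log Z_{SO}^{(2p^+)}-(2p^+-\frac12)\log n}{\sqrt{\log n}},\ \frac{\log Z_{SO}^{(2p^-)}-(2p^--\frac12)\log n}{\sqrt{\log n}}\right)\xrightarrow{\text{law}}(\mathcal N_1,\mathcal N_2),$$ with $\mathcal N_1$ and $\mathcal N_2$ independent standard normal variables. Likewise, for the analogous derivatives $Z_{USp}^{(2p^+)}$ and $Z_{USp}^{(2p^-)}$ under the conditional spectral Haar measure on $USp(2n+2p^++2p^-)$, as $n\to\infty$, $$\left(\frac{\log Z_{USp}^{(2p^+)}-(2p^++\frac12)\log n}{\sqrt{\log n}},\ \frac{\log Z_{USp}^{(2p^-)}-(2p^-+\frac12)\log n}{\sqrt{\log n}}\right)\xrightarrow{\text{law}}(\mathcal N_1,\mathcal N_2).$$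
   Context: Conditional spectral Haar measures: the matrix has eigenvalue $1$ with multiplicity $2p^+$, eigenvalue $-1$ with multiplicity $2p^-$, and the other $2n$ eigenvalues are $e^{\pm i\theta_1},\dots,e^{\pm i\theta_n}$, where $(\theta_1,\dots,\theta_n)\in(0,\pi)^n$ has density proportional to $$\prod_{1\le k<\ell\le n}(\cos\theta_k-\cos\theta_\ell)^2\prod_{j=1}^n(1-\cos\theta_j)^{2p^+}(1+\cos\theta_j)^{2p^-}$$ in the case of $SO(2n+2p^++2p^-)$, and proportional to $$\prod_{1\le k<\ell\le n}(\cos\theta_k-\cos\theta_\ell)^2\prod_{j=1}^n(1-\cos\theta_j)^{2p^++1}(1+\cos\theta_j)^{2p^-+1}$$ in the case of $USp(2n+2p^++2p^-)$. The characteristic polynomial is $x\mapsto(x-1)^{2p^+}(x+1)^{2p^-}\prod_{k=1}^n(x-e^{i\theta_k})(x-e^{-i\theta_k})$; the derivatives considered are almost surely positive real numbers. In each pair, the first coordinate always refers to the derivative of order $2p^+$ at the point $1$ and the second to the derivative of order $2p^-$ at the point $-1$ (also when $p^+=p^-$). *)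

(* Defs.v *)
From HB Require Import structures.
From mathcomp Require Import all_boot all_order all_algebra.
From mathcomp Require Import complex.
From mathcomp Require Import all_classical all_reals all_analysis.

Set Implicit Arguments.
Unset Strict Implicit.
Unset Printing Implicit Defensive.

Import Order.TTheory GRing.Theory Num.Theory.
Import numFieldNormedType.Exports.

Local Open Scope classical_set_scope.
Local Open Scope ring_scope.

Section cons_measure.
Variables (R : realType) (n : nat).

Definition tuple_cons (p : measurableTypeR R * n.-tuple R) : n.+1.-tuple R :=
  [tuple of p.1 :: p.2].

Definition tuple_uncons (t : n.+1.-tuple R) : measurableTypeR R * n.-tuple R :=
  (thead t, [tuple of behead t]).

Lemma tuple_unconsK : cancel tuple_uncons tuple_cons.
Proof. by move=> t; rewrite /tuple_cons/= -tuple_eta. Qed.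

Lemma tuple_consK : cancel tuple_cons tuple_uncons.
Proof.
by move=> [x t]; rewrite /tuple_uncons theadE; congr pair; exact: val_inj.
Qed.

Lemma measurable_tuple_cons : measurable_fun [set: _] tuple_cons.
Proof. by apply: (measurable_cons measurable_fst measurable_snd). Qed.

Lemma measurable_tuple_uncons : measurable_fun [set: _] tuple_uncons.
Proof.
apply/measurable_fun_pair; last exact: measurable_behead.
exact: (measurable_tnth (T := R)).
Qed.

Variable m : {sigma_finite_measure set (n.-tuple R) -> \bar R}.

(* One-dimensional Lebesgue measure times [m], transported to (n+1)-tuples.
   Sigma-finiteness is what allows the library product to be iterated. *)
Definition cons_measure : set (n.+1.-tuple R) -> \bar R :=
  pushforward (lebesgue_measure \x m)%E tuple_cons.

Let mpre A : measurable A -> measurable (tuple_cons @^-1` A).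
Proof.
by move=> mA; rewrite -[X in measurable X]setTI; exact: measurable_tuple_cons.
Qed.

Let cons_measure0 : cons_measure set0 = 0%E.
Proof. by rewrite /cons_measure /pushforward preimage_set0 measure0. Qed.

Let cons_measure_ge0 A : (0 <= cons_measure A)%E.
Proof. by rewrite /cons_measure /pushforward measure_ge0. Qed.

Let cons_measure_sigma_additive : semi_sigma_additive cons_measure.
Proof.
move=> F mF tF mUF; rewrite /cons_measure /pushforward preimage_bigcup.
apply: measure_semi_sigma_additive.
- by move=> k; exact: mpre.
- apply/trivIsetP => /= i j _ _ ij; rewrite -preimage_setI.
  by move/trivIsetP : tF => /(_ _ _ _ _ ij) ->//; rewrite preimage_set0.
- by rewrite -preimage_bigcup; exact: mpre.
Qed.

HB.instance Definition _ := isMeasure.Build _ _ _ cons_measure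
  cons_measure0 cons_measure_ge0 cons_measure_sigma_additive.

Let cons_measure_sigma_finite : sigma_finite setT cons_measure.
Proof.
have /sigma_finiteP[F [FT ndF Foo]] := sigma_finiteT (@lebesgue_measure R).
have /sigma_finiteP[G [GT ndG Goo]] := sigma_finiteT m.
exists (fun i => tuple_uncons @^-1` (F i `*` G i)).
  rewrite -preimage_bigcup; apply/esym; rewrite -subTset => t _ /=.
  have [i _ Fi] : (\bigcup_i F i) (thead t) by rewrite -FT.
  have [j _ Gj] : (\bigcup_i G i) [tuple of behead t] by rewrite -GT.
  exists (maxn i j) => //; split => /=.
    by move: Fi; exact/subsetPset/ndF/leq_maxl.
  by move: Gj; exact/subsetPset/ndG/leq_maxr.
move=> i; have [mF Fi] := Foo i; have [mG Gi] := Goo i; split.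
  rewrite -[X in measurable X]setTI.
  by apply: measurable_tuple_uncons => //; exact: measurableX.
rewrite /cons_measure /pushforward -comp_preimage.
rewrite (_ : _ @^-1` _ = F i `*` G i).
  by rewrite product_measure1E// lte_mul_pinfty// ge0_fin_numE.
by rewrite (_ : _ \o _ = id)//; apply/funext => p /=; rewrite tuple_consK.
Qed.

HB.instance Definition _ := Measure_isSigmaFinite.Build _ _ _ cons_measure
  cons_measure_sigma_finite.

End cons_measure.

(* n-dimensional Lebesgue measure on the Borel sets of n.-tuple R. *)
Fixpoint tuple_lebesgue (R : realType) (n : nat) :
    {sigma_finite_measure set (n.-tuple R) -> \bar R} :=
  match n with
  | 0 => \d_([tuple] : 0.-tuple R)
  | n'.+1 => cons_measure (tuple_lebesgue R n')
  end.


Section probability.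
Variable R : realType.

(* Quantified over measurable sets only: [normal_prob] is an integral over [A],
   which need not agree with a push-forward on a non-measurable [A]. *)
Definition standard_normal d (T : measurableType d) (P : probability T R)
    (X : {RV P >-> R}) : Prop :=
  forall A : set R, measurable A -> distribution P X A = normal_prob 0 1 A.

Definition independent_RV d (T : measurableType d) (P : probability T R)
    (X Y : {RV P >-> R}) : Prop :=
  forall A B : set R, measurable A -> measurable B ->
    P (X @^-1` A `&` Y @^-1` B) = (P (X @^-1` A) * P (Y @^-1` B))%E.

(* Each [X n] may live on its own probability space.  The first conjunct says
   that the [X n] are random variables, so that the expectations make sense. *)
Definition cvg_in_law (d : nat -> measure_display)
    (T : forall n, measurableType (d n)) (P : forall n, probability (T n) R)
    (X : forall n, T n -> R * R)
    d' (T' : measurableType d') (Q : probability T' R) (Y : T' -> R * R) :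
    Prop :=
  (forall n, measurable_fun [set: T n] (X n)) /\
  forall f : R * R -> R, continuous f -> bounded_fun f ->
    ('E_(P n)[f \o X n] @[n --> \oo] --> 'E_Q[f \o Y])%E.

Definition density_proportional d (T : measurableType d) (P : probability T R)
    (n : nat) (X : {RV P >-> n.-tuple R}) (D : set (n.-tuple R))
    (w : n.-tuple R -> R) : Prop :=
  exists2 c : R, 0 < c & forall A : set (n.-tuple R), measurable A ->
    distribution P X A =
      (\int[tuple_lebesgue R n]_(t in A `&` D) (c * w t)%:E)%E.

End probability.

Section spectral_haar.
Variable R : realType.
Variables pp pm : nat.
Implicit Types (n : nat).

Definition angle_domain n : set (n.-tuple R) :=
  [set t | forall k : 'I_n, 0 < tnth t k < pi].

Definition cos_vandermonde_sq n (t : n.-tuple R) : R :=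
  \prod_(k < n) \prod_(l < n | (k < l)%N)
    (cos (tnth t k) - cos (tnth t l)) ^+ 2.

Definition so_weight n (t : n.-tuple R) : R :=
  cos_vandermonde_sq t *
  \prod_(j < n) ((1 - cos (tnth t j)) ^+ (2 * pp) *
                 (1 + cos (tnth t j)) ^+ (2 * pm)).

Definition usp_weight n (t : n.-tuple R) : R :=
  cos_vandermonde_sq t *
  \prod_(j < n) ((1 - cos (tnth t j)) ^+ (2 * pp + 1) *
                 (1 + cos (tnth t j)) ^+ (2 * pm + 1)).

(* [theta] lists the eigenangles in (0, pi) of the random matrix of
   SO(2n + 2pp + 2pm) (resp. USp) conditioned to have the eigenvalue 1 with
   multiplicity 2pp and -1 with multiplicity 2pm. *)
Definition so_cond_haar d (T : measurableType d) (P : probability T R) n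
    (theta : {RV P >-> n.-tuple R}) : Prop :=
  density_proportional theta (@angle_domain n) (@so_weight n).

Definition usp_cond_haar d (T : measurableType d) (P : probability T R) n
    (theta : {RV P >-> n.-tuple R}) : Prop :=
  density_proportional theta (@angle_domain n) (@usp_weight n).

Definition expi (x : R) : R[i] := Complex (cos x) (sin x).

Definition spectral_char_poly n (t : n.-tuple R) : {poly R[i]} :=
  ('X - 1) ^+ (2 * pp) * ('X + 1) ^+ (2 * pm) *
  \prod_(k < n) (('X - (expi (tnth t k))%:P) *
                 ('X - (expi (- tnth t k))%:P)).

(* The derivatives are real because the eigenvalues come in conjugate pairs,
   and positive when the angles lie in (0, pi); [complex.Re] only changes
   their type from [R[i]] to [R]. *)
Definition Z_at1 n (t : n.-tuple R) : R :=
  complex.Re (spectral_char_poly t)^`(2 * pp).[1].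

Definition Z_atN1 n (t : n.-tuple R) : R :=
  complex.Re (spectral_char_poly t)^`(2 * pm).[-1].

End spectral_haar.

Definition normalized_log (R : realType) (a : R) (n : nat) (z : R) : R :=
  (ln z - a * ln n%:R) / Num.sqrt (ln n%:R).

(* Main.v *)
(* Both conditional measures have density [prod_(k<l) (cos t_k - cos t_l)^2
   prod_j (1 - cos t_j)^a (1 + cos t_j)^b] on (0, pi)^n, and up to explicit
   constants the two derivatives are X = prod_j (1 - cos t_j) and
   Y = prod_j (1 + cos t_j).  Hence E[X^s Y^t] is a ratio of two values of the
   same integral, at (a + s, b + t) and at (a, b).

   Writing the squared Vandermonde determinant as a product of one in the
   1 - cos t_j and one in the 1 + cos t_j (up to sign), the integral becomes a
   determinant of beta integrals, which factors into a constant times a product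
   of beta integrals.  The effect of a shift of the exponent on a beta integral
   is controlled up to O(s / x^2) by a Stirling term: the error has summable
   increments by the recursion, and tends to zero by log-convexity, as in the
   Bohr-Mollerup theorem.  Summing over the factors, with s and t of order
   (log n)^(-1/2), gives the convergence of the exponential moments
   E[exp(l U + m V)] of the normalised pair to exp((l^2 + m^2) / 2) for all
   l, m >= 0.

   These one-sided moments suffice.  The functions whose expectations converge
   form a class stable under approximation with an error dominated in mean by
   a member of the class.  Numerical differentiation and Taylor expansion give
   the functions e^(u + v) cos(phi + xi u + eta v); uniform approximation by
   trigonometric sums on a large box gives compactly supported continuous
   functions, and truncation gives all bounded continuous ones. *)

Require Import Defs.
From HB Require Import structures.
From mathcomp Require Import all_boot all_order all_algebra all_fingroup.
From mathcomp Require Import complex.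
From mathcomp Require Import all_classical all_reals all_analysis.
From mathcomp Require Import measurable_realfun.
From mathcomp Require Import ring lra zify.

Set Implicit Arguments.
Unset Strict Implicit.
Unset Printing Implicit Defensive.

Import Order.TTheory GRing.Theory Num.Theory.
Import numFieldNormedType.Exports.

Local Open Scope classical_set_scope.
Local Open Scope ring_scope.

(** * Increments of log-convex solutions of the beta recursion *)

Section real_asymptotics.
Variable R : realType.
Implicit Types (s x y w : R) (n k : nat).

(** The centring and the variance come from one expansion: raising the first exponent by [s]
    multiplies the integral by [exp((s * (a - 1/2) + s^2 / 2) * ln n - n * s * ln 2 + O(s))]. The
    term [n * s * ln 2] is compensated by the factor [2 ^ n] in the derivatives, the exponents
    [a = 2p] and [a = 2p + 1] give the centrings [2p - 1/2] and [2p + 1/2], and [s = l / sqrt(ln n)]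
    turns [s^2 / 2 * ln n] into [l^2 / 2]. An error O(1) would not vanish at this scale, hence the
    factor [s] in the error bounds.

    Exponents stay nonnegative so that the integrands are continuous on the closed interval
    [[0, pi]] even when [a] or [b] is 0. The price is that the known moments fill a closed quadrant
    with the origin at its corner. The point (1, 1) is interior to it, and around it the exponents
    may move in every direction: this is the reason for the factor [e^(u + v)]. *)

Lemma ge0_of_is_derive (f f' : R -> R) x :
  (forall z : R, 0 <= z -> is_derive z 1 f (f' z)) ->
  (forall z : R, 0 <= z -> 0 <= f' z) -> f 0 = 0 -> 0 <= x -> 0 <= f x.
Proof.
move=> df f'0 f0 x0; rewrite -f0.
apply: (@ger0_derive1_ndecry _ f 0) => //.
- move=> z; rewrite in_itv/= andbT => z0.
  by have [] := df _ (ltW z0).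
- move=> z; rewrite in_itv/= andbT => z0.
  by rewrite derive1E; have [_ ->] := df _ (ltW z0); exact/f'0/ltW.
- apply/continuous_within_itvcyP; split => [z|].
    rewrite in_itv/= andbT => z0; apply: differentiable_continuous.
    by apply/derivable1_diffP; have [] := df _ (ltW z0).
  apply: cvg_at_right_filter; apply: differentiable_continuous.
  by apply/derivable1_diffP; have [] := df _ (lexx _).
Qed.

Lemma is_derive_ln1D (z : R) : 0 <= z ->
  is_derive z 1 (fun w : R => ln (1 + w)) (1 + z)^-1.
Proof.
move=> z0; have z1 : 0 < 1 + z by lra.
have h : is_derive (1 + z) 1 (@ln R) (1 + z)^-1 by exact: is_derive1_ln.
have h2 : is_derive z 1 (fun w : R => 1 + w) 1.
  change (is_derive z 1 (cst 1 + id : R -> R) 1).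
  by apply: trigger_derive; rewrite add0r.
have := @is_derive1_comp _ (@ln R) (fun w : R => 1 + w) z _ _ h h2.
by rewrite mulr1.
Qed.

Lemma ln1D_ge w : 0 <= w -> w - w ^+ 2 / 2 <= ln (1 + w).
Proof.
move=> w0; rewrite -subr_ge0 (mulrC (w ^+ 2)).
apply: (@ge0_of_is_derive (fun w => ln (1 + w) - (w - 2^-1 * w ^+ 2))
  (fun z => z ^+ 2 / (1 + z)) w); last exact: w0.
- move=> z z0; have := is_derive_ln1D z0 => h.
  change (is_derive z 1 ((fun w : R => ln (1 + w)) - (id - 2^-1 \*: (id ^+ 2)))
    (z ^+ 2 / (1 + z))).
  apply: trigger_derive; rewrite /GRing.scale/=.
  by field; apply/eqP; lra.
- by move=> z z0; rewrite divr_ge0 ?sqr_ge0//; lra.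
- by rewrite /= addr0 ln1 !expr0n/= !mulr0; ring.
Qed.

Lemma ln1D_le w : 0 <= w -> ln (1 + w) <= w - w ^+ 2 / 2 + w ^+ 3 / 3.
Proof.
move=> w0; rewrite -subr_ge0.
rewrite (_ : _ - _ = w - 2^-1 * w ^+ 2 + 3^-1 * w ^+ 3 - ln (1 + w)); last by ring.
apply: (@ge0_of_is_derive (fun w => w - 2^-1 * w ^+ 2 + 3^-1 * w ^+ 3 - ln (1 + w))
  (fun z => z ^+ 3 / (1 + z)) w); last exact: w0.
- move=> z z0; have := is_derive_ln1D z0 => h.
  change (is_derive z 1 (id - 2^-1 \*: (id ^+ 2) + 3^-1 \*: (id ^+ 3)
    - (fun w : R => ln (1 + w))) (z ^+ 3 / (1 + z))).
  apply: trigger_derive; rewrite /GRing.scale/=.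
  by field; apply/eqP; lra.
- by move=> z z0; rewrite divr_ge0 ?exprn_ge0//; lra.
- by rewrite /= addr0 ln1 !expr0n/= !mulr0; ring.
Qed.

Lemma ln1D_ge0 w : 0 <= w -> 0 <= ln (1 + w).
Proof. by move=> w0; rewrite ln_ge0//; lra. Qed.

Lemma ln1D_lew w : 0 <= w -> ln (1 + w) <= w.
Proof. by move=> w0; apply: le_ln1Dx; lra. Qed.

(* The increment of [s * ln x + s * (s - 1) / (2 * x)] agrees with
   [ln ((x + s) / x)] to third order. *)
Lemma ln_shift_third_order s x : 0 <= s <= 1 -> 2^-1 <= x ->
  `|ln (1 + s / x) - s * ln (1 + x^-1) + s * (s - 1) / 2 / (x * (x + 1))|
    <= 2 * s / x ^+ 3.
Proof.
move=> /andP[s0 s1] hx; have x0 : 0 < x by lra.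
have sx0 : 0 <= s / x by rewrite divr_ge0// ltW.
have ix0 : 0 <= x^-1 by rewrite invr_ge0 ltW.
have := ln1D_ge sx0; have := ln1D_le sx0.
have := ln1D_ge ix0; have := ln1D_le ix0.
set L1 := ln (1 + x^-1); set L2 := ln (1 + s / x) => a1 a2 a3 a4.
(* Everything is expanded in [u = 1 / x] up to multiples of [u ^+ 3]; the terms in [u] and in
   [u ^+ 2] cancel. *)
have e : (x * (x + 1))^-1 = x^-1 ^+ 2 - x^-1 ^+ 3 + x^-1 ^+ 3 / (x + 1).
  by field; apply/andP; split; apply/eqP; lra.
have i3 : 0 <= x^-1 ^+ 3 by rewrite exprn_ge0.
have i4 : 0 <= (x + 1)^-1 <= 1.
  by rewrite invr_ge0 invf_le1; lra.
rewrite e; set q := (x + 1)^-1 in i4 *.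
rewrite -exprVn; move: a1 a2 a3 a4; set u := x^-1 in ix0 i3 *.
move=> a1 a2 a3 a4.
have b1 : s * (u - u ^+ 2 / 2) <= s * L1 by rewrite ler_wpM2l.
have b2 : s * L1 <= s * (u - u ^+ 2 / 2 + u ^+ 3 / 3) by rewrite ler_wpM2l.
have s2 : s ^+ 2 <= s by rewrite expr2 ler_piMl.
have s3 : 0 <= s ^+ 3 <= s.
  rewrite exprn_ge0//= exprS; apply: le_trans (_ : s * 1 <= _); last by rewrite mulr1.
  by rewrite ler_wpM2l//; lra.
have c1 : 0 <= s ^+ 3 * u ^+ 3 <= s * u ^+ 3.
  by apply/andP; split; [apply: mulr_ge0; lra|apply: ler_wpM2r; lra].
have c2 : 0 <= (s - s ^+ 2) * u ^+ 3 <= s * u ^+ 3.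
  apply/andP; split; first by apply: mulr_ge0; lra.
  by apply: ler_wpM2r => //; have := sqr_ge0 s; lra.
have c3 : 0 <= (s - s ^+ 2) * u ^+ 3 * q <= (s - s ^+ 2) * u ^+ 3.
  apply/andP; split; first by apply: mulr_ge0; lra.
  by rewrite ler_piMr; lra.
rewrite ler_norml; apply/andP; split; lra.
Qed.

(* [10 / x ^+ 2] decreases fast enough to absorb an increment [4 / x ^+ 3]. *)
Lemma invsqr_majorant x : 2^-1 <= x ->
  4 / x ^+ 3 <= 10 / x ^+ 2 - 10 / (x + 1) ^+ 2.
Proof.
move=> hx; have x0 : 0 < x by lra.
rewrite -subr_ge0.
have -> : 10 / x ^+ 2 - 10 / (x + 1) ^+ 2 - 4 / x ^+ 3 =
  (10 * (2 * x + 1) * x - 4 * (x + 1) ^+ 2) / (x ^+ 3 * (x + 1) ^+ 2).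
  by field; apply/andP; split; apply/eqP; lra.
apply: divr_ge0; last by rewrite mulr_ge0 ?exprn_ge0//; lra.
by nra.
Qed.

(** Leading terms of [ln Gamma(x + s) - ln Gamma(x)] for large [x]. *)
Definition stirling_term s x : R := s * ln x + s * (s - 1) / 2 / x.

Section beta_shift.
Variables (F : R -> R) (y : R).
Hypothesis y0 : 0 <= y.
Hypothesis F0 : forall x, 2^-1 <= x -> 0 < F x.
Hypothesis Frec : forall x, 2^-1 <= x -> F (x + 1) = 2 * x / (x + y) * F x.
Hypothesis Finterp : forall s x, 0 <= s <= 1 -> 2^-1 <= x ->
  ln (F (x + s)) - ln (F x) <= s * (ln (F (x + 1)) - ln (F x)).

(** Error of the approximation that Stirling's formula suggests when [F x] is proportional to
    [2 ^ x * Gamma(x) / Gamma(x + y)]. *)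
Let rho s x := ln (F (x + s)) - ln (F x) - s * ln 2
  - stirling_term s x + stirling_term s (x + y).

Let ln_ratio x : 2^-1 <= x -> ln (F (x + 1)) - ln (F x) =
  ln 2 - ln (1 + y / x).
Proof.
move=> hx; have hy := y0; have x0 : 0 < x by lra.
have yx : 0 <= y / x by rewrite divr_ge0// ltW.
have q0 : 0 < 2 * x / (x + y) by rewrite divr_gt0//; lra.
rewrite Frec// lnM ?posrE ?F0// addrK -ln_div ?posrE//; last lra.
by congr ln; field; apply/andP; split; apply/eqP; lra.
Qed.

Let lnD1 x : 0 < x -> ln (x + 1) = ln x + ln (1 + x^-1).
Proof.
move=> x0; rewrite -lnM ?posrE ?ltr_wpDr// ?invr_ge0 ?ltW//.
by congr ln; field; rewrite gt_eqF.
Qed.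

Let lnDs s x : 0 <= s -> 0 < x -> ln (x + s) = ln x + ln (1 + s / x).
Proof.
move=> s0 x0; rewrite -lnM ?posrE// ?ltr_wpDr// ?divr_ge0// ?ltW//.
by congr ln; field; rewrite gt_eqF.
Qed.

Let stirlingD1 s x : 0 < x -> stirling_term s (x + 1) - stirling_term s x =
  s * ln (1 + x^-1) - s * (s - 1) / 2 / (x * (x + 1)).
Proof.
move=> x0; rewrite /stirling_term lnD1//; field.
by rewrite !gt_eqF//; lra.
Qed.

(** The recursion eliminates [F] from the increment and leaves two third-order errors, at [x] and at
    [x + y]. The bound is in telescoping form. *)
Let rho_step s x : 0 <= s <= 1 -> 2^-1 <= x ->
  `|rho s (x + 1) - rho s x| <= s * (10 / x ^+ 2 - 10 / (x + 1) ^+ 2).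
Proof.
move=> s01 hx; have hy := y0; have x0 : 0 < x by lra.
have s0 : 0 <= s by lra.
have -> : rho s (x + 1) - rho s x =
  (ln (1 + s / x) - s * ln (1 + x^-1) + s * (s - 1) / 2 / (x * (x + 1))) -
  (ln (1 + s / (x + y)) - s * ln (1 + (x + y)^-1) +
     s * (s - 1) / 2 / ((x + y) * (x + y + 1))).
  rewrite /rho.
  have h1 := @stirlingD1 s x x0.
  have h2 := @stirlingD1 s (x + y) ltac:(lra).
  have h3 := @ln_ratio x hx.
  have h4 := @ln_ratio (x + s) ltac:(lra).
  have h5 := @lnDs s x s0 x0.
  have h6 := @lnDs s (x + y) s0 ltac:(lra).
  have h7 : ln (1 + y / x) = ln (x + y) - ln x by rewrite (@lnDs y x y0 x0); ring.
  have h8 : ln (1 + y / (x + s)) = ln (x + y + s) - ln (x + s).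
    by rewrite (addrAC x) (@lnDs y (x + s) y0 ltac:(lra)); ring.
  have -> : x + 1 + s = x + s + 1 by ring.
  have -> : x + 1 + y = x + y + 1 by ring.
  lra.
apply: le_trans (ler_normB _ _) _.
have a1 := @ln_shift_third_order s x s01 hx.
have a2 := @ln_shift_third_order s (x + y) s01 ltac:(lra).
have a3 : s / (x + y) ^+ 3 <= s / x ^+ 3.
  rewrite ler_wpM2l// lef_pV2 ?posrE ?exprn_gt0//; last by lra.
  by rewrite lerXn2r ?nnegrE; lra.
have a4 : s * (4 / x ^+ 3) <= s * (10 / x ^+ 2 - 10 / (x + 1) ^+ 2).
  by rewrite ler_wpM2l// invsqr_majorant.
lra.
Qed.

(** Log-convexity on [[x, x + 1]] bounds the increment from above; on [[x + s, x + s + 1]], at the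
    point [x + 1], it bounds it from below. The result has no factor [s], but it tends to zero
    uniformly in [s]. *)
Let rho_far s x : 0 <= s <= 1 -> 2^-1 <= x -> `|rho s x| <= (3 * y + 2) / x.
Proof.
move=> s01 hx; have hy := y0; have x0 : 0 < x by lra.
have s0 : 0 <= s by lra.
have a1 := @Finterp s x s01 hx.
have a2 := @Finterp (1 - s) (x + s) ltac:(lra) ltac:(lra).
rewrite (_ : x + s + (1 - s) = x + 1) in a2; last by ring.
have h3 := @ln_ratio x hx.
have h4 := @ln_ratio (x + s) ltac:(lra).
rewrite h3 in a1; rewrite h4 in a2.
have yx0 : 0 <= y / x by rewrite divr_ge0// ltW.
have yxs0 : 0 <= y / (x + s) by rewrite divr_ge0//; lra.
have b1 := ln1D_ge0 yx0; have b2 := ln1D_lew yx0.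
have b3 := ln1D_ge0 yxs0; have b4 := ln1D_lew yxs0.
have b5 : y / (x + s) <= y / x by rewrite ler_wpM2l// lef_pV2 ?posrE; lra.
have c1 : 0 <= s * ln (1 + y / x) <= ln (1 + y / x).
  by rewrite mulr_ge0//= ler_piMl//; lra.
have c2 : 0 <= (1 - s) * ln (1 + y / (x + s)) <= ln (1 + y / (x + s)).
  by rewrite mulr_ge0//= ?ler_piMl//; lra.
rewrite /rho /stirling_term (lnDs _ x0)//.
have ixy : 0 <= (x + y)^-1 <= x^-1.
  by rewrite invr_ge0 ?lef_pV2 ?posrE; lra.
have ix0 : 0 <= x^-1 by rewrite invr_ge0 ltW.
have ss : -1 <= s * (s - 1) / 2 <= 0 by nra.
have d1 : - x^-1 <= s * (s - 1) / 2 / x <= 0 by nra.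
have d2 : - x^-1 <= s * (s - 1) / 2 / (x + y) <= 0 by nra.
have -> : (3 * y + 2) / x = 3 * (y / x) + 2 * x^-1 by ring.
by rewrite ler_norml; lra.
Qed.

(** Moving from [x] to [x + k] costs at most [10 * s / x ^+ 2] by telescoping, and the value at
    [x + k] vanishes as [k] grows. The factor [s] survives because it comes from the increments
    alone. *)
Lemma ln_beta_shift s x : 0 <= s <= 1 -> 2^-1 <= x ->
  `|ln (F (x + s)) - ln (F x) - s * ln 2
    - stirling_term s x + stirling_term s (x + y)| <= 10 * s / x ^+ 2.
Proof.
move=> s01 hx; have hy := y0; rewrite -/(rho s x); have x0 : 0 < x by lra.
have s0 : 0 <= s by lra.
have tele k : `|rho s x| <= `|rho s (x + k%:R)| +
    s * (10 / x ^+ 2 - 10 / (x + k%:R) ^+ 2).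
  elim: k => [|k /le_trans]; first by rewrite addr0 subrr mulr0 addr0.
  apply; have k0 : (0 : R) <= k%:R by rewrite ler0n.
  have := @rho_step s (x + k%:R) s01 ltac:(lra).
  rewrite (_ : x + k%:R + 1 = x + k.+1%:R) => [h|]; last first.
    by rewrite -natr1 addrA.
  have := ler_normD (rho s (x + k%:R) - rho s (x + k.+1%:R)) (rho s (x + k.+1%:R)).
  rewrite subrK distrC; lra.
apply/ler_addgt0Pr => e e0.
have [k hk] : exists k : nat, (3 * y + 2) / (x + k%:R) <= e.
  exists (Num.truncn ((3 * y + 2) / e)).+1.
  have k1 : (3 * y + 2) / e < (Num.truncn ((3 * y + 2) / e)).+1%:R by exact: truncnS_gt.
  move: k1 (ler0n R (Num.truncn ((3 * y + 2) / e)).+1).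
  move: (_.+1%:R) => kk k1 kk0.
  rewrite ler_pdivrMr; last by lra.
  move: k1; rewrite ltr_pdivrMr// => k1.
  have : 0 <= e * x by rewrite mulr_ge0// ltW.
  lra.
have k0 : (0 : R) <= k%:R by rewrite ler0n.
have h1 := tele k.
have h2 := @rho_far s (x + k%:R) s01 ltac:(lra).
have h3 : 0 <= s * (10 / (x + k%:R) ^+ 2).
  by rewrite mulr_ge0// divr_ge0// exprn_ge0//; lra.
lra.
Qed.

End beta_shift.

Lemma sum_invsqr_le x n : 2^-1 <= x -> \sum_(i < n) (x + i%:R) ^- 2 <= 6.
Proof.
move=> hx; have x0 : 0 < x by lra.
(* For positive [z], [3 / z - 3 / (z + 1)] dominates [z ^- 2] as soon as [z >= 2^-1]. *)
have h : \sum_(i < n) (x + i%:R) ^- 2 <= 3 / x - 3 / (x + n%:R).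
  elim: n => [|n IH]; first by rewrite big_ord0 addr0 subrr.
  rewrite big_ord_recr/= -(natr1 n) addrA; move: IH.
  have k0 : (0 : R) <= n%:R by rewrite ler0n.
  have : 2^-1 <= x + n%:R by lra.
  move: (x + n%:R) => z hz.
  have e : 3 / z - 3 / (z + 1) - z ^- 2 = (2 * z - 1) / (z ^+ 2 * (z + 1)).
    by field; rewrite !gt_eqF//; lra.
  have : 0 <= (2 * z - 1) / (z ^+ 2 * (z + 1)).
    by rewrite divr_ge0 ?mulr_ge0// ?sqr_ge0; lra.
  lra.
apply: le_trans h _.
have k0 : (0 : R) <= n%:R by rewrite ler0n.
have : 0 <= 3 / (x + n%:R) by rewrite divr_ge0//; lra.
have : 3 / x <= 6 by rewrite ler_pdivrMr//; lra.
lra.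
Qed.

Lemma bounded_of_increments (v : nat -> R) (K : R) : 0 <= K ->
  (forall n, (0 < n)%N -> `|v n.+1 - v n| <= K / n%:R ^+ 2) ->
  forall n, (0 < n)%N -> `|v n| <= `|v 1%N| + 2 * K.
Proof.
move=> K0 hv n n0.
(* The subtracted term makes the induction go through: [K / n ^ 2 <= 2 * K / n - 2 * K / (n + 1)]
   for [n >= 1]. *)
suff : `|v n| <= `|v 1%N| + 2 * K - 2 * K / n%:R.
  have : 0 <= 2 * K / n%:R by rewrite divr_ge0// mulr_ge0.
  lra.
elim: n n0 => // -[_ _|n IH _]; first by rewrite divr1; lra.
have := IH isT; have := hv n.+1 isT.
have -> : n.+2%:R = n.+1%:R + 1 :> R by rewrite natr1.
have : 1 <= n.+1%:R :> R by rewrite ler1n.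
move: (n.+1%:R : R) => z z1 a b.
have := ler_normD (v n.+2 - v n.+1) (v n.+1); rewrite subrK => c.
have e : 2 * K / z - 2 * K / (z + 1) - K / z ^+ 2 =
    K * (z - 1) / (z ^+ 2 * (z + 1)).
  by field; rewrite !gt_eqF//; lra.
have : 0 <= K * (z - 1) / (z ^+ 2 * (z + 1)).
  by rewrite divr_ge0 ?mulr_ge0// ?sqr_ge0//; lra.
lra.
Qed.
End real_asymptotics.

(** * Sums of logarithms, reciprocals and Stirling terms along arithmetic progressions *)

Section sums_along_progressions.
Variable R : realType.
Implicit Types (s x y w : R) (n k : nat).

Lemma ln1D_dist w : 0 <= w -> `|ln (1 + w) - w| <= w ^+ 2 / 2.
Proof.
move=> w0; have := ln1D_ge w0; have := ln1D_lew w0 => a b.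
by rewrite ler_norml; have := sqr_ge0 w; lra.
Qed.

Let ln_split (m : R) x : 0 < m -> 0 <= x -> ln (m + x) = ln m + ln (1 + x / m).
Proof.
move=> m0 x0; rewrite -lnM ?posrE// ?ltr_wpDr// ?divr_ge0// ?ltW//.
by congr ln; field; rewrite gt_eqF.
Qed.

Lemma harmonic_sum x : 2^-1 <= x -> exists2 K, 0 <= K &
  forall n, (0 < n)%N -> `|\sum_(i < n) (x + i%:R)^-1 - ln n%:R| <= K.
Proof.
move=> hx;
exists (`|\sum_(i < 1) (x + i%:R)^-1 - ln 1%:R| + 2 * (x + 1)).
  by rewrite addr_ge0// mulr_ge0//; lra.
apply: (@bounded_of_increments _ (fun n => \sum_(i < n) (x + i%:R)^-1 - ln n%:R)).
  lra.
move=> n n0; rewrite big_ord_recr/=.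
have : 1 <= n%:R :> R by rewrite ler1n.
rewrite -(natr1 n); move: (n%:R : R) (\sum_(i < n) _) => m S m1.
have m0 : 0 < m by lra.
rewrite (ln_split m0)//.
have im0 : 0 <= 1 / m by rewrite divr_ge0// ltW.
have := ln1D_dist im0; rewrite !ler_norml.
have e : (x + m)^-1 = 1 / m - x / (m * (x + m)).
  by field; rewrite !gt_eqF//; lra.
have f : 0 <= x / (m * (x + m)) <= x / m ^+ 2.
  rewrite divr_ge0 ?mulr_ge0//=; try lra.
  rewrite ler_wpM2l// ?lef_pV2 ?posrE ?exprn_gt0//; first lra.
    by rewrite expr2 ler_pM2l//; lra.
  by rewrite mulr_gt0//; lra.
have g : (1 / m) ^+ 2 = 1 / m ^+ 2 by field; rewrite gt_eqF.
have g0 : 0 <= 1 / m ^+ 2 by rewrite divr_ge0// sqr_ge0.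
have -> : (x + 1) / m ^+ 2 = x / m ^+ 2 + 1 / m ^+ 2 by rewrite mulrDl.
rewrite e g; lra.
Qed.

(** The increments in [n] are O(1 / n^2): the logarithms of 2 and of [n] cancel, and so do the terms
    of order [1 / n], since [x + C - C / 2 - (1 + C) / 2 = x - 1 / 2]. Uniformity in [C] matters
    because [C] will depend on the shift of the other exponent. *)
Lemma log_sum x (C1 : R) : 2^-1 <= x -> 0 <= C1 -> exists2 K, 0 <= K &
  forall (C : R) n, 0 <= C <= C1 -> (0 < n)%N ->
  `|\sum_(i < n) (2 * ln 2 + ln (x + i%:R) - ln (C + n%:R + i%:R))
    - (x - 2^-1) * ln n%:R| <= K.
Proof.
move=> hx hC1.
have [K KE] : exists K, K = x ^+ 2 + C1 ^+ 2 + C1 ^+ 2 + (C1 + 1) ^+ 2 + x.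
  by eexists.
have K0 : 0 <= K.
  by rewrite KE !addr_ge0 ?sqr_ge0//; lra.
exists (`|2 * ln 2 + ln x| + C1 + 2 * K).
  by rewrite !addr_ge0//; lra.
move=> C n hC n0.
apply: le_trans (@bounded_of_increments _ (fun n =>
   \sum_(i < n) (2 * ln 2 + ln (x + i%:R) - ln (C + n%:R + i%:R))
    - (x - 2^-1) * ln n%:R) K K0 _ n n0) _; last first.
  rewrite big_ord_recr big_ord0/= ln1 mulr0 subr0 add0r !addr0.
  have : 0 <= ln (C + 1) by rewrite ln_ge0//; lra.
  have : ln (C + 1) <= C by rewrite addrC; apply: ln1D_lew; lra.
  have := ler_normB (2 * ln 2 + ln x) (ln (C + 1)).
  move=> a b c; rewrite (ger0_norm c) in a; lra.
move=> {n0}m m0.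
(* When [m] grows by one, the window from [m] to [2 * m] of the second logarithm loses its first
   term and gains two at the other end. *)
have -> : \sum_(i < m.+1) (2 * ln 2 + ln (x + i%:R) - ln (C + m.+1%:R + i%:R)) =
  \sum_(i < m) (2 * ln 2 + ln (x + i%:R) - ln (C + m%:R + i%:R)) +
  (2 * ln 2 + ln (x + m%:R) + ln (C + m%:R) - ln (C + (m + m)%:R)
     - ln (C + (m + m).+1%:R)).
  rewrite !big_split/= !sumrN.
  have -> : \sum_(i < m.+1) ln (C + m.+1%:R + i%:R) =
     \sum_(i < m) ln (C + m%:R + i%:R) - ln (C + m%:R) + ln (C + (m + m)%:R)
     + ln (C + (m + m).+1%:R).
    rewrite big_ord_recr/= -addrA -natrD addSn.
    congr (_ + _).
    transitivity (\sum_(i < m.+1) ln (C + m%:R + i%:R) - ln (C + m%:R)).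
      rewrite big_ord_recl/= addr0 [RHS]addrAC subrr add0r.
      by apply: eq_bigr => i _; rewrite -!addrA -!natrD addSnnS.
    by rewrite big_ord_recr/= -!addrA -natrD; ring.
  rewrite [\sum_(i < m.+1) ln _]big_ord_recr big_ord_recr/=; ring.
move: (\sum_(i < m) _) => S.
have : 1 <= m%:R :> R by rewrite ler1n.
rewrite -(natr1 m) -(natr1 (m + m)) natrD; move: (m%:R : R) => z z1.
have z0 : 0 < z by lra.
have zz0 : 0 < z + z by lra.
rewrite (addrC x) (addrC C z) (addrC C (z + z)) (_ : C + (z + z + 1) = z + z + (1 + C));
  last by ring.
rewrite (ln_split z0)//; last lra.
rewrite (ln_split z0 (x := C)); last lra.
rewrite (ln_split zz0 (x := C)); last lra.
rewrite (ln_split zz0 (x := 1 + C)); last lra.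
rewrite (ln_split z0 (x := 1))//.
have lnzz : ln (z + z) = ln 2 + ln z.
  by rewrite -lnM ?posrE//; congr ln; ring.
rewrite lnzz.
have a1 := @ln1D_dist (x / z) ltac:(by rewrite divr_ge0//; lra).
have a2 := @ln1D_dist (C / z) ltac:(by rewrite divr_ge0//; lra).
have a3 := @ln1D_dist (C / (z + z)) ltac:(by rewrite divr_ge0//; lra).
have a4 := @ln1D_dist ((1 + C) / (z + z)) ltac:(by rewrite divr_ge0//; lra).
have a5 := @ln1D_dist (1 / z) ltac:(by rewrite divr_ge0//; lra).
have u0 : 0 <= z^-1 by rewrite invr_ge0 ltW.
have e1 : C / (z + z) = C * z^-1 / 2 by field; rewrite !gt_eqF.
have e2 : (1 + C) / (z + z) = (1 + C) * z^-1 / 2 by field; rewrite !gt_eqF.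
rewrite e1 in a3 *; rewrite e2 in a4 *.
rewrite div1r in a5 *.
move: a1 a2 a3 a4 a5; rewrite -!exprVn.
move: (ln (1 + x / z)) (ln (1 + C / z)) (ln (1 + C / z / 2))
  (ln (1 + (1 + C) / z / 2)) (ln (1 + z^-1)) u0 => l1 l2 l3 l4 l5 u0.
move: (z^-1) u0 => u u0.
rewrite !exprMn KE => a1 a2 a3 a4 a5.
have C2 : C ^+ 2 <= C1 ^+ 2 by rewrite lerXn2r ?nnegrE; lra.
have C3 : (1 + C) ^+ 2 <= (C1 + 1) ^+ 2 by rewrite lerXn2r ?nnegrE; lra.
have u2 : 0 <= u ^+ 2 by exact: sqr_ge0.
have b1 : C ^+ 2 * u ^+ 2 <= C1 ^+ 2 * u ^+ 2 by rewrite ler_wpM2r.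
have b2 : (1 + C) ^+ 2 * u ^+ 2 <= (C1 + 1) ^+ 2 * u ^+ 2 by rewrite ler_wpM2r.
have b3 : 0 <= C ^+ 2 * u ^+ 2 by rewrite mulr_ge0 ?sqr_ge0.
have b4 : 0 <= (1 + C) ^+ 2 * u ^+ 2 by rewrite mulr_ge0 ?sqr_ge0.
have b5 : 0 <= x ^+ 2 * u ^+ 2 by rewrite mulr_ge0 ?sqr_ge0.
have c5 : `|(x - 2^-1) * (l5 - u)| <= x * u ^+ 2 / 2.
  rewrite normrM ger0_norm; last lra.
  apply: le_trans (_ : x * `|l5 - u| <= _); first by rewrite ler_wpM2r//; lra.
  by rewrite -mulrA ler_wpM2l//; lra.
have b6 : 0 <= x * u ^+ 2 by rewrite mulr_ge0 ?sqr_ge0//; lra.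
move: a1 a2 a3 a4 c5; rewrite !ler_norml; lra.
Qed.

(** The logarithmic parts of [stirling_term] contribute [s * (x - 1 / 2)] times [ln n] and the
    reciprocal parts [s * (s - 1) / 2] times [ln n]. Both sums carry the factor [s], hence so does
    the error. *)
Lemma shift_sum x (C1 : R) : 2^-1 <= x -> 0 <= C1 -> exists2 K, 0 <= K &
  forall (C : R) s n, 0 <= C <= C1 -> 0 <= s <= 1 -> (0 < n)%N ->
  `|\sum_(i < n) (2 * (s * ln 2) + stirling_term s (x + i%:R)
        - stirling_term s (C + n%:R + i%:R))
    - (s * (x - 1) + s ^+ 2 / 2) * ln n%:R| <= K * s.
Proof.
move=> hx hC1; have [K1 K10 h1] := harmonic_sum hx.
have [K2 K20 h2] := log_sum hx hC1.
exists (K2 + K1 + 1); first lra.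
move=> C s n hC s01 n0.
have := h1 _ n0; have := h2 _ _ hC n0.
have h3 : 0 <= \sum_(i < n) (C + n%:R + i%:R)^-1 <= 1.
  rewrite sumr_ge0/=; last by move=> i _; rewrite invr_ge0 !addr_ge0//; lra.
  apply: le_trans (_ : \sum_(i < n) n%:R^-1 <= _).
    apply: ler_sum => i _; have : 0 < n%:R :> R by rewrite ltr0n.
    have : 0 <= i%:R :> R by [].
    by move=> i0 nn; rewrite lef_pV2 ?posrE; lra.
  by rewrite sumr_const card_ord -(mulr_natr n%:R^-1) mulVf// pnatr_eq0 -lt0n.
have -> : \sum_(i < n) (2 * (s * ln 2) + stirling_term s (x + i%:R)
        - stirling_term s (C + n%:R + i%:R)) =
  s * \sum_(i < n) (2 * ln 2 + ln (x + i%:R) - ln (C + n%:R + i%:R)) +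
  s * ((s - 1) / 2) * \sum_(i < n) (x + i%:R)^-1 -
  s * ((s - 1) / 2) * \sum_(i < n) (C + n%:R + i%:R)^-1.
  rewrite !mulr_sumr -sumrN -!big_split/=; apply: eq_bigr => i _.
  by rewrite /stirling_term; ring.
move: (\sum_(i < n) (C + n%:R + i%:R)^-1) (\sum_(i < n) (x + i%:R)^-1)
  (\sum_(i < n) (2 * ln 2 + ln (x + i%:R) - ln (C + n%:R + i%:R))) h3.
move=> S1 S2 S3 h3.
move: (ln n%:R) => l a b.
have -> : s * S3 + s * ((s - 1) / 2) * S2 - s * ((s - 1) / 2) * S1 -
   (s * (x - 1) + s ^+ 2 / 2) * l =
   s * ((S3 - (x - 2^-1) * l) + ((s - 1) / 2) * (S2 - l) - ((s - 1) / 2) * S1).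
  by field.
rewrite normrM ger0_norm; last lra.
rewrite mulrC ler_wpM2r//; first lra.
have hs : `|(s - 1) / 2| <= 1 by rewrite ler_norml; lra.
have : `|(s - 1) / 2 * (S2 - l)| <= K1.
  by rewrite normrM -[leRHS]mul1r ler_pM.
have : `|(s - 1) / 2 * S1| <= 1.
  by rewrite normrM -[leRHS]mul1r ler_pM// ger0_norm; lra.
by move: a; rewrite !ler_norml; lra.
Qed.

(* [F] stands for [z |-> 2 ^ z * B(z, y + n - 1)], with [B] Euler's beta function,
   which is used only through its recursion and its log-convexity. *)
Lemma beta_product_shift x (y1 : R) : 2^-1 <= x -> 2^-1 <= y1 ->
  exists2 K, 0 <= K &
  forall (y s : R) n (F : R -> R), 2^-1 <= y <= y1 -> 0 <= s <= 1 ->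
    (0 < n)%N ->
  (forall z, 2^-1 <= z -> 0 < F z) ->
  (forall z, 2^-1 <= z -> F (z + 1) = 2 * z / (z + (y + n.-1%:R)) * F z) ->
  (forall s z, 0 <= s <= 1 -> 2^-1 <= z ->
    ln (F (z + s)) - ln (F z) <= s * (ln (F (z + 1)) - ln (F z))) ->
  `|\sum_(i < n) (ln (F (x + i%:R + s)) - ln (F (x + i%:R))) + n%:R * (s * ln 2)
    - (s * (x - 1) + s ^+ 2 / 2) * ln n%:R| <= K * s.
Proof.
move=> hx hy1; have [K K0 hK] := @shift_sum x (x + y1) hx ltac:(lra).
(* 60 is the constant 10 of [ln_beta_shift] times the bound 6 of [sum_invsqr_le]. *)
exists (K + 60); first lra.
move=> y s n F hy s01 n0 F0 Frec Fi.
(* This value of [C] is dictated by [x + i + (y + n - 1) = (x + y - 1) + n + i]. *)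
have := @hK (x + y - 1) s n ltac:(lra) s01 n0.
have y0 : 0 <= y + n.-1%:R by rewrite addr_ge0//; lra.
have e (i : 'I_n) := @ln_beta_shift R F (y + n.-1%:R) y0 F0 Frec Fi s
  (x + i%:R) s01 ltac:(by have : 0 <= i%:R :> R by []; lra).
have : `|\sum_(i < n) (ln (F (x + i%:R + s)) - ln (F (x + i%:R)) - s * ln 2
    - stirling_term s (x + i%:R)
    + stirling_term s (x + i%:R + (y + n.-1%:R)))| <= 60 * s.
  apply: le_trans (ler_norm_sum _ _ _) _.
  apply: le_trans (ler_sum _ (fun i _ => e i)) _.
  rewrite -mulr_sumr; have := sum_invsqr_le n hx => h.
  have -> : 60 * s = 10 * s * 6 by ring.
  by rewrite ler_wpM2l//; lra.
have -> : \sum_(i < n) (ln (F (x + i%:R + s)) - ln (F (x + i%:R)) - s * ln 2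
    - stirling_term s (x + i%:R)
    + stirling_term s (x + i%:R + (y + n.-1%:R))) =
  (\sum_(i < n) (ln (F (x + i%:R + s)) - ln (F (x + i%:R))) + n%:R * (s * ln 2))
  - \sum_(i < n) (2 * (s * ln 2) + stirling_term s (x + i%:R)
        - stirling_term s (x + y - 1 + n%:R + i%:R)).
  have -> : n%:R * (s * ln 2) = \sum_(i < n) (s * ln 2).
    by rewrite sumr_const card_ord -(mulr_natl (s * ln 2)).
  rewrite -sumrN -!big_split/=; apply: eq_bigr => i _.
  have -> : x + i%:R + (y + n.-1%:R) = x + y - 1 + n%:R + i%:R.
    by case: n n0 {hK Frec y0 e} i => // n _ i; rewrite -natr1/=; ring.
  by ring.
move: (\sum_(i < n) _ + _) => S1; move: (\sum_(i < n) _) => S2.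
by rewrite !ler_norml; lra.
Qed.

End sums_along_progressions.

(** * Selberg integral on the angles *)

Section beta_integral.
Variable R : realType.
Implicit Types (a b s t : R).
Local Notation mu := (@lebesgue_measure R).

(** At a zero of [f] the power function need not be differentiable, so continuity there is checked
    directly for [a > 0]; for [a = 0] it rests on the convention that 0 to the power 0 is 1. *)
Lemma continuous_powR_ge0 (f : R -> R) a :
  0 <= a -> continuous f -> (forall t, 0 <= f t) ->
  continuous (fun t => f t `^ a).
Proof.
move=> a0 cf f0 t.
have [a00|an0] := eqVneq a 0.
  have -> : (fun t => f t `^ a) = cst 1.
    by apply/funext => u; rewrite a00 powRr0.
  exact: cst_continuous.
have {an0}ap : 0 < a by rewrite lt_neqAle eq_sym an0.
have := f0 t; rewrite le_eqVlt => /predU1P[ft0|ft].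
  apply/cvgrPdist_lt => e e0.
  rewrite -ft0 powR0 ?gt_eqF//.
  near=> u; rewrite sub0r normrN ger0_norm ?powR_ge0//.
  have -> : e = (e `^ a^-1) `^ a by rewrite -powRrM mulVf ?gt_eqF// powRr1// ltW.
  rewrite gt0_ltr_powR// ?nnegrE ?powR_ge0//.
  have : `|f t - f u| < e `^ a^-1.
    by near: u; move/cvgrPdist_lt : (cf t); apply; exact: powR_gt0.
  by rewrite -ft0 sub0r normrN ger0_norm.
apply: (@continuous_comp _ _ _ f (fun x => x `^ a)); first exact: cf.
apply: differentiable_continuous; apply/derivable1_diffP.
by apply: ex_derive; exact: is_derive1_powR.
Unshelve. all: by end_near. Qed.

Lemma onem_cos_ge0 t : 0 <= 1 - cos t. Proof. by rewrite subr_ge0 cos_le1. Qed.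

Lemma oneD_cos_ge0 t : 0 <= 1 + cos t.
Proof. by have := cos_geN1 t; lra. Qed.

Lemma onemD_cos_gt0 t : 0 < t < pi -> 0 < 1 - cos t /\ 0 < 1 + cos t.
Proof.
move=> /sin_gt0_pi s0.
have : (1 - cos t) * (1 + cos t) = sin t ^+ 2 by rewrite sin2cos2; ring.
have : 0 < sin t ^+ 2 by rewrite exprn_gt0.
have := onem_cos_ge0 t; have := oneD_cos_ge0 t.
by move=> a b; rewrite !lt_neqAle a b !andbT => c d; split;
  apply/negP => /eqP h; move: d; rewrite -h ?(mul0r, mulr0) => d;
  move: c; rewrite -d eqxx.
Qed.

Lemma continuous_onem_cos : continuous (fun t : R => 1 - cos t).
Proof.
by move=> t; apply: cvgB; [exact: cvg_cst|exact: continuous_cos].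
Qed.

Lemma continuous_oneD_cos : continuous (fun t : R => 1 + cos t).
Proof.
by move=> t; apply: cvgD; [exact: cvg_cst|exact: continuous_cos].
Qed.

Definition beta_weight a b t : R := (1 - cos t) `^ a * (1 + cos t) `^ b.

Lemma beta_weight_ge0 a b t : 0 <= beta_weight a b t.
Proof. by rewrite mulr_ge0 ?powR_ge0. Qed.

Lemma continuous_beta_weight a b : 0 <= a -> 0 <= b ->
  continuous (beta_weight a b).
Proof.
move=> a0 b0 t; apply: cvgM.
- exact: (continuous_powR_ge0 a0 continuous_onem_cos onem_cos_ge0).
- exact: (continuous_powR_ge0 b0 continuous_oneD_cos oneD_cos_ge0).
Qed.

(* This is [2 ^ (a + b) * B(a + 1/2, b + 1/2)], with [B] Euler's beta function. *)
Definition beta_int a b : R := (\int[mu]_(t in `[0%R, pi]) beta_weight a b t)%R.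

Lemma integrable_beta_weight a b : 0 <= a -> 0 <= b ->
  mu.-integrable `[0%R, pi] (EFin \o beta_weight a b).
Proof.
move=> a0 b0; apply: continuous_compact_integrable; first exact: segment_compact.
by apply: continuous_subspaceT; exact: continuous_beta_weight.
Qed.

(** A zero integral would force the weight to vanish almost everywhere, but it is positive on an
    interval of length [pi]. *)
Lemma beta_int_gt0 a b : 0 <= a -> 0 <= b -> 0 < beta_int a b.
Proof.
move=> a0 b0; rewrite lt_neqAle Rintegral_ge0 ?andbT; last first.
  by move=> t _; exact: beta_weight_ge0.
apply/negP => /eqP h.
have int0 : (\int[mu]_(t in `[0%R, pi]) `|(beta_weight a b t)%:E| = 0)%E.
  have -> : (\int[mu]_(t in `[0%R, pi]) `|(beta_weight a b t)%:E|)%E =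
      (\int[mu]_(t in `[0%R, pi]) (beta_weight a b t)%:E)%E.
    by apply: eq_integral => t _; rewrite gee0_abs// lee_fin beta_weight_ge0.
  rewrite -[LHS]fineK ?integral_fune_fin_num ?integrable_beta_weight//.
  by rewrite -[fine _]/(beta_int a b) -h.
have /integrableP[mb _] := integrable_beta_weight a0 b0.
have := (ae_eq_integral_abs mu (measurable_itv `[0%R, pi]) mb).1 int0.
move=> [A [mA A0 hA]].
have : (mu `]0%R, pi[ <= mu A)%E.
  apply: le_measure; rewrite ?inE//.
  apply: subset_trans hA => t /=; rewrite !in_itv/= => t0 h1.
  have /= := onemD_cos_gt0 t0; move=> [u0 v0].
  have t1 : 0 <= t <= pi by case/andP: t0 => /ltW -> /ltW ->.
  by have [/eqP] := h1 t1; rewrite gt_eqF// mulr_gt0 ?powR_gt0.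
rewrite A0 lebesgue_measure_itv/= lte_fin pi_gt0 oppr0 adde0 lee_fin.
by rewrite leNgt pi_gt0.
Qed.

(** With [L = ln w], this is the combination with weights [s] and [1 - s] of [expR u >= 1 + u] at
    [u = (1 - s) * L] and at [u = - s * L]; the terms linear in [L] cancel. *)
Lemma powR_weighted_AMGM s w : 0 <= s <= 1 -> 0 < w -> w `^ s <= 1 + s * (w - 1).
Proof.
move=> s01 w0; rewrite /powR gt_eqF//; set L := ln w.
have wE : w = expR L by rewrite lnK.
have e1 : expR (s * L) * (1 + (1 - s) * L) <= w.
  rewrite [leRHS]wE (_ : expR L = expR (s * L) * expR ((1 - s) * L)).
    by rewrite ler_wpM2l ?expR_ge0 ?expR_ge1Dx.
  by rewrite -expRD; congr expR; ring.
have e2 : expR (s * L) * (1 + - (s * L)) <= 1.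
  rewrite [leRHS](_ : 1 = expR (s * L) * expR (- (s * L))).
    by rewrite ler_wpM2l ?expR_ge0 ?expR_ge1Dx.
  by rewrite -expRD subrr expR0.
have f1 : s * (expR (s * L) * (1 + (1 - s) * L)) <= s * w.
  by rewrite ler_wpM2l//; lra.
have f2 : (1 - s) * (expR (s * L) * (1 + - (s * L))) <= (1 - s) * 1.
  by rewrite ler_wpM2l//; lra.
move: (expR _) f1 f2 => E f1 f2.
clear -f1 f2; move: L f1 f2 => L f1 f2.
lra.
Qed.

Lemma powRD1 (u : R) a : 0 <= u -> 0 <= a -> u `^ (a + 1) = u * u `^ a.
Proof.
move=> u0 a0; rewrite powRD; first by rewrite powRr1// mulrC.
by rewrite [_ == 0]gt_eqF//; lra.
Qed.

Lemma powR_half_shift (u : R) a : 0 < u -> u `^ (a + 2^-1) = u `^ a * Num.sqrt u.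
Proof.
move=> u0; rewrite powRD; first by rewrite powR12_sqrt// ltW.
by rewrite [u == 0]gt_eqF// implybT.
Qed.

(** The half powers absorb the factor [sin t], which is the product of the square roots of
    [1 - cos t] and [1 + cos t], and make the function vanish at both ends. Its derivative is a
    combination of two beta weights. *)
Let FTC_prim a b t : R := (1 - cos t) `^ (a + 2^-1) * (1 + cos t) `^ (b + 2^-1).

Let is_derive_FTC_prim a b t : 0 < t < pi -> 0 <= a -> 0 <= b ->
  is_derive t 1 (FTC_prim a b) ((a + 2^-1) * beta_weight a (b + 1) t
    - (b + 2^-1) * beta_weight (a + 1) b t).
Proof.
move=> t0 a0 b0; have [u0 v0] := onemD_cos_gt0 t0.
have dc : is_derive t 1 (@cos R) (- sin t) by exact: is_derive_cos.
have d1 : is_derive t 1 (fun t : R => 1 - cos t) (sin t).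
  change (is_derive t 1 (cst 1 - @cos R : R -> R) (sin t)).
  by apply: trigger_derive; rewrite sub0r opprK.
have d2 : is_derive t 1 (fun t : R => 1 + cos t) (- sin t).
  change (is_derive t 1 (cst 1 + @cos R : R -> R) (- sin t)).
  by apply: trigger_derive; rewrite add0r.
have p1 := is_derive1_powR (a + 2^-1) u0.
have p2 := is_derive1_powR (b + 2^-1) v0.
have c1 := @is_derive1_comp _ (fun x : R => x `^ (a + 2^-1)) (fun t : R => 1 - cos t) t _ _ p1 d1.
have c2 := @is_derive1_comp _ (fun x : R => x `^ (b + 2^-1)) (fun t : R => 1 + cos t) t _ _ p2 d2.
have := @is_deriveM _ _ _ _ t 1 _ _ c1 c2.
move=> h; apply: is_derive_eq h _ => /=.
have sE : sin t = Num.sqrt (1 - cos t) * Num.sqrt (1 + cos t).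
  rewrite -sqrtrM ?ltW// (_ : _ * _ = sin t ^+ 2); last by rewrite sin2cos2; ring.
  by rewrite sqrtr_sqr gtr0_norm// sin_gt0_pi.
rewrite /GRing.scale/= /beta_weight.
move: u0 v0 sE {p1 p2 c1 c2 d1 d2}; move: (1 - cos t) (1 + cos t) => u v u0 v0 ->.
have -> : a + 2^-1 - 1 = a - 2^-1 by lra.
have -> : b + 2^-1 - 1 = b - 2^-1 by lra.
have q (w : R) c : 0 < w -> w `^ (c - 2^-1) * Num.sqrt w = w `^ c.
  by move=> w0; rewrite -powR_half_shift// subrK.
have u00 := ltW u0; have v00 := ltW v0.
rewrite !powR_half_shift// !powRD1//.
rewrite -(q u a u0) -(q v b v0).
have su : u = Num.sqrt u * Num.sqrt u by rewrite -expr2 sqr_sqrtr// ltW.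
have sv : v = Num.sqrt v * Num.sqrt v by rewrite -expr2 sqr_sqrtr// ltW.
rewrite [in X in _ = X - _](_ : v * _ = Num.sqrt v * Num.sqrt v * (v `^ (b - 2^-1) * Num.sqrt v)); last by rewrite -sv.
rewrite [in X in _ = _ - X](_ : u * _ = Num.sqrt u * Num.sqrt u * (u `^ (a - 2^-1) * Num.sqrt u)); last by rewrite -su.
by ring.
Qed.

Let continuous_FTC_prim a b : 0 <= a -> 0 <= b -> continuous (FTC_prim a b).
Proof. by move=> a0 b0; apply: (@continuous_beta_weight (a + 2^-1) (b + 2^-1)); lra. Qed.

Lemma beta_int_by_parts a b : 0 <= a -> 0 <= b ->
  (a + 2^-1) * beta_int a (b + 1) = (b + 2^-1) * beta_int (a + 1) b.
Proof.
move=> a0 b0; apply/eqP; rewrite -subr_eq0; apply/eqP.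
have b1 : 0 <= b + 1 by lra.
have a1 : 0 <= a + 1 by lra.
pose f t := (a + 2^-1) * beta_weight a (b + 1) t - (b + 2^-1) * beta_weight (a + 1) b t.
have i1 := integrable_beta_weight a0 b1.
have i2 := integrable_beta_weight a1 b0.
have -> : (a + 2^-1) * beta_int a (b + 1) - (b + 2^-1) * beta_int (a + 1) b =
    (\int[mu]_(t in `[0%R, pi]) f t)%R.
  rewrite /f RintegralB//=; first by rewrite !RintegralZl.
    exact: (integrableZl _ _ i1).
  exact: (integrableZl _ _ i2).
have cF := continuous_FTC_prim a0 b0.
rewrite /Rintegral (@continuous_FTC2 R f (FTC_prim a b) 0 pi)/=.
- have a2 : a + 2^-1 != 0 by rewrite gt_eqF//; lra.
  have b2 : b + 2^-1 != 0 by rewrite gt_eqF//; lra.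
  by rewrite /FTC_prim cos0 cospi !subrr !powR0// mulr0 mul0r subrr.
- exact: pi_gt0.
- apply: continuous_subspaceT => t; apply: cvgB.
    by apply: cvgM; [exact: cvg_cst|exact: continuous_beta_weight].
  by apply: cvgM; [exact: cvg_cst|exact: continuous_beta_weight].
- split=> [t||]; last 2 first.
  + by apply: cvg_at_right_filter; exact: cF.
  + by apply: cvg_at_left_filter; exact: cF.
  rewrite in_itv/= => t0.
  by have [] := is_derive_FTC_prim t0 a0 b0.
- move=> t; rewrite in_itv/= => t0.
  by rewrite derive1E; have [_ ->] := is_derive_FTC_prim t0 a0 b0.
Qed.

(** The factors [1 - cos t] and [1 + cos t] add up to 2. With [beta_int_by_parts] this is a linear
    system for the two shifted integrals, solved by the recursions below. *)
Lemma beta_intD1 a b : 0 <= a -> 0 <= b ->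
  beta_int (a + 1) b + beta_int a (b + 1) = 2 * beta_int a b.
Proof.
move=> a0 b0.
have b1 : 0 <= b + 1 by lra.
have a1 : 0 <= a + 1 by lra.
have i0 := integrable_beta_weight a0 b0.
have i1 := integrable_beta_weight a0 b1.
have i2 := integrable_beta_weight a1 b0.
rewrite /beta_int -RintegralD// -RintegralZl//; apply: eq_Rintegral => t _.
by rewrite /beta_weight !powRD1 ?oneD_cos_ge0 ?onem_cos_ge0//; ring.
Qed.

Lemma beta_int_recl a b : 0 <= a -> 0 <= b ->
  beta_int (a + 1) b = 2 * (a + 2^-1) / (a + 2^-1 + (b + 2^-1)) * beta_int a b.
Proof.
move=> a0 b0; have c0 : a + 2^-1 + (b + 2^-1) != 0 by rewrite gt_eqF//; lra.
have := beta_int_by_parts a0 b0; have := beta_intD1 a0 b0.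
move: (beta_int (a + 1) b) (beta_int a (b + 1)) (beta_int a b) => X Y Z XY YX.
have -> : 2 * (a + 2^-1) / (a + 2^-1 + (b + 2^-1)) * Z =
    (a + 2^-1) * (2 * Z) / (a + 2^-1 + (b + 2^-1)) by ring.
by rewrite -XY mulrDr YX; apply: (canRL (mulfK c0)); ring.
Qed.

Lemma beta_int_recr a b : 0 <= a -> 0 <= b ->
  beta_int a (b + 1) = 2 * (b + 2^-1) / (a + 2^-1 + (b + 2^-1)) * beta_int a b.
Proof.
move=> a0 b0; have := beta_intD1 a0 b0; rewrite beta_int_recl// => h.
apply: (addrI (2 * (a + 2^-1) / (a + 2^-1 + (b + 2^-1)) * beta_int a b)).
rewrite h; move: (beta_int a b) => Z; field; rewrite gt_eqF//; lra.
Qed.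

(** Log-convexity of moments. The weighted inequality is applied to [g / c], where [c = I1 / I0] is
    the mean of [g] under [w]; for this [c] the integrated bound collapses to [c ^ s * I0]. *)
Lemma Rintegral_powR_shift (g w : R -> R) s : 0 <= s <= 1 ->
  (forall t, 0 <= g t) -> (forall t, 0 <= w t) ->
  mu.-integrable `[0%R, pi] (EFin \o w) ->
  mu.-integrable `[0%R, pi] (EFin \o (fun t => w t * g t)) ->
  mu.-integrable `[0%R, pi] (EFin \o (fun t => w t * g t `^ s)) ->
  let I0 := (\int[mu]_(t in `[0%R, pi]) w t)%R in
  let I1 := (\int[mu]_(t in `[0%R, pi]) (w t * g t))%R in
  let Is := (\int[mu]_(t in `[0%R, pi]) (w t * g t `^ s))%R in
  0 < I0 -> 0 < I1 -> 0 < Is ->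
  ln Is - ln I0 <= s * (ln I1 - ln I0).
Proof.
move=> s01 g0 w0 i0 i1 is_ I0 I1 Is I00 I10 Is0.
have s0 : 0 <= s by lra.
pose c := I1 / I0.
have c0 : 0 < c by rewrite divr_gt0.
have cs0 : 0 < c `^ s by rewrite powR_gt0.
have pt t : g t `^ s <= c `^ s * (1 - s) + (c `^ s * (s / c)) * g t.
  have -> : c `^ s * (1 - s) + (c `^ s * (s / c)) * g t =
     c `^ s * (1 + s * (g t / c - 1)) by ring.
  have [->|gt0] := eqVneq (g t) 0.
    rewrite mul0r sub0r mulrN1.
    have [->|sn0] := eqVneq s 0; first by rewrite !powRr0 subr0 mulr1.
    by rewrite powR0// mulr_ge0; [|rewrite ltW|lra].
  have gp : 0 < g t by rewrite lt_neqAle eq_sym gt0 g0.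
  have gc : 0 < g t / c by rewrite divr_gt0.
  have gE : g t `^ s = c `^ s * (g t / c) `^ s.
    by rewrite -powRM ?(ltW c0) ?(ltW gc)// mulrC divfK// gt_eqF.
  by rewrite gE ler_wpM2l ?(ltW cs0)// powR_weighted_AMGM.
have le1 : Is <= c `^ s * (1 - s) * I0 + (c `^ s * (s / c)) * I1.
  rewrite /Is /I0 /I1 -!RintegralZl// -RintegralD//; last 2 first.
    exact: (integrableZl _ _ i0).
    exact: (integrableZl _ _ i1).
  apply: le_Rintegral => //.
    exact: (integrableD _ (integrableZl _ _ i0) (integrableZl _ _ i1)).
  move=> t _; have := ler_wpM2l (w0 t) (pt t); rewrite mulrDr => /le_trans; apply.
  by rewrite le_eqVlt; apply/orP; left; apply/eqP; ring.
have le2 : Is <= c `^ s * I0.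
  rewrite (le_trans le1)// le_eqVlt; apply/orP; left; apply/eqP.
  by rewrite /c; field; rewrite !gt_eqF.
have : ln Is <= ln (c `^ s * I0) by rewrite ler_ln ?posrE// mulr_gt0.
rewrite lnM ?posrE// ln_powR /c ln_div ?posrE//; lra.
Qed.

Lemma beta_int_interpl a b s : 0 <= s <= 1 -> 0 <= a -> 0 <= b ->
  ln (beta_int (a + s) b) - ln (beta_int a b) <=
    s * (ln (beta_int (a + 1) b) - ln (beta_int a b)).
Proof.
move=> s01 a0 b0.
have as0 : 0 <= a + s by lra.
have a1 : 0 <= a + 1 by lra.
have E1 : beta_weight (a + 1) b = fun t => beta_weight a b t * (1 - cos t).
  by apply/funext => t; rewrite /beta_weight powRD1 ?onem_cos_ge0//; ring.
have Es : beta_weight (a + s) b = fun t => beta_weight a b t * (1 - cos t) `^ s.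
  apply/funext => t; rewrite /beta_weight.
  have [->|u0] := eqVneq (1 - cos t) 0.
    have [->|s0] := eqVneq s 0; first by rewrite addr0 powRr0 mulr1.
    rewrite [0 `^ s]powR0// mulr0 powR0 ?mul0r// gt_eqF//; lra.
  by rewrite powRD ?u0 ?implybT//; ring.
have i0 := integrable_beta_weight a0 b0.
have i1 := integrable_beta_weight a1 b0; rewrite E1 in i1.
have is_ := integrable_beta_weight as0 b0; rewrite Es in is_.
have := beta_int_gt0 as0 b0; have := beta_int_gt0 a1 b0.
rewrite {1 2 3 5}/beta_int E1 Es => h1 hs.
exact: (Rintegral_powR_shift s01 onem_cos_ge0 (beta_weight_ge0 a b) i0 i1 is_ (beta_int_gt0 a0 b0)).
Qed.

Lemma beta_int_interpr a b s : 0 <= s <= 1 -> 0 <= a -> 0 <= b ->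
  ln (beta_int a (b + s)) - ln (beta_int a b) <=
    s * (ln (beta_int a (b + 1)) - ln (beta_int a b)).
Proof.
move=> s01 a0 b0.
have bs0 : 0 <= b + s by lra.
have b1 : 0 <= b + 1 by lra.
have E1 : beta_weight a (b + 1) = fun t => beta_weight a b t * (1 + cos t).
  by apply/funext => t; rewrite /beta_weight powRD1 ?oneD_cos_ge0//; ring.
have Es : beta_weight a (b + s) = fun t => beta_weight a b t * (1 + cos t) `^ s.
  apply/funext => t; rewrite /beta_weight.
  have [->|u0] := eqVneq (1 + cos t) 0.
    have [->|s0] := eqVneq s 0; first by rewrite addr0 powRr0 mulr1.
    rewrite [0 `^ s]powR0// mulr0 powR0 ?mulr0// gt_eqF//; lra.
  by rewrite powRD ?u0 ?implybT//; ring.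
have i0 := integrable_beta_weight a0 b0.
have i1 := integrable_beta_weight a0 b1; rewrite E1 in i1.
have is_ := integrable_beta_weight a0 bs0; rewrite Es in is_.
have := beta_int_gt0 a0 bs0; have := beta_int_gt0 a0 b1.
rewrite {1 2 3 5}/beta_int E1 Es => h1 hs.
exact: (Rintegral_powR_shift s01 oneD_cos_ge0 (beta_weight_ge0 a b) i0 i1 is_ (beta_int_gt0 a0 b0)).
Qed.

End beta_integral.

(** * Determinant of beta integrals *)

Section beta_determinant.
Variable F : numFieldType.
Implicit Types (n k : nat) (c x y : F).

(** The Pochhammer symbol. *)
Definition rising x k : F := \prod_(i < k) (x + i%:R).

Lemma rising0 x : rising x 0 = 1. Proof. by rewrite /rising big_ord0. Qed.

Lemma risingS x k : rising x k.+1 = rising x k * (x + k%:R).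
Proof. by rewrite /rising big_ord_recr. Qed.

Lemma rising_gt0 x k : 0 < x -> 0 < rising x k.
Proof. by move=> x0; apply: prodr_gt0 => i _; rewrite ltr_wpDr. Qed.

Lemma rising_split x k l : (k <= l)%N ->
  rising x l = rising x k * \prod_(k <= m < l) (x + m%:R).
Proof.
move=> kl; rewrite /rising -!(big_mkord xpredT (fun i => x + i%:R)).
by rewrite (big_cat_nat (n := k)).
Qed.

(** Its value at [c + i] is [rising c (i + n.-1) / rising c (i + j)], while its coefficients do not
    involve [c]. *)
Let q n (j : nat) : {poly F} := \prod_(j <= m < n.-1) ('X - (- m%:R)%:P).

Let size_q n (j : 'I_n) : (size (q n j) <= n)%N.
Proof.
rewrite size_prod_XsubC size_iota; case: n j => [[//]|n] j.
by rewrite ltnS leq_subr.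
Qed.

Let horner_q n j x : (q n j).[x] = \prod_(j <= m < n.-1) (x + m%:R).
Proof.
by rewrite horner_prod; apply: eq_bigr => m _; rewrite hornerXsubC opprK.
Qed.

Lemma det_powers n (a : 'I_n -> F) :
  \det (\matrix_(k, i < n) a k ^+ i) =
  \prod_(i < n) \prod_(j < n | (i < j)%N) (a j - a i).
Proof.
rewrite -det_tr.
rewrite (_ : _^T = Vandermonde n (\row_j a j)); last by apply/matrixP => i j; rewrite !mxE.
by rewrite det_Vandermonde; apply: eq_bigr => i _; apply: eq_bigr => j _; rewrite !mxE.
Qed.

(* After scaling row [i] by [rising c (i + n - 1)], entry [(i, j)] is a
   polynomial in [c + i], so the determinant is a Vandermonde determinant in
   the nodes [c + i] times one that does not involve [c]. *)
Lemma det_inv_rising n : exists K : F, forall c, 0 < c ->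
  \det (\matrix_(i, j < n) (rising c (i + j))^-1) =
  K * \prod_(i < n) (rising c (i + n.-1))^-1.
Proof.
exists ((\prod_(i < n) \prod_(j < n | (i < j)%N) (j%:R - i%:R)) *
   \det (\matrix_(l, j < n) (q n j)`_l)) => c c0.
have -> : \matrix_(i, j < n) (rising c (i + j))^-1 =
    diag_mx (\row_(i < n) (rising c (i + n.-1))^-1) *m
    ((\matrix_(i, l < n) (c + i%:R) ^+ l) *m (\matrix_(l, j < n) (q n j)`_l)).
  apply/matrixP => i j; rewrite mul_diag_mx !mxE.
  under eq_bigr => l _ do rewrite !mxE mulrC.
  rewrite -(horner_coef_wide _ (size_q j)) horner_q.
  have jn : (j <= n.-1)%N by case: (n) j => [[]//|m] j; rewrite -ltnS.
  rewrite (@rising_split c (i + j) (i + n.-1)) ?leq_add2l//.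
  rewrite invfM -mulrA [X in _ = _ * X](_ : _ = 1) ?mulr1//.
  rewrite (addnC i n.-1) -{1}[(i + j)%N]addnC big_addn addnK.
  under [X in X^-1]eq_bigr => m _ do rewrite natrD (addrC m%:R) addrA.
  rewrite mulVf// gt_eqF// prodr_gt0// => m _.
  by rewrite !ltr_wpDr// ltr_wpDr.
rewrite !det_mulmx det_diag det_powers mulrC -!mulrA; congr (_ * _); last first.
  by congr (_ * _); apply: eq_bigr => i _; rewrite mxE.
apply: eq_bigr => i _; apply: eq_bigr => j _; by rewrite opprD addrACA subrr add0r.
Qed.

(** For fixed [s], the sum over [r] is the sign of [s] times the determinant of [M] with rows
    permuted by [s], that is [\det M]. This is the combinatorial half of Andréief's identity. *)
Lemma sum_perm2 n (M : 'M[F]_n) :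
  \sum_(s : 'S_n) \sum_(r : 'S_n) (-1) ^+ s * (-1) ^+ r * \prod_k M (s k) (r k)
  = n`!%:R * \det M.
Proof.
transitivity (\sum_(s : 'S_n) \det M); last first.
  rewrite sumr_const mulr_natl; congr (_ *+ _).
  by rewrite -card_Sn; apply: eq_card => s; rewrite !inE.
apply: eq_bigr => s _.
transitivity ((-1) ^+ s * \det (row_perm s M)).
  rewrite big_distrr/=; apply: eq_bigr => r _; rewrite -mulrA; congr (_ * (_ * _)).
  by apply: eq_bigr => k _; rewrite mxE.
by rewrite row_permE det_mulmx det_perm mulrA -expr2 sqrr_sign mul1r.
Qed.

(** Factors that depend on the row alone or on the column alone leave the sum, because a permutation
    meets each index once; the rest is [det_inv_rising]. It is essential that [K] be the same for
    all [b0], [x], [y], as it then cancels in ratios. *)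
Lemma sum_perm2_beta n : exists K : F, forall (b0 x y : F) (B : nat -> nat -> F),
  0 < x + y ->
  (forall i j, B i j = b0 * 2 ^+ (i + j) * rising x i * rising y j
                       / rising (x + y) (i + j)) ->
  \sum_(s : 'S_n) \sum_(r : 'S_n) (-1) ^+ s * (-1) ^+ r * \prod_k B (s k) (r k)
  = K * \prod_(i < n) (b0 * rising x i * rising y i
                       / rising (x + y) (i + n.-1)).
Proof.
have [K hK] := det_inv_rising n.
exists (n`!%:R * K * \prod_(i < n) (2 ^+ i * 2 ^+ i)) => b0 x y B xy hB.
pose M := \matrix_(i, j < n) (rising (x + y) (i + j))^-1.
have pE (s r : 'S_n) : \prod_k B (s k) (r k) =
    \prod_(i < n) (b0 * rising x i * rising y i) * \prod_(i < n) (2 ^+ i * 2 ^+ i)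
    * \prod_k M (s k) (r k).
  transitivity (\prod_k ((b0 * (2 ^+ s k * rising x (s k))) *
       (2 ^+ r k * rising y (r k)) * M (s k) (r k))).
    by apply: eq_bigr => k _; rewrite hB mxE exprD; ring.
  rewrite !big_split/=.
  rewrite -(reindex_inj (@perm_inj _ s) (P := xpredT) (F := fun i : 'I_n => 2 ^+ i)).
  rewrite -(reindex_inj (@perm_inj _ s) (P := xpredT) (F := fun i : 'I_n => rising x i)).
  rewrite -(reindex_inj (@perm_inj _ r) (P := xpredT) (F := fun i : 'I_n => 2 ^+ i)).
  rewrite -(reindex_inj (@perm_inj _ r) (P := xpredT) (F := fun i : 'I_n => rising y i)).
  by ring.
transitivity (\prod_(i < n) (b0 * rising x i * rising y i) * \prod_(i < n) (2 ^+ i * 2 ^+ i)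
  * \sum_(s : 'S_n) \sum_(r : 'S_n) (-1) ^+ s * (-1) ^+ r * \prod_k M (s k) (r k)).
  rewrite mulr_sumr; apply: eq_bigr => s _; rewrite mulr_sumr; apply: eq_bigr => r _.
  by rewrite pE mulrCA.
by rewrite sum_perm2 hK// [X in _ = _ * X]big_split/=; ring.
Qed.

End beta_determinant.

(** * Iterated integrals over the angles and the Selberg integral *)

Section tuple_integral.
Variable R : realType.
Local Notation mu := (@lebesgue_measure R).

Lemma ge0_integral_tuple_cons n (f : n.+1.-tuple R -> \bar R) :
  @measurable_fun _ _ (n.+1.-tuple R) (\bar R) setT f -> (forall t, (0 <= f t)%E) ->
  (\int[tuple_lebesgue R n.+1]_t f t =
   \int[mu]_x \int[tuple_lebesgue R n]_t f [tuple of x :: t])%E.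
Proof.
move=> mf f0.
have mc := @measurable_tuple_cons R n.
transitivity (\int[pushforward (mu \x tuple_lebesgue R n)%E (@tuple_cons R n)]_t f t)%E.
  by apply: eq_measure_integral.
rewrite ge0_integral_pushforward// preimage_setT.
rewrite fubini_tonelli1//.
- exact: measurableT_comp.
- by move=> p /=; exact: f0.
Qed.

Lemma measurable_prod_tnth n (g : 'I_n -> R -> R) :
  (forall k, measurable_fun [set: R] (g k)) ->
  measurable_fun [set: n.-tuple R] (fun t : n.-tuple R => \prod_(k < n) g k (tnth t k)).
Proof.
move=> mg; apply: measurable_prod => k _.
by apply: (measurableT_comp (mg k)); exact: measurable_tnth.
Qed.

Lemma ge0_integral_prod_tnth n (g : 'I_n -> R -> R) :
  (forall k, measurable_fun [set: R] (g k)) -> (forall k x, 0 <= g k x) ->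
  (\int[tuple_lebesgue R n]_t (\prod_(k < n) g k (tnth t k))%:E =
   \prod_(k < n) \int[mu]_x (g k x)%:E)%E.
Proof.
elim: n g => [|n IH] g mg g0.
  rewrite big_ord0 /= integral_dirac//.
  - by rewrite diracT mul1e big_ord0.
  - by under eq_fun do rewrite big_ord0; exact: measurable_cst.
have mp m (h : 'I_m -> R -> R) : (forall k, measurable_fun [set: R] (h k)) ->
    measurable_fun [set: m.-tuple R] (fun t : m.-tuple R => (\prod_(k < m) h k (tnth t k))%:E).
  by move=> mh; apply/measurable_EFinP; exact: measurable_prod_tnth.
rewrite ge0_integral_tuple_cons; last 2 first.
- exact: mp.
- by move=> t; rewrite lee_fin prodr_ge0.
rewrite big_ord_recl -(IH (fun k => g (lift ord0 k)))//.
have I0 : (0 <= \int[tuple_lebesgue R n]_t (\prod_(k < n) g (lift ord0 k) (tnth t k))%:E)%E.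
  by apply: integral_ge0 => t _; rewrite lee_fin prodr_ge0.
rewrite -ge0_integralZr//; last 2 first.
- by apply/measurable_EFinP; exact: mg.
- by move=> x _; rewrite lee_fin.
apply: eq_integral => x _.
rewrite -ge0_integralZl//; last 3 first.
- exact: (mp n (fun k => g (lift ord0 k))).
- by move=> t _; rewrite lee_fin prodr_ge0.
- by rewrite lee_fin.
apply: eq_integral => t _; rewrite -EFinM; congr EFin.
rewrite big_ord_recl; congr (_ * _); apply: eq_bigr => k _.
by rewrite !(tnth_nth 0).
Qed.

Lemma measurable_angle_domain n : measurable (@angle_domain R n).
Proof.
rewrite (_ : @angle_domain R n = \bigcap_(k in [set: 'I_n]) ((fun t : n.-tuple R => tnth t k) @^-1` `]0%R, pi[)).
  apply: fin_bigcap_measurable => [|k _]; first exact: finite_finset.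
  by rewrite -[X in measurable X]setTI; apply: measurable_tnth.
apply/seteqP; split => t h k; first by move=> _ /=; rewrite in_itv/=; exact: h.
by have := h k Logic.I; rewrite /= in_itv.
Qed.

Lemma ge0_integral_prod_angle n (g : 'I_n -> R -> R) :
  (forall k, measurable_fun [set: R] (g k)) -> (forall k x, 0 <= g k x) ->
  (\int[tuple_lebesgue R n]_(t in @angle_domain R n) (\prod_(k < n) g k (tnth t k))%:E =
   \prod_(k < n) \int[mu]_(x in `]0%R, pi[) (g k x)%:E)%E.
Proof.
move=> mg g0.
have mI : measurable (`]0%R, pi[ : set R) by exact: measurable_itv.
(* The domain is a box, so its indicator splits into one factor per coordinate. *)
pose h k x := g k x * \1_(`]0%R, pi[ : set R) x.
have mh k : measurable_fun [set: R] (h k) by apply: measurable_funM => //; exact: measurable_indic.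
have h0 k x : 0 <= h k x by rewrite mulr_ge0.
rewrite integral_mkcond.
transitivity (\int[tuple_lebesgue R n]_t (\prod_(k < n) h k (tnth t k))%:E)%E.
  apply: eq_integral => t _; rewrite patchE; case: ifPn.
    rewrite inE => tD; congr EFin; apply: eq_bigr => k _.
    by rewrite /h indicE mem_set ?mulr1//= in_itv/=; exact: tD.
  move=> /negP tD; apply/eqP; rewrite eqe; apply/eqP.
  have [k hk] : exists k : 'I_n, ~ (0 < tnth t k < pi).
    by apply/existsNP => h1; apply: tD; rewrite inE.
  rewrite (bigD1 k)//= /h indicE memNset ?mulr0 ?mul0r//=.
rewrite ge0_integral_prod_tnth//; apply: eq_bigr => k _.
rewrite [RHS]integral_mkcond; apply: eq_integral => x _.
rewrite patchE /h indicE; case: ifP => _; first by rewrite mulr1.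
by rewrite mulr0.
Qed.

Lemma beta_int_rising a b i j : 0 <= a -> 0 <= b ->
  beta_int (a + i%:R) (b + j%:R) = beta_int a b * 2 ^+ (i + j)
    * rising (a + 2^-1) i * rising (b + 2^-1) j
    / rising (a + 2^-1 + (b + 2^-1)) (i + j) :> R.
Proof.
move=> a0 b0; have c0 : 0 < a + 2^-1 + (b + 2^-1) by lra.
have n0 k : (0 : R) <= k%:R by [].
elim: i j => [|i IH] j.
  elim: j => [|j IHj].
    by rewrite !addr0 !rising0 expr0 !mulr1 invr1 mulr1.
  rewrite -(natr1 j) [b + _]addrA beta_int_recr; last 2 first.
  - by rewrite addr_ge0.
  - by rewrite addr_ge0.
  rewrite IHj add0n addr0 !risingS rising0 exprS.
  have j0 := n0 j; have r0 := rising_gt0 j c0.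
  by field; rewrite !gt_eqF//; lra.
rewrite -(natr1 i) [a + _]addrA beta_int_recl; last 2 first.
- by rewrite addr_ge0.
- by rewrite addr_ge0.
rewrite IH addSn !risingS exprS natrD.
have i0 := n0 i; have j0 := n0 j; have r0 := rising_gt0 (i + j) c0.
by field; rewrite !gt_eqF//; lra.
Qed.

Lemma measurable_beta_weight a b : measurable_fun [set: R] (@beta_weight R a b).
Proof.
have mu_ := continuous_measurable_fun (@continuous_onem_cos R).
have mv := continuous_measurable_fun (@continuous_oneD_cos R).
have h1 := measurableT_comp (measurable_powR a) mu_.
have h2 := measurableT_comp (measurable_powR b) mv.
exact: (measurable_funM h1 h2).
Qed.

Lemma integral_beta_weight_oo a b : 0 <= a -> 0 <= b ->
  (\int[mu]_(x in `]0%R, pi[) (beta_weight a b x)%:E = (beta_int a b)%:E)%E.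
Proof.
move=> a0 b0.
rewrite -(@integral_itv_bndoo _ _ _ _ true false); last first.
  apply/measurable_EFinP; apply: measurable_funTS; exact: measurable_beta_weight.
rewrite -[LHS]fineK//.
by apply: integrable_fin_num => //; exact: integrable_beta_weight.
Qed.

(** Common form of [so_weight] and [usp_weight], with real exponents that can be shifted
    continuously. *)
Definition selberg_weight n a b (t : n.-tuple R) : R :=
  cos_vandermonde_sq t * \prod_(j < n) beta_weight a b (tnth t j).

(** Each pair contributes a sign, since differences of [1 - cos] and of [1 + cos] are opposite. With
    one determinant in each variable, expanding them only raises the two exponents of [beta_weight]
    by integers. *)
Lemma cos_vandermonde_sqE n (t : n.-tuple R) :
  cos_vandermonde_sq t = (\prod_(i < n) \prod_(j < n | (i < j)%N) (-1)) *
   (\det (\matrix_(k, i < n) (1 - cos (tnth t k)) ^+ i) *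
    \det (\matrix_(k, i < n) (1 + cos (tnth t k)) ^+ i)).
Proof.
rewrite !det_powers -!big_split/=; apply: eq_bigr => i _.
by rewrite -!big_split/=; apply: eq_bigr => j _; ring.
Qed.

Lemma selberg_weightE n a b (t : n.-tuple R) : 0 <= a -> 0 <= b ->
  selberg_weight a b t = (\prod_(i < n) \prod_(j < n | (i < j)%N) (-1)) *
   \sum_(s : 'S_n) \sum_(r : 'S_n) (-1) ^+ s * (-1) ^+ r *
     \prod_(k < n) beta_weight (a + (s k)%:R) (b + (r k)%:R) (tnth t k).
Proof.
move=> a0 b0; rewrite /selberg_weight cos_vandermonde_sqE -mulrA; congr (_ * _).
rewrite /determinant mulr_suml mulr_suml; apply: eq_bigr => s _.
rewrite mulr_sumr mulr_suml; apply: eq_bigr => r _.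
rewrite mulrACA -!mulrA; congr (_ * (_ * _)).
rewrite -!big_split/=; apply: eq_bigr => k _; rewrite !mxE /beta_weight.
have u0 := onem_cos_ge0 (tnth t k); have v0 := oneD_cos_ge0 (tnth t k).
have pE (u c : R) (m : nat) : 0 <= u -> 0 <= c -> u `^ (c + m%:R) = u `^ c * u ^+ m.
  move=> hu hc; elim: m => [|m IH]; first by rewrite addr0 mulr1.
  rewrite -(natr1 m) addrA powRD1//; last by rewrite addr_ge0.
  by rewrite IH exprS; ring.
by rewrite !pE//; ring.
Qed.

(** The expansion over two permutations has signs, so it is integrated term by term by
    integrability, and [sum_perm2_beta] evaluates it. [K] depends on [n] alone and is left implicit,
    as only ratios of these integrals are used. *)
Lemma selberg_integral n : exists K : R, forall a b, 0 <= a -> 0 <= b ->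
  (\int[tuple_lebesgue R n]_(t in @angle_domain R n) (selberg_weight a b t)%:E =
   (K * \prod_(i < n) (beta_int a b * rising (a + 2^-1) i * rising (b + 2^-1) i
      / rising (a + 2^-1 + (b + 2^-1)) (i + n.-1)))%:E)%E.
Proof.
have [K hK] := sum_perm2_beta R n.
exists ((\prod_(i < n) \prod_(j < n | (i < j)%N) (-1)) * K) => a b a0 b0.
have c0 : 0 < a + 2^-1 + (b + 2^-1) by lra.
pose B i j := beta_int (a + i%:R) (b + j%:R).
have mD := @measurable_angle_domain n.
pose f (s r : 'S_n) (t : n.-tuple R) : R :=
  \prod_(k < n) beta_weight (a + (s k)%:R) (b + (r k)%:R) (tnth t k).
have mf s r : measurable_fun [set: n.-tuple R] (f s r).
  exact: (measurable_prod_tnth (fun k => measurable_beta_weight (a + (s k)%:R) (b + (r k)%:R))).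
have f0 s r t : 0 <= f s r t by apply: prodr_ge0 => k _; exact: beta_weight_ge0.
have If s r : (\int[tuple_lebesgue R n]_(t in @angle_domain R n) (f s r t)%:E =
    (\prod_k B (s k) (r k))%:E)%E.
  rewrite (ge0_integral_prod_angle (fun k => measurable_beta_weight (a + (s k)%:R) (b + (r k)%:R))
    (fun k => beta_weight_ge0 (a + (s k)%:R) (b + (r k)%:R))) -prodEFin.
  by apply: eq_bigr => k _; rewrite integral_beta_weight_oo// addr_ge0.
have intf s r : (tuple_lebesgue R n).-integrable (@angle_domain R n) (EFin \o f s r).
  apply/integrableP; split; first by apply/measurable_EFinP; exact: measurable_funTS.
  rewrite (_ : (fun _ => _) = (fun t => (f s r t)%:E)); first by rewrite If ltry.
  by apply/funext => t /=; rewrite ger0_norm.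
have h (s r : 'S_n) : (tuple_lebesgue R n).-integrable (@angle_domain R n)
   (fun t => (((-1) ^+ s * (-1) ^+ r)%:E * (f s r t)%:E)%E).
  exact: (integrableZl mD _ (intf s r)).
have hs (s : 'S_n) : (tuple_lebesgue R n).-integrable (@angle_domain R n)
   (fun t => (\sum_(r : 'S_n) ((-1) ^+ s * (-1) ^+ r)%:E * (f s r t)%:E)%E).
  by apply: integrable_sum => // r _.
transitivity (\int[tuple_lebesgue R n]_(t in @angle_domain R n)
  ((\prod_(i < n) \prod_(j < n | (i < j)%N) (-1))%:E *
   \sum_(s : 'S_n) \sum_(r : 'S_n) ((-1) ^+ s * (-1) ^+ r)%:E * (f s r t)%:E))%E.
  apply: eq_integral => t _; rewrite selberg_weightE// EFinM; congr (_ * _)%E.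
  rewrite -sumEFin; apply: eq_bigr => s _; rewrite -sumEFin.
  by apply: eq_bigr => r _; rewrite EFinM.
rewrite integralZl//; last by apply: integrable_sum => // s _.
rewrite integral_sum//.
rewrite (eq_bigr (fun s : 'S_n => (\sum_(r : 'S_n)
    (-1) ^+ s * (-1) ^+ r * \prod_k B (s k) (r k))%:E)); last first.
  move=> s _; rewrite integral_sum// -sumEFin; apply: eq_bigr => r _.
  by rewrite (integralZl mD (intf s r)) If -EFinM.
rewrite sumEFin -EFinM (hK (beta_int a b) (a + 2^-1) (b + 2^-1) B)//.
  by rewrite mulrA.
by move=> i j; exact: beta_int_rising.
Qed.

End tuple_integral.

(** * Integration against a measure with a density *)

Section integral_density.
Context d (T : measurableType d) (R : realType).
Variables (mu nu : {measure set T -> \bar R}) (w : T -> R).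
Hypotheses (mw : measurable_fun [set: T] w) (w0 : forall x, 0 <= w x).
Hypothesis nuE : forall A, measurable A -> (nu A = \int[mu]_(x in A) (w x)%:E)%E.
Local Open Scope ereal_scope.
Import HBNNSimple.

Let nnsfun_density (h : {nnsfun T >-> R}) :
  \int[nu]_x (h x)%:E = \int[mu]_x ((h x)%:E * (w x)%:E).
Proof.
have mh r : measurable (h @^-1` [set r]) by [].
have mi r : measurable_fun [set: T] (fun x => (r * \1_(h @^-1` [set r]) x)%:E).
  by apply/measurable_EFinP; exact: measurable_funM.
have hE x : (h x)%:E = \sum_(r \in range h) (r * \1_(h @^-1` [set r]) x)%:E.
  by rewrite {1}fimfunE fsumEFin.
transitivity (\sum_(r \in range h) r%:E * nu (h @^-1` [set r])).
  under eq_integral do rewrite hE.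
  rewrite ge0_integral_fsum//; last by move=> r x _; exact: nnfun_muleindic_ge0.
  apply: eq_fsbigr => r _.
  by rewrite integralZl_indic_nnsfun// integral_indic// setIT.
transitivity (\int[mu]_x \sum_(r \in range h)
    (r * \1_(h @^-1` [set r]) x)%:E * (w x)%:E); last first.
  apply: eq_integral => x _; rewrite hE ge0_mule_fsuml// => r.
  exact: nnfun_muleindic_ge0.
rewrite ge0_integral_fsum//; last 2 first.
- by move=> r; apply: emeasurable_funM => //; exact/measurable_EFinP.
- by move=> r x _; rewrite mule_ge0 ?lee_fin ?w0// -lee_fin nnfun_muleindic_ge0.
apply: eq_fsbigr => r /[!inE] -[t _ <-].
rewrite nuE// integral_mkcond -ge0_integralZl//; last 3 first.
- apply/(measurable_restrict _ _ measurableT) => //; rewrite setTI.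
  by apply: measurable_funTS; exact/measurable_EFinP.
- by move=> x _; rewrite patchE; case: ifP => //; rewrite lee_fin.
- by rewrite lee_fin.
apply: eq_integral => x _; rewrite patchE indicE EFinM -muleA.
by case: ifP => _; rewrite ?mul1e ?mul0e.
Qed.

Lemma ge0_integral_density (f : T -> \bar R) :
  measurable_fun [set: T] f -> (forall x, 0 <= f x) ->
  \int[nu]_x f x = \int[mu]_x (f x * (w x)%:E).
Proof.
move=> mf f0; pose h := nnsfun_approx measurableT mf.
have hf x : (EFin \o h ^~ x) @ \oo --> f x by exact: cvg_nnsfun_approx.
have hnd x : {homo (fun n => h n x) : a b / (a <= b)%N >-> (a <= b)%R}.
  by move=> a b ab; exact/lefP/nd_nnsfun_approx.
transitivity (lim (\int[nu]_x (h n x)%:E @[n --> \oo])).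
  rewrite -monotone_convergence//.
  - by apply: eq_integral => x _; apply/esym/cvg_lim => //; exact: hf.
  - by move=> n; exact/measurable_EFinP.
  - by move=> n x _; rewrite lee_fin.
  - by move=> x _ a b ab; rewrite lee_fin; exact: hnd.
under eq_fun do rewrite nnsfun_density.
rewrite -monotone_convergence//.
- apply: eq_integral => x _; apply/cvg_lim => //; apply: cvgeZr => //.
  exact: hf.
- by move=> n; apply: emeasurable_funM; exact/measurable_EFinP.
- by move=> n x _; rewrite mule_ge0 ?lee_fin.
- by move=> x _ a b ab; rewrite lee_wpmul2r ?lee_fin//; exact: hnd.
Qed.

End integral_density.

(** * Joint exponential moments *)

Section selberg_moments.
Variable R : realType.
Local Notation mu := (@lebesgue_measure R).

(** The Selberg integral without the factor that depends on [n] alone. *)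
Definition selberg_product n (a b : R) : R :=
  \prod_(i < n) (beta_int a b * rising (a + 2^-1) i * rising (b + 2^-1) i
      / rising (a + 2^-1 + (b + 2^-1)) (i + n.-1)).

Lemma selberg_product_gt0 n a b : 0 <= a -> 0 <= b -> 0 < selberg_product n a b.
Proof.
move=> a0 b0; apply: prodr_gt0 => i _.
by rewrite divr_gt0 ?mulr_gt0 ?beta_int_gt0 ?rising_gt0//; lra.
Qed.

(** Regrouped so that [a] occurs only in beta integrals with one common second argument; the second
    product involves only [b] and [n], and cancels when [a] is shifted. *)
Lemma selberg_productEl n a b : 0 <= a -> 0 <= b ->
  selberg_product n a b = \prod_(i < n) beta_int (a + i%:R) (b + n.-1%:R) *
    \prod_(i < n) (rising (b + 2^-1) i / rising (b + 2^-1) n.-1 / 2 ^+ (i + n.-1)).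
Proof.
move=> a0 b0; rewrite -big_split/=; apply: eq_bigr => i _.
rewrite beta_int_rising//.
have r1 : 0 < rising (b + 2^-1) n.-1 by rewrite rising_gt0//; lra.
have r2 : 0 < rising (a + 2^-1 + (b + 2^-1)) (i + n.-1) by rewrite rising_gt0//; lra.
by field; rewrite expf_neq0 ?pnatr_eq0//= !gt_eqF.
Qed.

Lemma selberg_productEr n a b : 0 <= a -> 0 <= b ->
  selberg_product n a b = \prod_(i < n) beta_int (a + n.-1%:R) (b + i%:R) *
    \prod_(i < n) (rising (a + 2^-1) i / rising (a + 2^-1) n.-1 / 2 ^+ (i + n.-1)).
Proof.
move=> a0 b0; rewrite -big_split/=; apply: eq_bigr => i _.
rewrite beta_int_rising// (addnC n.-1).
have r1 : 0 < rising (a + 2^-1) n.-1 by rewrite rising_gt0//; lra.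
have r2 : 0 < rising (a + 2^-1 + (b + 2^-1)) (i + n.-1) by rewrite rising_gt0//; lra.
by field; rewrite expf_neq0 ?pnatr_eq0//= !gt_eqF.
Qed.

Lemma prodr_ratio n (f g : 'I_n -> R) : (forall i, 0 < f i) -> (forall i, 0 < g i) ->
  \prod_(i < n) f i = \prod_(i < n) g i * expR (\sum_(i < n) (ln (f i) - ln (g i))).
Proof.
move=> f0 g0; rewrite expR_sum -big_split/=; apply: eq_bigr => i _.
by rewrite expRB !lnK ?posrE// mulrC divfK// gt_eqF.
Qed.

Lemma selberg_product_shiftl n (a b s : R) : 0 <= a -> 0 <= b -> 0 <= s ->
  selberg_product n (a + s) b = selberg_product n a b *
    expR (\sum_(i < n) (ln (beta_int (a + i%:R + s) (b + n.-1%:R))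
                      - ln (beta_int (a + i%:R) (b + n.-1%:R)))).
Proof.
move=> a0 b0 s0; rewrite !selberg_productEl ?addr_ge0// mulrAC; congr (_ * _).
rewrite -prodr_ratio; last 2 first.
- by move=> i; rewrite beta_int_gt0 ?addr_ge0.
- by move=> i; rewrite beta_int_gt0 ?addr_ge0.
by apply: eq_bigr => i _; rewrite addrAC.
Qed.

Lemma selberg_product_shiftr n (a b t : R) : 0 <= a -> 0 <= b -> 0 <= t ->
  selberg_product n a (b + t) = selberg_product n a b *
    expR (\sum_(i < n) (ln (beta_int (a + n.-1%:R) (b + i%:R + t))
                      - ln (beta_int (a + n.-1%:R) (b + i%:R)))).
Proof.
move=> a0 b0 t0; rewrite !selberg_productEr ?addr_ge0// mulrAC; congr (_ * _).
rewrite -prodr_ratio; last 2 first.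
- by move=> i; rewrite beta_int_gt0 ?addr_ge0.
- by move=> i; rewrite beta_int_gt0 ?addr_ge0.
by apply: eq_bigr => i _; rewrite addrAC.
Qed.

(** The arguments of [beta_int] lie one half below those of Euler's beta function; this translates
    [beta_product_shift] accordingly. *)
Lemma beta_product_shift_half (a y1 : R) : 0 <= a -> 2^-1 <= y1 ->
  exists2 K, 0 <= K &
  forall (y s : R) n (G : R -> R), 2^-1 <= y <= y1 -> 0 <= s <= 1 ->
    (0 < n)%N ->
  (forall z, 0 <= z -> 0 < G z) ->
  (forall z, 0 <= z ->
    G (z + 1) = 2 * (z + 2^-1) / (z + 2^-1 + (y + n.-1%:R)) * G z) ->
  (forall s z, 0 <= s <= 1 -> 0 <= z ->
    ln (G (z + s)) - ln (G z) <= s * (ln (G (z + 1)) - ln (G z))) ->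
  `|\sum_(i < n) (ln (G (a + i%:R + s)) - ln (G (a + i%:R))) + n%:R * (s * ln 2)
    - (s * (a - 2^-1) + s ^+ 2 / 2) * ln n%:R| <= K * s.
Proof.
move=> a0 hy1; have [|K K0 hK] := @beta_product_shift R (a + 2^-1) y1 _ hy1; first lra.
exists K => // y s n G hy s01 n0 G0 Grec Gi.
have sh (u v : R) : u + 2^-1 + v - 2^-1 = u + v by ring.
have hz (z : R) : 2^-1 <= z -> 0 <= z - 2^-1 by rewrite subr_ge0.
have := hK y s n (fun z => G (z - 2^-1)) hy s01 n0.
rewrite (eq_bigr (fun i : 'I_n => ln (G (a + i%:R + s)) - ln (G (a + i%:R)))); last first.
  by move=> i _; rewrite -[a + 2^-1 + _ + s]addrA !sh addrA.
rewrite (_ : a + 2^-1 - 1 = a - 2^-1); last lra.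
apply => [z /hz|z /hz|u z hu /hz] h; first exact: G0.
  by rewrite addrAC Grec// subrK.
by rewrite !(addrAC z _ (- 2^-1)); exact: Gi.
Qed.

(** The exponents are shifted one at a time. The effect of one shift depends on the other exponent
    only within the error, so there is no cross term in [s] and [t]: this is the source of
    independence in the limit. *)
Lemma selberg_product_asymptotics (a b : R) : 0 <= a -> 0 <= b ->
  exists2 K, 0 <= K & forall n s t, (0 < n)%N -> 0 <= s <= 1 -> 0 <= t <= 1 ->
  exists2 L, selberg_product n (a + s) (b + t) = selberg_product n a b * expR L &
  `|L + n%:R * ((s + t) * ln 2)
    - (s * (a - 2^-1) + s ^+ 2 / 2 + (t * (b - 2^-1) + t ^+ 2 / 2)) * ln n%:R|
   <= K * (s + t).
Proof.
move=> a0 b0.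
(* The shift of [a] takes place at second exponent [b + t] with [t <= 1], hence a range up to
   [b + 2^-1 + 1]. *)
have [|K1 K10 h1] := @beta_product_shift_half a (b + 2^-1 + 1) a0; first lra.
have [|K2 K20 h2] := @beta_product_shift_half b (a + 2^-1) b0; first lra.
exists (K1 + K2) => [|n s t n0 s01 t01]; first lra.
have s0 : 0 <= s by lra.
have t0 : 0 <= t by lra.
have bt0 : 0 <= b + t by lra.
have np : (0 : R) <= n.-1%:R by [].
have bn0 : 0 <= b + t + n.-1%:R by lra.
have an0 : 0 <= a + n.-1%:R by lra.
rewrite selberg_product_shiftl// selberg_product_shiftr// -mulrA -expRD.
eexists; first by [].
have hy1 : 2^-1 <= b + t + 2^-1 <= b + 2^-1 + 1 by lra.
have hy2 : 2^-1 <= a + 2^-1 <= a + 2^-1 by lra.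
have p1 : 0 <= K1 * t by rewrite mulr_ge0.
have p2 : 0 <= K2 * s by rewrite mulr_ge0.
have addB (S1 S2 x l u v : R) : `|S1 + x * (s * l) - u| <= K1 * s ->
    `|S2 + x * (t * l) - v| <= K2 * t ->
    `|S2 + S1 + x * ((s + t) * l) - (u + v)| <= (K1 + K2) * (s + t).
  by rewrite !ler_norml; lra.
rewrite [X in _ - X]mulrDl; apply: addB.
  apply: (h1 (b + t + 2^-1) s n (fun z => beta_int z (b + t + n.-1%:R)) hy1 s01 n0
    (fun z hz => beta_int_gt0 hz bn0) _ (fun u z hu hz => beta_int_interpl hu hz bn0)).
  by move=> z hz; rewrite beta_int_recl// (addrAC _ n.-1%:R).
apply: (h2 (a + 2^-1) t n (fun z => beta_int (a + n.-1%:R) z) hy2 t01 n0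
  (fun z hz => beta_int_gt0 an0 hz) _ (fun u z hu hz => beta_int_interpr hu an0 hz)).
by move=> z hz; rewrite beta_int_recr// (addrAC a n.-1%:R) (addrC (z + 2^-1)).
Qed.

Lemma selberg_weight_ge0 n a b (t : n.-tuple R) : 0 <= selberg_weight a b t.
Proof.
apply: mulr_ge0; last by apply: prodr_ge0 => j _; exact: beta_weight_ge0.
by apply: prodr_ge0 => k _; apply: prodr_ge0 => l _; exact: sqr_ge0.
Qed.

Lemma measurable_selberg_weight n a b :
  measurable_fun [set: n.-tuple R] (@selberg_weight R n a b).
Proof.
have mc (k : 'I_n) : measurable_fun [set: n.-tuple R] (fun t : n.-tuple R => cos (tnth t k)).
  apply: (@measurableT_comp _ _ _ _ _ _ (@cos R) _ (fun t : n.-tuple R => tnth t k)).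
    by apply: continuous_measurable_fun; exact: continuous_cos.
  exact: measurable_tnth.
apply: measurable_funM.
  apply: measurable_prod => k _.
  rewrite (_ : (fun _ => _) = (fun t : n.-tuple R => \prod_(l < n)
      (if (k < l)%N then (cos (tnth t k) - cos (tnth t l)) ^+ 2 else 1))).
    apply: measurable_prod => l _; case: (k < l)%N; last exact: measurable_cst.
    by apply: measurable_funX; apply: measurable_funB.
  by apply/funext => t; rewrite big_mkcond.
exact: (measurable_prod_tnth (fun k => measurable_beta_weight a b)).
Qed.

(* Up to the factor [2 ^ n], [prod_onem] and [prod_oneD] are the values at [1]
   and [-1] of the product of the factors of the characteristic polynomial that
   do not vanish there. *)
Definition prod_onem n (t : n.-tuple R) : R := \prod_(k < n) (1 - cos (tnth t k)).
Definition prod_oneD n (t : n.-tuple R) : R := \prod_(k < n) (1 + cos (tnth t k)).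

Lemma measurable_prod_onem n : measurable_fun [set: n.-tuple R] (@prod_onem n).
Proof.
exact: (measurable_prod_tnth (fun k => continuous_measurable_fun (@continuous_onem_cos R))).
Qed.

Lemma measurable_prod_oneD n : measurable_fun [set: n.-tuple R] (@prod_oneD n).
Proof.
exact: (measurable_prod_tnth (fun k => continuous_measurable_fun (@continuous_oneD_cos R))).
Qed.

Lemma selberg_weight_shift n a b s u (t : n.-tuple R) : @angle_domain R n t ->
  expR (s * ln (prod_onem t) + u * ln (prod_oneD t)) * selberg_weight a b t =
  selberg_weight (a + s) (b + u) t.
Proof.
move=> tD; have h k := onemD_cos_gt0 (tD k).
have lnprod (f : 'I_n -> R) : (forall k, 0 < f k) ->
    ln (\prod_k f k) = \sum_k ln (f k).
  move=> f0; apply: expR_inj; rewrite lnK ?posrE ?prodr_gt0// expR_sum.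
  by apply: eq_bigr => k _; rewrite lnK ?posrE.
rewrite /prod_onem /prod_oneD (lnprod _ (fun k => (h k).1)) (lnprod _ (fun k => (h k).2)).
rewrite !mulr_sumr -big_split/= expR_sum mulrCA /selberg_weight; congr (_ * _).
rewrite -big_split/=; apply: eq_bigr => k _; have [u0 v0] := h k.
have nu := lt0r_neq0 u0; have nv := lt0r_neq0 v0.
rewrite /beta_weight !powRD ?nu ?nv ?implybT//.
by rewrite expRD /powR !gt_eqF//; ring.
Qed.

End selberg_moments.

(** * Exponential moments of the random angles at fixed size *)

Section moments_of_angles.
Context (R : realType) d (T : measurableType d) (P : probability T R).
Variables (n : nat) (theta : {RV P >-> n.-tuple R}) (a b : R).
Hypotheses (a0 : 0 <= a) (b0 : 0 <= b).
Hypothesis hdens : density_proportional theta (@angle_domain R n)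
  (@selberg_weight R n a b).
Local Open Scope ereal_scope.

Let mD := @measurable_angle_domain R n.

Lemma ge0_integral_angles : exists2 c : R, (0 < c)%R &
  forall f : n.-tuple R -> R,
    measurable_fun [set: n.-tuple R] f -> (forall t, 0 <= f t)%R ->
  \int[P]_x (f (theta x))%:E = c%:E *
  \int[tuple_lebesgue R n]_(t in @angle_domain R n) (f t * selberg_weight a b t)%:E.
Proof.
have [c c0 hc] := hdens; exists c => // f mf f0.
pose w t : R := (c * selberg_weight a b t * \1_(@angle_domain R n) t)%R.
have mw : measurable_fun [set: n.-tuple R] w.
  apply: measurable_funM; last exact: measurable_indic.
  by apply: measurable_funM => //; exact: measurable_selberg_weight.
have w0 t : (0 <= w t)%R.
  by rewrite mulr_ge0// mulr_ge0 ?(ltW c0)// selberg_weight_ge0.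
rewrite -(ge0_integral_distribution theta (f := fun t => (f t)%:E))//; last first.
  exact/measurable_EFinP.
rewrite (ge0_integral_density (mu := tuple_lebesgue R n) mw w0); last 3 first.
- move=> A mA; rewrite [LHS](hc A mA) integral_mkcondr; apply: eq_integral => t _.
  by rewrite patchE /w indicE; case: ifP => _; rewrite ?mulr1 ?mulr0.
- exact/measurable_EFinP.
- by [].
rewrite -ge0_integralZl//; last 3 first.
- apply/measurable_EFinP; apply: measurable_funTS; apply: measurable_funM => //.
  exact: measurable_selberg_weight.
- by move=> t _; rewrite lee_fin mulr_ge0// selberg_weight_ge0.
- by rewrite lee_fin ltW.
rewrite [RHS]integral_mkcond; apply: eq_integral => t _.
rewrite patchE /w indicE; case: ifP => _; last by rewrite mulr0 mule0.
by rewrite mulr1 -!EFinM; congr EFin; ring.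
Qed.

Lemma moment_angles (s u : R) : (0 <= s)%R -> (0 <= u)%R ->
  \int[P]_x (expR (s * ln (prod_onem (theta x)) + u * ln (prod_oneD (theta x))))%:E
  = (selberg_product n (a + s) (b + u) / selberg_product n a b)%:E.
Proof.
move=> s0 u0; have [c c0 hc] := ge0_integral_angles.
have [K hK] := selberg_integral R n.
have p0 := selberg_product_gt0 n a0 b0.
(* Total mass one determines the product of the two unknown constants, which is all that enters the
   moments. *)
have cK : (c * K * selberg_product n a b = 1)%R.
  have := hc (cst 1%R) (measurable_cst _) (fun=> ler01).
  rewrite /= integral_cst// [X in (_ * X)%E]probability_setT mule1.
  under eq_integral do rewrite mul1r.
  by rewrite hK// -EFinM mulrA => -[].
pose f (t : n.-tuple R) : R := expR (s * ln (prod_onem t) + u * ln (prod_oneD t)).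
have mf : measurable_fun [set: n.-tuple R] f.
  apply: (measurableT_comp (@measurable_expR R)); apply: measurable_funD.
    apply: measurable_funM => //.
    exact: (measurableT_comp (@measurable_ln R) (@measurable_prod_onem R n)).
  apply: measurable_funM => //.
  exact: (measurableT_comp (@measurable_ln R) (@measurable_prod_oneD R n)).
rewrite (hc f mf (fun t => expR_ge0 _)).
rewrite (eq_integral (fun t => (selberg_weight (a + s) (b + u) t)%:E)); last first.
  by move=> t /[!inE] tD; rewrite /f selberg_weight_shift.
rewrite hK ?addr_ge0// -EFinM; congr EFin.
rewrite -/(selberg_product n (a + s) (b + u)).
by apply/eqP; rewrite eq_sym -[eqbLHS]mul1r -cK; apply/eqP; field; rewrite gt_eqF.
Qed.

(** The law of [theta] charges only [angle_domain]. This permits identities between logarithms of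
    products that hold only when all factors are positive. *)
Lemma eq_integral_angles (f g : n.-tuple R -> R) :
  measurable_fun [set: n.-tuple R] f -> measurable_fun [set: n.-tuple R] g ->
  (forall t, 0 <= f t)%R -> (forall t, 0 <= g t)%R ->
  (forall t, @angle_domain R n t -> f t = g t) ->
  \int[P]_x (f (theta x))%:E = \int[P]_x (g (theta x))%:E.
Proof.
move=> mf mg f0 g0 fg; have [c _ hc] := ge0_integral_angles.
rewrite !hc//; congr (_ * _).
by apply: eq_integral => t /[!inE] tD; rewrite fg.
Qed.

End moments_of_angles.

(** * Limit of the exponential moments of the normalised pair *)

Section mgf_limit.
Variable R : realType.

Lemma cvg_inv_sqrt_ln : (Num.sqrt (ln n%:R))^-1 @[n --> \oo] --> (0 : R).
Proof.
apply/cvgrPdist_lt => e e0.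
have [N hN] : exists N : nat, expR (e ^- 2) < N%:R.
  by exists (Num.truncn (expR (e ^- 2))).+1; exact: truncnS_gt.
near=> n.
have nN : expR (e ^- 2) < n%:R.
  by apply: lt_le_trans hN _; rewrite ler_nat; near: n; exact: nbhs_infty_ge.
have n0 : (0 : R) < n%:R by apply: lt_trans nN; exact: expR_gt0.
have ln0 : e ^- 2 < ln n%:R by rewrite -ltr_expR lnK.
have i0 : 0 < e ^- 2 by rewrite invr_gt0 exprn_gt0.
rewrite sub0r normrN ger0_norm ?invr_ge0 ?sqrtr_ge0//.
have lnp : 0 < ln n%:R :> R := lt_trans i0 ln0.
rewrite invf_plt ?posrE ?sqrtr_gt0//.
have -> : e^-1 = Num.sqrt (e ^- 2).
  by rewrite -exprVn sqrtr_sqr ger0_norm// invr_ge0 ltW.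
by rewrite ltr_sqrt.
Unshelve. all: by end_near. Qed.

Context (d : nat -> measure_display) (T : forall n, measurableType (d n))
  (P : forall n, probability (T n) R) (theta : forall n, {RV (P n) >-> n.-tuple R}).
Variables (a b C1 C2 : R).
Hypotheses (a0 : 0 <= a) (b0 : 0 <= b) (C10 : 0 < C1) (C20 : 0 < C2).
Hypothesis hdens : forall n, (0 < n)%N ->
  density_proportional (theta n) (@angle_domain R n) (@selberg_weight R n a b).

Let U n (t : n.-tuple R) := normalized_log (a - 2^-1) n (C1 * 2 ^+ n * prod_onem t).
Let V n (t : n.-tuple R) := normalized_log (b - 2^-1) n (C2 * 2 ^+ n * prod_oneD t).

Lemma measurable_normalized_log (c : R) n : measurable_fun [set: R] (normalized_log c n).
Proof.
by apply: measurable_funM => //; apply: measurable_funB.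
Qed.

Lemma measurable_normalized_prod_onem (c C : R) n :
  measurable_fun [set: n.-tuple R] (fun t => normalized_log c n (C * 2 ^+ n * prod_onem t)).
Proof.
apply: (measurableT_comp (measurable_normalized_log c n)).
by apply: measurable_funM => //; exact: measurable_prod_onem.
Qed.

Lemma measurable_normalized_prod_oneD (c C : R) n :
  measurable_fun [set: n.-tuple R] (fun t => normalized_log c n (C * 2 ^+ n * prod_oneD t)).
Proof.
apply: (measurableT_comp (measurable_normalized_log c n)).
by apply: measurable_funM => //; exact: measurable_prod_oneD.
Qed.

Lemma mgf_angles_cvg (l m : R) : 0 <= l -> 0 <= m ->
  ((\int[P n]_x (expR (l * U (theta n x) + m * V (theta n x)))%:E)%E @[n --> \oo]
    --> (expR ((l ^+ 2 + m ^+ 2) / 2))%:E).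
Proof.
move=> l0 m0; have [K K0 hK] := selberg_product_asymptotics a0 b0.
pose r n : R := (Num.sqrt (ln n%:R))^-1.
pose K' := (K * (l + m) + l * `|ln C1| + m * `|ln C2|).
(* The exponent gets a value for every [n], by default 0 for the finitely many [n] at which the
   shifts exceed 1, so that choice yields a sequence. *)
have hE n : exists E : R, (1 < n)%N -> l * r n <= 1 -> m * r n <= 1 ->
    (\int[P n]_x (expR (l * U (theta n x) + m * V (theta n x)))%:E)%E = (expR E)%:E /\
    `|E - (l ^+ 2 + m ^+ 2) / 2| <= K' * r n.
  have [[n1 ls ms]|] := pselect [/\ (1 < n)%N, l * r n <= 1 & m * r n <= 1]; last first.
    by move=> h; exists 0 => h1 h2 h3; exfalso; apply: h.
  have n0 : (0 < n)%N by exact: ltnW.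
  have ln0 : 0 < ln n%:R :> R by rewrite ln_gt0// ltr1n.
  have r0 : 0 < r n by rewrite invr_gt0 sqrtr_gt0.
  have r2 : r n ^+ 2 * ln n%:R = 1.
    by rewrite /r exprVn sqr_sqrtr ?(ltW ln0)// mulVf// gt_eqF.
  have s01 : 0 <= l * r n <= 1 by rewrite ls mulr_ge0// ltW.
  have t01 : 0 <= m * r n <= 1 by rewrite ms mulr_ge0// ltW.
  have [L LE Lb] := hK n (l * r n) (m * r n) n0 s01 t01.
  have p0 := selberg_product_gt0 n a0 b0.
  pose c := l * r n * (ln C1 + n%:R * ln 2 - (a - 2^-1) * ln n%:R)
          + m * r n * (ln C2 + n%:R * ln 2 - (b - 2^-1) * ln n%:R).
  exists (c + L) => _ _ _; split.
    rewrite (@eq_integral_angles _ _ _ (P n) n (theta n) a b (hdens n0)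
      (fun t => expR (l * U t + m * V t))
      (fun t => expR c * expR (l * r n * ln (prod_onem t) + m * r n * ln (prod_oneD t)))).
    - under eq_integral do rewrite EFinM.
      have mom := moment_angles a0 b0 (hdens n0) (andP s01).1 (andP t01).1.
      rewrite ge0_integralZl//; last first.
        apply/measurable_EFinP; apply: (measurableT_comp (@measurable_expR R)).
        apply: measurable_funD; apply: measurable_funM => //.
          apply: (measurableT_comp (measurableT_comp (@measurable_ln R) (@measurable_prod_onem R n))).
          exact: measurable_funP.
        apply: (measurableT_comp (measurableT_comp (@measurable_ln R) (@measurable_prod_oneD R n))).
        exact: measurable_funP.
      by rewrite mom LE mulrAC divff ?gt_eqF// mul1r -EFinM -expRD.
    - apply: (measurableT_comp (@measurable_expR R)).
      by apply: measurable_funD; apply: measurable_funM => //;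
        [exact: measurable_normalized_prod_onem|exact: measurable_normalized_prod_oneD].
    - apply: measurable_funM => //; apply: (measurableT_comp (@measurable_expR R)).
      apply: measurable_funD; apply: measurable_funM => //.
        exact: (measurableT_comp (@measurable_ln R) (@measurable_prod_onem R n)).
      exact: (measurableT_comp (@measurable_ln R) (@measurable_prod_oneD R n)).
    - by move=> t; exact: expR_ge0.
    - by move=> t; rewrite mulr_ge0 ?expR_ge0.
    - move=> t tD; rewrite -expRD; congr expR.
      have p1 : 0 < prod_onem t by apply: prodr_gt0 => k _; have [] := onemD_cos_gt0 (tD k).
      have p2 : 0 < prod_oneD t by apply: prodr_gt0 => k _; have [] := onemD_cos_gt0 (tD k).
      have e2 : 0 < (2 : R) ^+ n by rewrite exprn_gt0.
      rewrite /U /V /normalized_log -/(r n) !lnM ?posrE ?mulr_gt0// lnXn// -(mulr_natl (ln 2)) /c.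
      by ring.
  (* The deterministic part [c] cancels the terms in [n%:R * ln 2] and the centring terms of the
     expansion of [L]. Since [r n ^+ 2 * ln n%:R = 1], the last summand vanishes. *)
  have -> : c + L - (l ^+ 2 + m ^+ 2) / 2 =
    (L + n%:R * ((l * r n + m * r n) * ln 2)
    - (l * r n * (a - 2^-1) + (l * r n) ^+ 2 / 2
       + (m * r n * (b - 2^-1) + (m * r n) ^+ 2 / 2)) * ln n%:R) +
     l * r n * ln C1 + m * r n * ln C2 + (l ^+ 2 + m ^+ 2) / 2 * (r n ^+ 2 * ln n%:R - 1).
    by rewrite /c; field.
  rewrite r2 subrr mulr0 addr0 /K'.
  have h1 : `|l * r n * ln C1| <= l * `|ln C1| * r n.
    by rewrite !normrM (ger0_norm l0) (gtr0_norm r0) mulrAC.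
  have h2 : `|m * r n * ln C2| <= m * `|ln C2| * r n.
    by rewrite !normrM (ger0_norm m0) (gtr0_norm r0) mulrAC.
  apply: le_trans (ler_normD _ _) _.
  rewrite [leRHS]mulrDl; apply: lerD => //.
  apply: le_trans (ler_normD _ _) _.
  rewrite [leRHS]mulrDl; apply: lerD => //.
  by apply: le_trans Lb _; rewrite -mulrDl mulrA.
have [E hEE] := choice hE.
have rc : r n @[n --> \oo] --> (0 : R) by exact: cvg_inv_sqrt_ln.
have small (x : R) : 0 <= x -> \forall n \near \oo, x * r n <= 1.
  move=> x0; have : x * r n @[n --> \oo] --> (x * 0 : R) by apply: cvgMr.
  rewrite mulr0 => /cvgrPdist_lt /(_ _ ltr01); apply: filterS => n.
  by rewrite sub0r normrN => /ltW; exact: le_trans (ler_norm _).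
have Ec : E n @[n --> \oo] --> (l ^+ 2 + m ^+ 2) / 2.
  have : K' * r n @[n --> \oo] --> (K' * 0 : R) by apply: cvgMr.
  rewrite mulr0 => /cvgrPdist_lt kr.
  apply/cvgrPdist_lt => e e0; near=> n.
  have [||| _ h] := hEE n; first by near: n; exact: nbhs_infty_gt.
  - by near: n; exact: small.
  - by near: n; exact: small.
  rewrite distrC; apply: le_lt_trans h _.
  apply: le_lt_trans (ler_norm _) _.
  by rewrite -normrN -sub0r; near: n; exact: kr.
apply: (@cvg_trans _ ((expR (E n))%:E @[n --> \oo])).
  apply: near_eq_cvg; near=> n.
  have [||| -> //] := hEE n; first by near: n; exact: nbhs_infty_gt.
  - by near: n; exact: small.
  - by near: n; exact: small.
have Xc : expR (E n) @[n --> \oo] --> expR ((l ^+ 2 + m ^+ 2) / 2).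
  exact: (cvg_comp _ _ Ec (@continuous_expR R _)).
by apply/fine_cvgP; split; [near=> n|exact: Xc].
Unshelve. all: by end_near. Qed.

End mgf_limit.

(** * Convergence in law from one-sided exponential moments *)

Section continuous_measurable_prod.
Variable R : realType.

(** Squares with rational centres and radii [1 / (k + 1)] form a countable base of the plane. *)
Lemma open_measurable_prod (U : set (R * R)) : open U -> measurable U.
Proof.
move=> oU.
pose B (i : rat * rat * nat) : set (R * R) :=
  ball (ratr i.1.1 : R) i.2.+1%:R^-1 `*` ball (ratr i.1.2 : R) i.2.+1%:R^-1.
have -> : U = \bigcup_(i in [set i | B i `<=` U]) B i.
  apply/seteqP; split => [[u v] Uuv|p [i /= BU]]; last exact: BU.
  have := open_nbhs_nbhs (conj oU Uuv); rewrite -nbhs_ballE => -[e /= e0 be].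
  pose k := Num.truncn (2 / e).
  have k1 : 2 / e < k.+1%:R by exact: truncnS_gt.
  have r0 : (0 : R) < k.+1%:R^-1 by [].
  have ke : k.+1%:R^-1 < e / 2.
    by rewrite invf_plt ?posrE ?divr_gt0// invf_div.
  have rat_near (x : R) : exists q : rat, `|ratr q - x| < k.+1%:R^-1.
    have [|q] := @rat_in_itvoo R (x - k.+1%:R^-1) (x + k.+1%:R^-1).
      by rewrite ltrBlDr -addrA ltrDl addr_gt0.
    rewrite in_itv/= => /andP[q1 q2]; exists q.
    by rewrite ltr_distl q1 q2.
  have [p hp] := rat_near u; have [q hq] := rat_near v.
  exists (p, q, k); last by split; rewrite /ball/=.
  move=> [x y] [/= hx hy]; apply: be; split; rewrite /ball/=.
    apply: le_lt_trans (ler_distD (ratr p) _ _) _.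
    by rewrite distrC in hp; rewrite (splitr e) ltrD ?(lt_trans hp)// (lt_trans hx).
  apply: le_lt_trans (ler_distD (ratr q) _ _) _.
  by rewrite distrC in hq; rewrite (splitr e) ltrD ?(lt_trans hq)// (lt_trans hy).
rewrite bigcup_mkcond; apply: countable_bigcupT_measurable => // i.
case: ifP => _; last exact: measurable0.
by apply: measurableX; exact: measurable_ball.
Qed.

Lemma continuous_measurable_prod (f : R * R -> R) :
  continuous f -> measurable_fun [set: R * R] f.
Proof.
move=> cf; apply: (measurability _ (RGenOpens.measurableE R)) => _ [_ [a [b ->] <-]].
rewrite setTI; apply: open_measurable_prod.
by move/continuousP : cf => /(_ _ (interval_open _ _)); apply.
Qed.

End continuous_measurable_prod.

(** * Powers of cosines summed over equally spaced nodes *)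

Section cosine_kernel.
Variable R : realType.

Lemma mul_cos (x y : R) : cos x * cos y = 2^-1 * (cos (x + y) + cos (x - y)).
Proof. by rewrite cosD cosB; field. Qed.

(** Real form of the binomial expansion of [((e^(iy) + e^(-iy)) / 2)^p], by Pascal's rule. *)
Lemma cos_exprn (y : R) p : cos y ^+ p =
  2^-1 ^+ p * \sum_(i < p.+1) 'C(p, i)%:R * cos ((p%:R - 2 * i%:R) * y).
Proof.
elim: p => [|p IH].
  by rewrite big_ord_recl big_ord0 /= !expr0 mulr0 subr0 mul0r cos0 bin0; ring.
pose c (i : nat) : R := cos ((p.+1%:R - 2 * i%:R) * y).
have step : (\sum_(i < p.+1) 'C(p, i)%:R * cos ((p%:R - 2 * i%:R) * y)) * cos y =
    2^-1 * (\sum_(i < p.+1) 'C(p, i)%:R * c i + \sum_(i < p.+1) 'C(p, i)%:R * c i.+1).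
  rewrite -big_split/= mulr_suml mulr_sumr; apply: eq_bigr => i _.
  rewrite -mulrA mul_cos mulrCA -mulrDr /c -(natr1 p) -(natr1 i).
  congr (_ * (_ * (cos _ + cos _))); ring.
have pascal : \sum_(i < p.+2) 'C(p.+1, i)%:R * c i =
    \sum_(i < p.+1) 'C(p, i)%:R * c i + \sum_(i < p.+1) 'C(p, i)%:R * c i.+1.
  have -> : \sum_(i < p.+1) 'C(p, i)%:R * c i = \sum_(i < p.+2) 'C(p, i)%:R * c i.
    by rewrite [RHS]big_ord_recr/= bin_small// mul0r addr0.
  rewrite [LHS]big_ord_recl [X in _ = X + _]big_ord_recl/= !bin0 -addrA; congr (_ + _).
  rewrite -big_split/=; apply: eq_bigr => i _.
  by rewrite /bump/= add1n binS natrD mulrDl.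
by rewrite exprSr IH -mulrA step pascal mulrA -exprSr.
Qed.

(** Multiplied by [2 * sin a], the sum telescopes, and its two end terms differ by [l] full periods.
    The condition on [l] ensures [sin a != 0]. *)
Lemma sum_cos_nodes (l N : nat) (b : R) : (0 < l < N)%N ->
  \sum_(j < N) cos (b - 2 * (l%:R * pi / N%:R) * j%:R) = 0.
Proof.
move=> /andP[l0 lN]; set a := l%:R * pi / N%:R.
have N0 : (0 : R) < N%:R by rewrite ltr0n (leq_trans _ lN).
have sa : 0 < sin a.
  apply: sin_gt0_pi; apply/andP; split.
    by rewrite divr_gt0// mulr_gt0 ?pi_gt0// ltr0n.
  by rewrite ltr_pdivrMr// mulrC ltr_pM2l ?pi_gt0// ltr_nat.
have tele n : 2 * sin a * \sum_(j < n) cos (b - 2 * a * j%:R) =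
    sin (b + a) - sin (b + a - 2 * a * n%:R).
  elim: n => [|n IH]; first by rewrite big_ord0 !mulr0 subr0 subrr.
  rewrite big_ord_recr/= mulrDr IH -(natr1 n).
  have -> : b + a - 2 * a * n%:R = (b - 2 * a * n%:R) + a by ring.
  have -> : b + a - 2 * a * (n%:R + 1) = (b - 2 * a * n%:R) - a by ring.
  by rewrite (sinD (b - 2 * a * n%:R)) (sinB (b - 2 * a * n%:R)); ring.
have s0 : 2 * sin a != 0 by exact/lt0r_neq0/mulr_gt0.
apply: (mulfI s0); rewrite tele mulr0.
have e : b + a = b + a - 2 * a * N%:R + (pi *+ 2) *+ l.
  by rewrite /a -[pi *+ 2 *+ l]mulr_natr -[pi *+ 2]mulr_natr; field; rewrite gt_eqF.
by rewrite {1}e (periodicn (@sinD2pi R)) subrr.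
Qed.

(** Mean of [((1 + cos x) / 2) ^ m] over a period. *)
Definition fejer_mean m : R := 'C(2 * m, m)%:R / 4 ^+ m.

Lemma fejer_mean_gt0 m : 0 < fejer_mean m.
Proof. by rewrite divr_gt0 ?exprn_gt0// ltr0n bin_gt0 leq_pmull. Qed.

(** As [1 - cos x = 2 * (1 - (1 + cos x) / 2)], the left-hand side is the mean of [1 - cos] under
    the normalised kernel. Its decay measures how the kernel concentrates. *)
Lemma fejer_meanS m : 2 * (1 - fejer_mean m.+1 / fejer_mean m) = m.+1%:R^-1.
Proof.
have b0 : 'C(2 * m, m)%:R != 0 :> R by rewrite pnatr_eq0 -lt0n bin_gt0 leq_pmull.
have m0 : m.+1%:R != 0 :> R by rewrite pnatr_eq0.
have bE : m.+1%:R * 'C(2 * m.+1, m.+1)%:R = 2 * (2 * m%:R + 1) * 'C(2 * m, m)%:R :> R.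
  have e1 : (m.+1 * 'C(2 * m.+1, m.+1) = 2 * (2 * m).+1 * 'C(2 * m, m))%N.
    have h1 := mul_bin_diag (2 * m).+2 m; rewrite /= in h1.
    have h2 := mul_bin_down (2 * m).+1 m; rewrite /= in h2.
    have e2 : (2 * m.+1 = (2 * m).+2)%N by rewrite mulnS.
    have e3 : ((2 * m).+1 - m = m.+1)%N by rewrite mul2n -addnn -addnS addKn.
    by rewrite e2 -h1 -e2 -mulnA -[in RHS]mulnA h2 e3.
  by rewrite -natrM e1 !natrM -(natr1 (2 * m)) natrM.
have -> : fejer_mean m.+1 / fejer_mean m = (2 * m%:R + 1) / (2 * m.+1%:R).
  rewrite /fejer_mean exprSr; apply: (mulfI m0).
  transitivity (m.+1%:R * 'C(2 * m.+1, m.+1)%:R / (4 * 'C(2 * m, m)%:R) : R).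
    by field; rewrite b0 expf_neq0// pnatr_eq0.
  have m1 : m%:R + 1 != 0 :> R by rewrite natr1.
  by rewrite bE -(natr1 m); field; rewrite b0 m1.
by rewrite -(natr1 m) in m0 *; field.
Qed.

(** The frequencies that occur are at most [m] in absolute value, and with [N > m] nodes every
    nonzero one sums to zero. The mean over the nodes is thus exactly the mean over a period,
    whatever the phase [b]. *)
Lemma sum_fejer m N (b : R) : (m < N)%N ->
  \sum_(j < N) ((1 + cos (b - 2 * pi / N%:R * j%:R)) / 2) ^+ m = N%:R * fejer_mean m.
Proof.
move=> mN.
have N0 : N%:R != 0 :> R by rewrite pnatr_eq0 -lt0n (leq_trans _ mN).
have half (x : R) : ((1 + cos x) / 2) ^+ m =
    4^-1 ^+ m * \sum_(i < (2 * m).+1) 'C(2 * m, i)%:R * cos ((m%:R - i%:R) * x).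
  have -> : (1 + cos x) / 2 = cos (x / 2) ^+ 2.
    by rewrite {1}[x]splitr -mulr2n cos_mulr2n mulr2n; field.
  rewrite -exprM cos_exprn; congr (_ * _); first by rewrite exprM; congr (_ ^+ _); field.
  apply: eq_bigr => i _; rewrite natrM; congr (_ * cos _); by field.
under eq_bigr => j _ do rewrite half.
rewrite -mulr_sumr exchange_big/=.
have mm : (m < (2 * m).+1)%N by rewrite ltnS leq_pmull.
rewrite (bigD1 (Ordinal mm))//= [X in _ + X]big1 ?addr0 => [|i im].
  rewrite subrr -mulr_sumr.
  under eq_bigr => j _ do rewrite mul0r cos0.
  by rewrite sumr_const card_ord /fejer_mean exprVn; ring.
rewrite -mulr_sumr.
have [l [l0 e]] : exists l : nat, (0 < l < N)%N /\ forall x : R,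
    cos ((m%:R - i%:R) * x) = cos (l%:R * x).
  have i2 := ltn_ord i; have imn : (i != m :> nat) by [].
  have [im'|im'] := leqP i m.
    exists (m - i)%N; split; last by move=> x; rewrite natrB.
    by rewrite subn_gt0 ltn_neqAle imn im' (leq_ltn_trans _ mN)// leq_subr.
  exists (i - m)%N; split; last first.
    by move=> x; rewrite natrB ?(ltnW im')// -cosN; congr cos; ring.
  rewrite subn_gt0 im' (leq_ltn_trans _ mN)//; lia.
under eq_bigr => j _ do rewrite e.
rewrite (eq_bigr (fun j : 'I_N => cos (l%:R * b - 2 * (l%:R * pi / N%:R) * j%:R))).
  by rewrite sum_cos_nodes ?mulr0.
by move=> j _; congr cos; field.
Qed.

End cosine_kernel.

(** * Approximation by trigonometric sums on a box *)

Section trigonometric_approximation.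
Variable R : realType.

(** The phase [phi] lets cosines stand for sines as well. An inductive class makes it enough to
    treat a single cosine whenever a property is stable under sums and multiples. *)
Inductive trig_sum : (R * R -> R) -> Prop :=
| TrigCos phi xi eta : trig_sum (fun p => cos (phi + (xi * p.1 + eta * p.2)))
| TrigAdd f g : trig_sum f -> trig_sum g -> trig_sum (fun p => f p + g p)
| TrigScale c f : trig_sum f -> trig_sum (fun p => c * f p).

Lemma trig_sum_ext f g : f =1 g -> trig_sum f -> trig_sum g.
Proof. by move=> /funext ->. Qed.

Lemma trig_sum_cst c : trig_sum (fun=> c).
Proof.
apply: (@trig_sum_ext (fun p => c * cos (0 + (0 * p.1 + 0 * p.2)))).
  by move=> p; rewrite !mul0r !addr0 cos0 mulr1.
by apply: TrigScale; exact: TrigCos.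
Qed.

Lemma trig_sum_bigsum n (f : 'I_n -> R * R -> R) :
  (forall i, trig_sum (f i)) -> trig_sum (fun p => \sum_(i < n) f i p).
Proof.
move=> hf; elim: n f hf => [|n IH] f hf.
  by apply: trig_sum_ext (trig_sum_cst 0) => p; rewrite big_ord0.
apply: trig_sum_ext (TrigAdd (hf ord0) (IH (fun i => f (lift ord0 i)) (fun i => hf _))) => p.
by rewrite big_ord_recl.
Qed.

Lemma trig_sum_mul_cos f phi xi eta : trig_sum f ->
  trig_sum (fun p => f p * cos (phi + (xi * p.1 + eta * p.2))).
Proof.
elim=> {f} [psi a b|f g _ IHf _ IHg|c f _ IHf].
- apply: trig_sum_ext (TrigScale 2^-1 (TrigAdd (TrigCos (psi + phi) (a + xi) (b + eta))
    (TrigCos (psi - phi) (a - xi) (b - eta)))) => p.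
  by rewrite mul_cos; congr (_ * (cos _ + cos _)); ring.
- by apply: trig_sum_ext (TrigAdd IHf IHg) => p; rewrite mulrDl.
- by apply: trig_sum_ext (TrigScale c IHf) => p; rewrite mulrA.
Qed.

Lemma trig_sum_kernel m phi xi eta :
  trig_sum (fun p => ((1 + cos (phi + (xi * p.1 + eta * p.2))) / 2) ^+ m).
Proof.
elim: m => [|m IH]; first by apply: trig_sum_ext (trig_sum_cst 1) => p.
apply: trig_sum_ext (TrigScale 2^-1 (TrigAdd IH (trig_sum_mul_cos phi xi eta IH))) => p.
by rewrite exprSr -{1}[_ ^+ m]mulr1 -mulrDr mulrCA mulrC mulrA; ring.
Qed.

Lemma trig_sum_kernel2 m k phi xi eta phi' xi' eta' :
  trig_sum (fun p => ((1 + cos (phi + (xi * p.1 + eta * p.2))) / 2) ^+ m *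
    ((1 + cos (phi' + (xi' * p.1 + eta' * p.2))) / 2) ^+ k).
Proof.
elim: k => [|k IH].
  by apply: trig_sum_ext (trig_sum_kernel m phi xi eta) => p; rewrite mulr1.
apply: trig_sum_ext (TrigScale 2^-1 (TrigAdd IH (trig_sum_mul_cos phi' xi' eta' IH))) => p.
by rewrite exprSr; ring.
Qed.

Let node (L : R) N j : R := - L + 2 * L / N%:R * j%:R.

Let angle (L : R) N j (u : R) : R := pi / L * (u - node L N j).

(** A bump of period [2 * L] centred at the node [j]; the nodes are [N] equally spaced points
    starting at [- L]. *)
Let kernel m (L : R) N j (u : R) : R :=
  ((1 + cos (angle L N j u)) / 2) ^+ m / (N%:R * fejer_mean R m).

Let kernel_ge0 m L N j u : 0 <= kernel m L N j u.
Proof.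
apply: divr_ge0; last by rewrite mulr_ge0// ltW// fejer_mean_gt0.
by rewrite exprn_ge0// divr_ge0//; have := cos_geN1 (angle L N j u); lra.
Qed.

Let angleE L N j u : L != 0 -> angle L N j u = pi / L * u + pi - 2 * pi / N%:R * j%:R.
Proof. by move=> L0; rewrite /angle /node; move: (N%:R^-1) => w; field. Qed.

Let sum_kernel m L N u : L != 0 -> (m < N)%N -> \sum_(j < N) kernel m L N j u = 1.
Proof.
move=> L0 mN; have N0 : N%:R != 0 :> R by rewrite pnatr_eq0 -lt0n (leq_trans _ mN).
rewrite -mulr_suml; under eq_bigr => j _ do rewrite angleE//.
by rewrite sum_fejer// divff// mulf_neq0// gt_eqF// fejer_mean_gt0.
Qed.

(** Counterpart of the variance in Bernstein's argument: it bounds the weight of the nodes far from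
    [u]. The factor [1 - cos] raises the degree to [m.+1], hence the stronger condition on [N]. *)
Let sum_kernel_cos m L N u : L != 0 -> (m.+1 < N)%N ->
  \sum_(j < N) kernel m L N j u * (1 - cos (angle L N j u)) = m.+1%:R^-1.
Proof.
move=> L0 mN; have N0 : N%:R != 0 :> R by rewrite pnatr_eq0 -lt0n (leq_trans _ mN).
have f0 := fejer_mean_gt0 R m.
have kE j : kernel m L N j u * (1 - cos (angle L N j u)) =
   2 / (N%:R * fejer_mean R m) *
   (((1 + cos (angle L N j u)) / 2) ^+ m - ((1 + cos (angle L N j u)) / 2) ^+ m.+1).
  rewrite /kernel exprS; move: (_ ^+ m) => z; field.
  by rewrite N0 gt_eqF.
under eq_bigr => j _ do rewrite kE angleE//.
rewrite -mulr_sumr big_split/= sumrN !sum_fejer//; last exact: ltnW.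
rewrite -(fejer_meanS R m); field.
by rewrite N0 gt_eqF.
Qed.

(** The point stays at distance at least [delta] from 0 and from both points [2 * L] and [- 2 * L];
    the reflection of [|x|] in [L] reduces to the range where [cos] decreases. *)
Let cos_far (L delta x : R) : 0 < delta -> delta < L -> delta <= `|x| ->
  `|x| <= 2 * L - delta -> cos (pi / L * x) <= cos (pi / L * delta).
Proof.
move=> d0 dL h1 h2; have L0 : 0 < L by lra.
have pL : 0 < pi / L :> R by rewrite divr_gt0// pi_gt0.
have pLL : pi / L * L = pi :> R by rewrite divfK// gt_eqF.
have -> : cos (pi / L * x) = cos (pi / L * `|x|).
  have [x0|x0] := leP 0 x; first by rewrite ger0_norm.
  by rewrite ltr0_norm// mulrN cosN.
have hd : pi / L * delta \in `[0, pi]%R.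
  rewrite in_itv/= mulr_ge0 ?(ltW pL) ?(ltW d0)//= -{2}pLL.
  by rewrite ler_wpM2l// ltW.
have dec y z : y \in `[0, pi]%R -> z \in `[0, pi]%R -> y <= z -> cos z <= cos y :> R.
  move=> hy hz; rewrite le_eqVlt => /predU1P[->//|yz].
  by apply: ltW; rewrite ltr_cos.
have [xL|Lx] := leP `|x| L.
  apply: dec => //.
    rewrite in_itv/= mulr_ge0 ?(ltW pL)//= -{2}pLL.
    by rewrite ler_wpM2l// ltW.
  by rewrite ler_wpM2l// ltW.
have -> : cos (pi / L * `|x|) = cos (pi / L * (2 * L - `|x|)).
  rewrite (_ : pi / L * (2 * L - `|x|) = - (pi / L * `|x|) + pi *+ 2).
    by rewrite cosD2pi cosN.
  by rewrite mulrBr mulrCA pLL -(mulr_natl pi); ring.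
apply: dec => //.
  rewrite in_itv/= mulr_ge0 ?(ltW pL)//=; last lra.
  by rewrite -{2}pLL ler_wpM2l// ?ltW//; lra.
by rewrite ler_wpM2l ?(ltW pL)//; lra.
Qed.

Let unif_cont_box (f : R * R -> R) (L e : R) : continuous f -> 0 < e ->
  exists2 delta : R, 0 < delta & forall p q, `|p.1| <= L -> `|p.2| <= L ->
    `|q.1 - p.1| < delta -> `|q.2 - p.2| < delta -> `|f q - f p| <= e.
Proof.
move=> cf e0.
pose box : set (R * R) := `[- L, L]%classic `*` `[- L, L]%classic.
have cbox : compact box by apply: compact_setX; exact: segment_compact.
have /compact_near_coveringP cov := cbox.
pose good (delta : R) (p : R * R) := forall q : R * R,
  `|q.1 - p.1| < delta -> `|q.2 - p.2| < delta -> `|f q - f p| <= e.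
have near_good : \forall delta \near 0^'+, box `<=` good delta.
  apply: cov => p _.
  have /cvgrPdist_lt /(_ (e / 2)) := cf p; rewrite divr_gt0// => /(_ isT).
  rewrite -nbhs_ballE => -[r /= r0 hr].
  have r2 : 0 < r / 2 by rewrite divr_gt0.
  exists (ball p (r / 2), [set x | 0 < x < r / 2]%R).
    split=> /=; first exact: nbhsx_ballx.
    by near=> x; apply/andP; split.
  move=> [p' delta] [/= [b1 b2] /andP[dl0 dl]] q h1 h2.
  have i1 : `|f p - f p'| < e / 2.
    by apply: hr; split; rewrite /ball/=; [apply: lt_trans b1 _|apply: lt_trans b2 _]; lra.
  have i2 : `|f p - f q| < e / 2.
    apply: hr; split; rewrite /ball/=.
      have := ler_distD p'.1 p.1 q.1; move: b1; rewrite /ball/= (distrC p'.1 q.1); lra.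
    have := ler_distD p'.2 p.2 q.2; move: b2; rewrite /ball/= (distrC p'.2 q.2); lra.
  have := ler_distD (f p) (f q) (f p'); rewrite (distrC (f q) (f p)); lra.
near (0 : R)^'+ => delta.
have hd : box `<=` good delta by near: delta.
exists delta => [|p q p1 p2]; first by near: delta; exact: nbhs_right_gt.
apply: hd.
by split; rewrite /= in_itv/= -ler_norml.
Unshelve. all: by end_near. Qed.


(* Bernstein-type operator: averages of samples of [f] on a grid of the box,
   with weights a positive trigonometric kernel that sums exactly to 1. *)
Lemma trig_approx (f : R * R -> R) (rho L M e : R) : continuous f ->
  0 < rho -> rho < L -> 0 < e ->
  (forall p, rho < `|p.1| -> f p = 0) -> (forall p, rho < `|p.2| -> f p = 0) ->
  (forall p, `|f p| <= M) ->
  exists t, [/\ trig_sum t, forall p, `|t p| <= M &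
    forall p, `|p.1| <= L -> `|p.2| <= L -> `|f p - t p| <= e].
Proof.
move=> cf rho0 rhoL e0 f1 f2 fM; have L0 : 0 < L by lra.
have Ln0 : L != 0 by rewrite gt_eqF.
have M0 : 0 <= M by exact: le_trans (fM (0, 0)).
have e2 : 0 < e / 2 by rewrite divr_gt0.
have [delta1 d10 hunif] := @unif_cont_box f L (e / 2) cf e2.
(* At most half the gap between support and box: two points of [[-L, L]] that are close modulo the
   period but not close in fact then lie outside [[-rho, rho]]. *)
pose delta := Num.min delta1 ((L - rho) / 2).
have Lr : 0 < (L - rho) / 2 by rewrite divr_gt0// subr_gt0.
have d0 : 0 < delta by rewrite lt_min d10.
have dd1 : delta <= delta1 by rewrite ge_min lexx.
have dLr : delta <= (L - rho) / 2 by rewrite ge_min lexx orbT.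
have dL : delta < L by apply: le_lt_trans dLr _; rewrite ltr_pdivrMr//; lra.
pose eta := 1 - cos (pi / L * delta).
have eta0 : 0 < eta.
  have pL : 0 < pi / L by rewrite divr_gt0// pi_gt0.
  rewrite subr_gt0 -[ltRHS](@cos0 R) ltr_cos ?in_itv/= ?lexx ?pi_ge0//.
    by rewrite mulr_gt0.
  rewrite mulr_ge0 ?(ltW pL) ?(ltW d0)//=.
  by rewrite -[leRHS](@divfK _ L)// ler_wpM2l// ltW.
have [m hm] : exists m, 2 * M / eta * (m.+1%:R^-1 + m.+1%:R^-1) <= e / 2.
  have [k hk] : exists k : nat, 8 * M / eta / e <= k.+1%:R.
    by exists (Num.truncn (8 * M / eta / e)); apply: ltW; exact: truncnS_gt.
  exists k; have k0 : (0 : R) < k.+1%:R by rewrite ltr0n.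
  rewrite (_ : 2 * M / eta * _ = 4 * M / eta / k.+1%:R); last by ring.
  rewrite ler_pdivrMr//; move: hk; rewrite ler_pdivrMr// => hk.
  rewrite (_ : 4 * M / eta = 8 * M / eta / 2); last by field; rewrite gt_eqF.
  by rewrite ler_pdivrMr//; move: hk; rewrite mulrC; lra.
(* The least number of nodes allowed by [sum_kernel_cos]. *)
pose N := m.+2; pose w := kernel m L N; pose c := node L N.
have w0 j u : 0 <= w j u by exact: kernel_ge0.
have w1 u : \sum_(j < N) w j u = 1 by apply: sum_kernel.
have wc u : \sum_(j < N) w j u * (1 - cos (angle L N j u)) = m.+1%:R^-1.
  exact: sum_kernel_cos.
have cL (j : 'I_N) : `|c j| <= L.
  have N0 : (0 : R) < N%:R by rewrite ltr0n.
  rewrite ler_norml /c /node; have : 0 <= 2 * L / N%:R * j%:R.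
    by rewrite mulr_ge0// divr_ge0 ?mulr_ge0 ?(ltW L0) ?(ltW N0).
  have : 2 * L / N%:R * j%:R <= 2 * L.
    rewrite -mulrA ler_piMr ?mulr_ge0 ?(ltW L0)// mulrC ler_pdivrMr// mul1r.
    by rewrite ler_nat ltnW.
  lra.
have W2 p : \sum_(j < N) \sum_(l < N) w j p.1 * w l p.2 = 1.
  by under eq_bigr => j _ do rewrite -mulr_sumr w1 mulr1; exact: w1.
pose t p := \sum_(j < N) \sum_(l < N) f (c j, c l) * (w j p.1 * w l p.2).
exists t; split.
- apply: trig_sum_bigsum => j; apply: trig_sum_bigsum => l.
  pose ph (j : nat) := pi / L * (- c j).
  apply: trig_sum_ext (TrigScale (f (c j, c l) / (N%:R * fejer_mean R m) ^+ 2)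
     (trig_sum_kernel2 m m (ph j) (pi / L) 0 (ph l) 0 (pi / L))) => p.
  rewrite /w /kernel /angle -/(c j) -/(c l) /ph.
  have -> : pi / L * - c j + (pi / L * p.1 + 0 * p.2) = pi / L * (p.1 - c j) by ring.
  have -> : pi / L * - c l + (0 * p.1 + pi / L * p.2) = pi / L * (p.2 - c l) by ring.
  by rewrite expr2 invfM; ring.
- move=> p; rewrite -[leRHS]mulr1 -(W2 p) mulr_sumr.
  apply: le_trans (ler_norm_sum _ _ _) _; apply: ler_sum => j _; rewrite mulr_sumr.
  apply: le_trans (ler_norm_sum _ _ _) _; apply: ler_sum => l _.
  have ww : 0 <= w j p.1 * w l p.2 by rewrite mulr_ge0.
  by rewrite normrM (ger0_norm ww); apply: ler_wpM2r.
move=> p p1 p2.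
pose a (j : 'I_N) := 1 - cos (angle L N j p.1).
pose b (l : 'I_N) := 1 - cos (angle L N l p.2).
have a0 j : 0 <= a j by rewrite subr_ge0 cos_le1.
have b0 l : 0 <= b l by rewrite subr_ge0 cos_le1.
(* Three cases. For close points uniform continuity applies; if a coordinate is far modulo the
   period, the cosine term exceeds the trivial bound [2 * M]; if a coordinate is close only modulo
   the period, both values of [f] are 0. *)
have key (j l : 'I_N) : `|f p - f (c j, c l)| <= e / 2 + 2 * M / eta * (a j + b l).
  have ME0 : 0 <= 2 * M / eta by rewrite divr_ge0 ?mulr_ge0 ?(ltW eta0).
  have big : eta <= a j + b l -> `|f p - f (c j, c l)| <= e / 2 + 2 * M / eta * (a j + b l).
    move=> h; have h2 := ler_wpM2l ME0 h; rewrite divfK ?gt_eqF// in h2.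
    have := ler_normB (f p) (f (c j, c l)); have := fM p; have := fM (c j, c l); lra.
  have small : `|f p - f (c j, c l)| <= e / 2 -> `|f p - f (c j, c l)| <= e / 2 + 2 * M / eta * (a j + b l).
    by move/le_trans; apply; rewrite lerDl mulr_ge0// addr_ge0.
  have zero : f p = 0 -> f (c j, c l) = 0 -> `|f p - f (c j, c l)| <= e / 2.
    by move=> -> ->; rewrite subrr normr0 ltW.
  have cj := cL j; have cl := cL l.
  have split1 (u v : R) : `|u| <= L -> `|v| <= L -> delta <= `|u - v| ->
      2 * L - delta < `|u - v| -> rho < `|u| /\ rho < `|v|.
    move=> hu hv _ h; have := ler_normB u v; lra.
  have [d1|d1] := ltP `|p.1 - c j| delta; last first.
    have [far|far] := leP `|p.1 - c j| (2 * L - delta).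
      apply: big; have : eta <= a j.
        by rewrite lerD2l lerN2; exact: cos_far.
      by have := b0 l; lra.
    have [r1 r2] := split1 _ _ p1 cj d1 far.
    by apply: small; apply: zero; apply: f1.
  have [d2|d2] := ltP `|p.2 - c l| delta; last first.
    have [far|far] := leP `|p.2 - c l| (2 * L - delta).
      apply: big; have : eta <= b l.
        by rewrite lerD2l lerN2; exact: cos_far.
      by have := a0 j; lra.
    have [r1 r2] := split1 _ _ p2 cl d2 far.
    by apply: small; apply: zero; apply: f2.
  apply: small; apply: hunif => //=; exact: lt_le_trans dd1.
have -> : f p - t p = \sum_(j < N) \sum_(l < N) (f p - f (c j, c l)) * (w j p.1 * w l p.2).
  rewrite -{1}[f p]mulr1 -{1}(W2 p) mulr_sumr -sumrB; apply: eq_bigr => j _.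
  by rewrite mulr_sumr -sumrB; apply: eq_bigr => l _; rewrite mulrBl.
apply: le_trans (_ : \sum_(j < N) \sum_(l < N) (e / 2 + 2 * M / eta * (a j + b l)) * (w j p.1 * w l p.2) <= _).
  apply: le_trans (ler_norm_sum _ _ _) _; apply: ler_sum => j _.
  apply: le_trans (ler_norm_sum _ _ _) _; apply: ler_sum => l _.
  have ww : 0 <= w j p.1 * w l p.2 by rewrite mulr_ge0.
  by rewrite normrM (ger0_norm ww); apply: ler_wpM2r.
have -> : \sum_(j < N) \sum_(l < N) (e / 2 + 2 * M / eta * (a j + b l)) * (w j p.1 * w l p.2) =
   e / 2 + 2 * M / eta * (m.+1%:R^-1 + m.+1%:R^-1).
  have sa : \sum_(j < N) \sum_(l < N) a j * (w j p.1 * w l p.2) = m.+1%:R^-1.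
    rewrite -(wc p.1); apply: eq_bigr => j _.
    rewrite -mulr_sumr -mulr_sumr w1 mulr1 mulrC; by [].
  have sb : \sum_(j < N) \sum_(l < N) b l * (w j p.1 * w l p.2) = m.+1%:R^-1.
    rewrite exchange_big/= -(wc p.2); apply: eq_bigr => l _.
    by under eq_bigr => j _ do rewrite mulrA mulrAC mulrC; rewrite -mulr_suml w1 mul1r mulrC.
  transitivity (e / 2 * (\sum_(j < N) \sum_(l < N) w j p.1 * w l p.2) + 2 * M / eta *
     (\sum_(j < N) \sum_(l < N) a j * (w j p.1 * w l p.2)
      + \sum_(j < N) \sum_(l < N) b l * (w j p.1 * w l p.2))); last by rewrite W2 sa sb mulr1.
  rewrite -big_split/= !mulr_sumr -big_split/=.
  apply: eq_bigr => j _; rewrite -big_split/= !mulr_sumr -big_split/=.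
  by apply: eq_bigr => l _; ring.
by rewrite [leRHS](splitr e) lerD2l.
Qed.

End trigonometric_approximation.

Section expR_estimates.
Variable R : realType.

Lemma exprn_le_fact_expR (y : R) k : 0 <= y -> y ^+ k <= k`!%:R * expR y.
Proof.
move=> y0; case: k => [|k].
  by rewrite expr0 fact0 mul1r; have := expR_ge1Dx y; lra.
have := expR_ge1Dxn k y0 => h.
rewrite -ler_pdivrMl ?ltr0n ?fact_gt0// mulrC.
by apply: le_trans h; rewrite ler_wpDl.
Qed.

Lemma expRB1Bx_le (x : R) : `|expR x - 1 - x| <= x ^+ 2 * expR `|x|.
Proof.
rewrite ger0_norm; last by have := expR_ge1Dx x; lra.
have [x0|x0] := leP 0 x.
  rewrite ger0_norm//; have h1 := expR_ge1Dx (- x).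
  have h2 : expR x * (1 - x) <= 1.
    rewrite -[leRHS](expRxMexpNx_1 x).
    by rewrite ler_wpM2l ?expR_ge0.
  have h3 : x * (expR x * (1 - x)) <= x * 1 by rewrite ler_wpM2l.
  rewrite expr2; move: (expR x) h2 h3 => e h2 h3; lra.
rewrite ltr0_norm// -[in X in X <= _](opprK x).
have y0 : 0 < - x by lra.
rewrite -(sqrrN x); move: (- x) y0 => y y0.
have h1 : 1 + y <= expR y by exact: expR_ge1Dx.
have h2 : 1 - y <= expR (- y) by exact: expR_ge1Dx.
have h4 : expR (- y) * (1 + y) <= 1.
  rewrite -[leRHS](expRxMexpNx_1 y) mulrC.
  by rewrite ler_wpM2r ?expR_ge0.
have h3 : y ^+ 2 * 1 <= y ^+ 2 * expR y.
  by rewrite ler_wpM2l ?sqr_ge0// ; lra.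
have h5 : y * (1 - y) <= y * expR (- y) by rewrite ler_wpM2l// ltW.
rewrite expr2 in h3 *; move: (expR (- y)) (expR y) h1 h2 h3 h4 h5 => e e'; lra.
Qed.

End expR_estimates.

(** * Taylor expansion of the cosine with an arbitrary phase *)

Section cos_taylor.
Variable R : realType.

(** Taylor polynomial of [cos (phi + z)] at 0. Successive derivatives are written as phase shifts by
    [pi / 2], so that the family is stable under differentiation. *)
Let T (phi : R) m : {poly R} := \poly_(i < m) (cos (phi + i%:R * (pi / 2)) / i`!%:R).

Let derivT phi m : (T phi m.+1)^`() = T (phi + pi / 2) m.
Proof.
apply/polyP => i; rewrite coef_deriv !coef_poly ltnS; case: ifP => _; last by rewrite mul0rn.
rewrite -[LHS]mulr_natr factS natrM -(natr1 i).
have i0 : i%:R + 1 != 0 :> R by rewrite natr1 pnatr_eq0.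
have f0 : i`!%:R != 0 :> R by rewrite pnatr_eq0 -lt0n fact_gt0.
rewrite (_ : phi + (i%:R + 1) * (pi / 2) = phi + pi / 2 + i%:R * (pi / 2)); last by ring.
by field; rewrite i0 f0.
Qed.

(** Induction with [phi] free: the derivative of a remainder is the remainder of lower order at
    phase [phi + pi / 2], and remainder and bound both vanish at 0. *)
Let taylor_ge0 phi m (z : R) : 0 <= z ->
  `|cos (phi + z) - (T phi m).[z]| <= z ^+ m / m`!%:R.
Proof.
elim: m phi z => [|m IH] phi z z0.
  rewrite /T poly_def big_ord0 horner0 subr0 divr1.
  by rewrite ler_norml cos_geN1 cos_le1.
have dX (x : R) : is_derive x 1 (fun x : R => x ^+ m.+1 / m.+1`!%:R) (x ^+ m / m`!%:R).
  have := is_derive_poly ((m.+1`!%:R)^-1 *: 'X^(m.+1)) x.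
  rewrite derivZ derivXn hornerZ hornerMn hornerXn /= => h.
  rewrite (_ : (fun x : R => _) = horner ((m.+1`!%:R)^-1 *: 'X^(m.+1))); last first.
    by apply/funext => y; rewrite hornerZ hornerXn mulrC.
  rewrite (_ : x ^+ m / _ = (m.+1`!%:R)^-1 * (x ^+ m *+ m.+1))//.
  have m0 : m.+1%:R != 0 :> R by rewrite pnatr_eq0.
  have f0 : m`!%:R != 0 :> R by rewrite pnatr_eq0 -lt0n fact_gt0.
  rewrite factS natrM -[x ^+ m *+ _]mulr_natr invfM -mulrA mulrCA mulrC.
  by rewrite [_ * m.+1%:R]mulrC mulKf// mulrC.
have dC (x : R) : is_derive x 1 (fun x : R => cos (phi + x) - (T phi m.+1).[x])
    (cos (phi + pi / 2 + x) - (T (phi + pi / 2) m).[x]).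
  have h1 : is_derive (phi + x) 1 (@cos R) (- sin (phi + x)) by exact: is_derive_cos.
  have h2 : is_derive x 1 (fun w : R => phi + w) 1.
    change (is_derive x 1 (cst phi + id : R -> R) 1).
    by apply: trigger_derive; rewrite add0r.
  have h3 := @is_derive1_comp _ (@cos R) (fun w : R => phi + w) x _ _ h1 h2.
  have h4 := is_derive_poly (T phi m.+1) x.
  have := is_deriveB h3 h4; rewrite derivT mulr1.
  by rewrite -(addrAC phi x) cosDpihalf.
have T0 : cos (phi + 0) - (T phi m.+1).[0] = 0.
  by rewrite horner_coef0 coef_poly/= mul0r fact0 divr1 subrr.
have X0 : (0 : R) ^+ m.+1 / m.+1`!%:R = 0 by rewrite expr0n/= mul0r.
rewrite ler_norml; apply/andP; split; rewrite -subr_ge0.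
- apply: (@ge0_of_is_derive _ (fun x => cos (phi + x) - (T phi m.+1).[x] - (- (x ^+ m.+1 / m.+1`!%:R)))
    (fun x => cos (phi + pi / 2 + x) - (T (phi + pi / 2) m).[x] + x ^+ m / m`!%:R) z); last exact: z0.
  + move=> x x0; rewrite [X in is_derive _ _ X _](_ : _ = (fun x : R => cos (phi + x) - (T phi m.+1).[x])
      + (fun x : R => x ^+ m.+1 / m.+1`!%:R)); last by apply/funext => y /=; rewrite opprK.
    exact: is_deriveD (dC x) (dX x).
  + by move=> x x0; have := IH (phi + pi / 2) x x0; rewrite ler_norml => /andP[h _]; lra.
  + by rewrite T0 X0 oppr0 subr0.
- apply: (@ge0_of_is_derive _ (fun x => x ^+ m.+1 / m.+1`!%:R - (cos (phi + x) - (T phi m.+1).[x]))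
    (fun x => x ^+ m / m`!%:R - (cos (phi + pi / 2 + x) - (T (phi + pi / 2) m).[x])) z); last exact: z0.
  + by move=> x x0; have := IH (phi + pi / 2) x x0; rewrite ler_norml => /andP[_ h]; lra.
  + by rewrite T0 X0 subr0.
Qed.

Lemma cos_taylor (phi : R) m (z : R) :
  `|cos (phi + z) - \sum_(i < m) cos (phi + i%:R * (pi / 2)) / i`!%:R * z ^+ i|
    <= `|z| ^+ m / m`!%:R.
Proof.
have [z0|z0] := leP 0 z.
  have := taylor_ge0 phi m z0; rewrite /T horner_poly (ger0_norm z0).
  by [].
have y0 : 0 <= - z by lra.
rewrite (ltr0_norm z0); have := taylor_ge0 (- phi) m y0.
rewrite /T horner_poly (_ : - phi - z = - (phi + z)) ?cosN; last by ring.
rewrite (eq_bigr (fun i : 'I_m => cos (phi + i%:R * (pi / 2)) / i`!%:R * z ^+ i))// => i _.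
have e : cos (- phi + i%:R * (pi / 2)) = (-1) ^+ i * cos (phi + i%:R * (pi / 2)).
  have cosDnpi (x : R) k : cos (x + k%:R * pi) = (-1) ^+ k * cos x.
    elim: k => [|k IH]; first by rewrite mul0r addr0 expr0 mul1r.
    by rewrite -(natr1 k) mulrDl mul1r addrA cosDpi IH exprS; ring.
  rewrite (_ : phi + _ = - (- phi + i%:R * (pi / 2)) + i%:R * pi); last by field.
  by rewrite cosDnpi cosN signrMK.
rewrite e (exprNn z) -[RHS](signrMK i) -!mulrA; congr (_ * _).
by rewrite [RHS]mulrCA; congr (_ * _); rewrite mulrCA.
Qed.

End cos_taylor.

(** * The class of functions whose expectations converge *)

Section moment_class.
Variable R : realType.
Context (d : nat -> measure_display) (T : forall n, measurableType (d n))
  (P : forall n, probability (T n) R) (X : forall n, T n -> R * R)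
  (mX : forall n, measurable_fun [set: T n] (X n))
  d' (T' : measurableType d') (Q : probability T' R) (Y : T' -> R * R)
  (mY : measurable_fun [set: T'] Y).

Hypothesis expY : forall l m : R,
  Q.-integrable [set: T'] (fun w => (expR (l * (Y w).1 + m * (Y w).2))%:E).
Hypothesis expX : forall l m : R, 0 <= l -> 0 <= m ->
  ((\int[P n]_w (expR (l * (@X n w).1 + m * (@X n w).2))%:E)%E @[n --> \oo]
   --> (\int[Q]_w (expR (l * (Y w).1 + m * (Y w).2))%:E)%E).

(** Integrability under [P n] is required only eventually, since a limit of exponential moments says
    nothing about small [n]. *)
Definition cvg_expect (g : R * R -> R) : Prop :=
  [/\ measurable_fun [set: R * R] g,
      Q.-integrable [set: T'] (fun w => (g (Y w))%:E),
      \forall n \near \oo, (P n).-integrable [set: T n] (fun w => (g (@X n w))%:E) &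
      (\int[P n]_w g (@X n w))%R @[n --> \oo] --> (\int[Q]_w g (Y w))%R].

Let E (g : R * R -> R) : R := (\int[Q]_w g (Y w))%R.

Lemma measurable_exp_lin (l m : R) :
  measurable_fun [set: R * R] (fun p : R * R => expR (l * p.1 + m * p.2)).
Proof.
apply: (measurableT_comp (@measurable_expR R)); apply: measurable_funD.
  by apply: measurable_funM => //; exact: measurable_fst.
by apply: measurable_funM => //; exact: measurable_snd.
Qed.

Lemma cvg_expect_exp (l m : R) : 0 <= l -> 0 <= m ->
  cvg_expect (fun p => expR (l * p.1 + m * p.2)).
Proof.
move=> l0 m0; have := expX l0 m0.
have fQ : (\int[Q]_w (expR (l * (Y w).1 + m * (Y w).2))%:E)%E \is a fin_num.
  exact: integrable_fin_num (expY l m).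
rewrite -(fineK fQ) => /fine_cvgP[finP cP].
have mg := measurable_exp_lin l m.
split => //; apply: filterS finP => n fin.
apply/integrableP; split.
  by apply/measurable_EFinP; exact: (measurableT_comp mg (@mX n)).
under eq_integral do rewrite /= ger0_norm ?expR_ge0//.
by move: fin; rewrite fin_numE => /andP[_ fin]; rewrite ltey.
Qed.

Lemma cvg_expectD (f g : R * R -> R) : cvg_expect f -> cvg_expect g ->
  cvg_expect (fun p => f p + g p).
Proof.
move=> [mf fQ fP cf] [mg gQ gP cg]; split.
- exact: measurable_funD.
- exact: (integrableD measurableT fQ gQ).
- by apply: filterS2 fP gP => n f1 g1; exact: (integrableD measurableT f1 g1).
- rewrite RintegralD//; apply: cvg_trans (cvgD cf cg).
  by apply: near_eq_cvg; apply: filterS2 fP gP => n f1 g1; rewrite RintegralD.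
Qed.

Lemma cvg_expectZ (c : R) (f : R * R -> R) : cvg_expect f ->
  cvg_expect (fun p => c * f p).
Proof.
move=> [mf fQ fP cf]; split.
- exact: measurable_funM.
- exact: (integrableZl measurableT c fQ).
- by apply: filterS fP => n f1; exact: (integrableZl measurableT c f1).
- rewrite RintegralZl//; apply: cvg_trans (cvgM (cvg_cst c) cf).
  by apply: near_eq_cvg; apply: filterS fP => n f1; rewrite RintegralZl.
Qed.

Lemma cvg_expect_ext (f g : R * R -> R) : f =1 g -> cvg_expect f -> cvg_expect g.
Proof. by move=> /funext ->. Qed.

Lemma cvg_expect0 : cvg_expect (fun=> 0).
Proof.
apply: (@cvg_expect_ext (fun p => 0 * expR (0 * p.1 + 0 * p.2))).
  by move=> p; rewrite mul0r.
by apply: cvg_expectZ; exact: cvg_expect_exp.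
Qed.

Lemma cvg_expect_sum (I : Type) (r : seq I) (f : I -> R * R -> R) :
  (forall i, cvg_expect (f i)) -> cvg_expect (fun p => \sum_(i <- r) f i p).
Proof.
move=> hf; elim: r => [|i r IH].
  by apply: cvg_expect_ext cvg_expect0 => p; rewrite big_nil.
apply: cvg_expect_ext (cvg_expectD (hf i) IH) => p.
by rewrite big_cons.
Qed.

(* Domination in mean: the error [V] is itself in the class, so its expectation
   under [P n] is eventually as small as under [Q]. *)
Lemma cvg_expect_approx (g : R * R -> R) : measurable_fun [set: R * R] g ->
  (forall e : R, 0 < e -> exists g' V, [/\ cvg_expect g', cvg_expect V,
     forall p, `|g p - g' p| <= V p & E V <= e]) ->
  cvg_expect g.
Proof.
move=> mg happ.
have dom d0 (T0 : measurableType d0) (P0 : probability T0 R) (Z : T0 -> R * R) g' V :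
    measurable_fun [set: T0] Z ->
    P0.-integrable [set: T0] (fun w => (g' (Z w))%:E) ->
    P0.-integrable [set: T0] (fun w => (V (Z w))%:E) ->
    (forall p, `|g p - g' p| <= V p) ->
    P0.-integrable [set: T0] (fun w => (g (Z w))%:E) /\
    `|(\int[P0]_w g (Z w))%R - (\int[P0]_w g' (Z w))%R| <= (\int[P0]_w V (Z w))%R.
  move=> mZ ig' iV gV.
  have ig : P0.-integrable [set: T0] (fun w => (g (Z w))%:E).
    apply: (le_integrable _ _ _ (integrableD measurableT (integrable_abse ig') iV)) => //.
      by apply/measurable_EFinP; exact: (measurableT_comp mg mZ).
    move=> w _ /=; rewrite lee_fin.
    have := gV (Z w); have := ler_normD (g (Z w) - g' (Z w)) (g' (Z w)); rewrite subrK.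
    have := ler_norm (`|g' (Z w)| + V (Z w)); lra.
  split=> //; rewrite -RintegralB//.
  apply: le_trans (le_normr_Rintegral _ _) _ => //.
    exact: (integrableB measurableT ig ig').
  apply: le_Rintegral => //.
  exact: (integrable_abse (integrableB measurableT ig ig')).
(* An approximation with error 1 already gives integrability. *)
have [g1 [V1 [[_ g1Q g1P _] [_ V1Q V1P _] h1 _]]] := happ 1 ltr01.
have gQ : Q.-integrable [set: T'] (fun w => (g (Y w))%:E).
  by have [] := dom _ _ _ _ _ _ mY g1Q V1Q h1.
have gP : \forall n \near \oo, (P n).-integrable [set: T n] (fun w => (g (@X n w))%:E).
  by apply: filterS2 g1P V1P => n f1 v1; have [] := dom _ _ (P n) _ _ _ (@mX n) f1 v1 h1.
split=> //; apply/cvgrPdist_le => e e0.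
(* The budget is [e / 4] for the error under [Q], [e / 4] for the approximant, and [e / 2] for the
   error under [P n], whose mean is within [e / 4] of that under [Q]. *)
have [g2 [V2 [[_ g2Q g2P c2] [_ V2Q V2P cV] h2 hV]]] := happ (e / 4) ltac:(by rewrite divr_gt0).
have e4 : 0 < e / 4 by rewrite divr_gt0.
have k2' : \forall n \near \oo, `|(\int[P n]_w g (@X n w))%R - (\int[P n]_w g2 (@X n w))%R|
    <= (\int[P n]_w V2 (@X n w))%R.
  by apply: filterS2 g2P V2P => n f2 v2; have [] := dom _ _ (P n) _ _ _ (@mX n) f2 v2 h2.
near=> n.
have k1 := (dom _ _ _ _ _ _ mY g2Q V2Q h2).2.
have k2 : `|(\int[P n]_w g (@X n w))%R - (\int[P n]_w g2 (@X n w))%R| <= (\int[P n]_w V2 (@X n w))%R.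
  by near: n.
have k3 : `|(\int[Q]_w g2 (Y w))%R - (\int[P n]_w g2 (@X n w))%R| <= e / 4.
  by near: n; move/cvgrPdist_le : c2; exact.
have k4 : `|(\int[Q]_w V2 (Y w))%R - (\int[P n]_w V2 (@X n w))%R| <= e / 4.
  by near: n; move/cvgrPdist_le : cV; exact.
rewrite /E in hV; move: k1 k2 k3 k4 hV.
move: (\int[Q]_w g (Y w))%R (\int[Q]_w g2 (Y w))%R (\int[Q]_w V2 (Y w))%R => a1 a2 a3.
move: (\int[P n]_w g (@X n w))%R (\int[P n]_w g2 (@X n w))%R (\int[P n]_w V2 (@X n w))%R => b1 b2 b3.
rewrite !ler_norml; lra.
Unshelve. all: by end_near. Qed.


Lemma expectYD (f g : R * R -> R) : cvg_expect f -> cvg_expect g ->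
  E (fun p => f p + g p) = E f + E g.
Proof. by move=> [_ fQ _ _] [_ gQ _ _]; rewrite /E RintegralD. Qed.

Lemma expectYZ (c : R) (f : R * R -> R) : cvg_expect f -> E (fun p => c * f p) = c * E f.
Proof. by move=> [_ fQ _ _]; rewrite /E RintegralZl. Qed.

Lemma expectY_le (f g : R * R -> R) : cvg_expect f ->
  Q.-integrable [set: T'] (fun w => (g (Y w))%:E) -> (forall p, f p <= g p) -> E f <= E g.
Proof. by move=> [_ fQ _ _] gQ fg; apply: le_Rintegral. Qed.

Lemma expectY_ge0 (f : R * R -> R) : (forall p, 0 <= f p) -> 0 <= E f.
Proof. by move=> f0; exact: Rintegral_ge0. Qed.

(* The factor [expR (p.1 + p.2)] keeps all exponents nonnegative. *)
Let zexp (xi eta tau : R) (p : R * R) : R :=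
  expR (p.1 + p.2 + tau * (xi * p.1 + eta * p.2)).

Let zexp_cvg (xi eta tau : R) : `|tau| * (`|xi| + `|eta| + 1) <= 1 ->
  cvg_expect (zexp xi eta tau).
Proof.
move=> h; have h1 : `|tau * xi| <= 1.
  rewrite normrM; apply: le_trans h; rewrite ler_wpM2l//.
  by have := normr_ge0 eta; lra.
have h2 : `|tau * eta| <= 1.
  rewrite normrM; apply: le_trans h; rewrite ler_wpM2l//.
  by have := normr_ge0 xi; lra.
move: h1 h2; rewrite !ler_norml => h1 h2.
apply: (@cvg_expect_ext (fun p => expR ((1 + tau * xi) * p.1 + (1 + tau * eta) * p.2))).
  by move=> p; rewrite /zexp; congr expR; ring.
by apply: cvg_expect_exp; lra.
Qed.

(* Multiplication by one more factor [xi * u + eta * v] is approximated by a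
   difference quotient in [tau]. *)
Lemma cvg_expect_monomial (xi eta : R) k (tau : R) :
  `|tau| * (`|xi| + `|eta| + 1) < 1 ->
  cvg_expect (fun p => (xi * p.1 + eta * p.2) ^+ k * zexp xi eta tau p).
Proof.
set S := `|xi| + `|eta| + 1 => htau.
have S0 : 0 < S by rewrite /S; have := normr_ge0 xi; have := normr_ge0 eta; lra.
elim: k tau htau => [|k IH] tau htau.
  apply: (@cvg_expect_ext (zexp xi eta tau)); first by move=> p; rewrite mul1r.
  exact/zexp_cvg/ltW.
(* The strict inequality on [tau] leaves a margin within which the exponents remain nonnegative. *)
have [delta d0 hd] : exists2 delta : R, 0 < delta & (`|tau| + delta) * S <= 1.
  exists (S^-1 - `|tau|); first by rewrite subr_gt0 -ltr_pdivlMr ?div1r// in htau *.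
  by rewrite addrC subrK mulVf// gt_eqF.
have d2 : 0 < delta / 2 by rewrite divr_gt0.
(* One half of [delta] absorbs the power [|z| ^+ k.+2] through the exponential series, the other
   half absorbs [expR |h * z|]. The product is at most [expR (delta * z) + expR (- delta * z)], up
   to [C]. *)
pose C : R := (k.+2)`!%:R / (delta / 2) ^+ k.+2.
have C0 : 0 < C by rewrite divr_gt0 ?exprn_gt0// ltr0n fact_gt0.
have cp : cvg_expect (fun p => zexp xi eta (tau + delta) p + zexp xi eta (tau - delta) p).
  by apply: cvg_expectD; apply: zexp_cvg; apply: le_trans hd;
    rewrite ler_wpM2r ?(ltW S0)//;
    [have := ler_normD tau delta|have := ler_normB tau delta]; rewrite (gtr0_norm d0).
set M := E (fun p => zexp xi eta (tau + delta) p + zexp xi eta (tau - delta) p).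
have M0 : 0 <= M by apply: expectY_ge0 => p; rewrite addr_ge0 ?expR_ge0.
apply: cvg_expect_approx => [|e e0].
  apply: measurable_funM; last first.
    by have [] := zexp_cvg (ltW htau).
  by apply: measurable_funX; apply: measurable_funD; apply: measurable_funM.
have CM0 : 0 < C * M + 1 by rewrite ltr_wpDl// mulr_ge0// ltW.
have [h [h0 hd2 he]] : exists h : R, [/\ 0 < h, h <= delta / 2 & h * (C * M) <= e].
  exists (Num.min (delta / 2) (e / (C * M + 1))); split.
  - by rewrite lt_min d2 divr_gt0.
  - by rewrite ge_min lexx.
  apply: le_trans (_ : e / (C * M + 1) * (C * M) <= _).
    apply: ler_wpM2r; first by rewrite mulr_ge0// ltW.
    by rewrite ge_min lexx orbT.
  by rewrite mulrAC ler_pdivrMr// ler_wpM2l ?(ltW e0)// lerDl.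
have hth : `|tau + h| * S < 1.
  apply: lt_le_trans hd; rewrite ltr_pM2r//.
  have := ler_normD tau h; rewrite (gtr0_norm h0); lra.
exists (fun p => h^-1 * ((xi * p.1 + eta * p.2) ^+ k * zexp xi eta (tau + h) p)
   + (- h^-1) * ((xi * p.1 + eta * p.2) ^+ k * zexp xi eta tau p)).
exists (fun p => h * C * (zexp xi eta (tau + delta) p + zexp xi eta (tau - delta) p)).
split.
- by apply: cvg_expectD; apply: cvg_expectZ; exact: IH.
- exact: cvg_expectZ.
- move=> p; rewrite /zexp; set z := xi * p.1 + eta * p.2; set A := p.1 + p.2.
  have -> : A + (tau + h) * z = (A + tau * z) + h * z by ring.
  have -> : A + (tau + delta) * z = (A + tau * z) + delta * z by ring.
  have -> : A + (tau - delta) * z = (A + tau * z) + (- (delta * z)) by ring.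
  rewrite !(expRD (A + tau * z)); set B := expR (A + tau * z).
  have B0 : 0 <= B by exact: expR_ge0.
  have -> : z ^+ k.+1 * B - (h^-1 * (z ^+ k * (B * expR (h * z))) + - h^-1 * (z ^+ k * B))
     = - (h^-1 * z ^+ k * B * (expR (h * z) - 1 - h * z)).
    by rewrite exprS; field; rewrite gt_eqF.
  rewrite normrN normrM.
  have -> : `|h^-1 * z ^+ k * B| = h^-1 * `|z| ^+ k * B.
    by rewrite !normrM normrX (ger0_norm B0) gtr0_norm// invr_gt0.
  have w1 := expRB1Bx_le (h * z).
  apply: le_trans (ler_wpM2l _ w1) _.
    by rewrite !mulr_ge0 ?invr_ge0 ?exprn_ge0// ltW.
  have -> : h^-1 * `|z| ^+ k * B * ((h * z) ^+ 2 * expR `|h * z|) =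
     h * B * (`|z| ^+ k.+2 * expR `|h * z|).
    rewrite exprMn -(real_normK (num_real z)) !exprS.
    by move: (`|z| ^+ k) (expR `|h * z|) `|z| => a b c; field; rewrite gt_eqF.
  rewrite -mulrDr mulrA [h * C * B]mulrAC -[leRHS]mulrA.
  rewrite ler_wpM2l ?mulr_ge0 ?(ltW h0)//.
  have hz : expR `|h * z| <= expR (delta / 2 * `|z|).
    by rewrite ler_expR normrM (gtr0_norm h0) ler_wpM2r.
  have zk : `|z| ^+ k.+2 <= C * expR (delta / 2 * `|z|).
    have := @exprn_le_fact_expR R (delta / 2 * `|z|) k.+2.
    rewrite exprMn mulr_ge0 ?(ltW d2)// => /(_ isT).
    rewrite (_ : C * _ = (k.+2)`!%:R * expR (delta / 2 * `|z|) / (delta / 2) ^+ k.+2).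
      by rewrite ler_pdivlMr ?exprn_gt0// mulrC.
    by rewrite /C mulrAC.
  apply: le_trans (_ : C * expR (delta / 2 * `|z|) * expR (delta / 2 * `|z|) <= _).
    by rewrite ler_pM ?exprn_ge0 ?expR_ge0.
  rewrite -mulrA -expRD ler_wpM2l ?(ltW C0)//.
  rewrite (_ : _ + _ = delta * `|z|); last by field.
  have [z0|z0] := leP 0 z; first by rewrite ger0_norm// lerDl expR_ge0.
  by rewrite ltr0_norm// mulrN lerDr expR_ge0.
- by rewrite expectYZ// -mulrA.
Qed.

(** Truncation at the even order [2 * K] makes the remainder bound a monomial without absolute
    value, hence a member of the class. Only its mean under [Q] must be small; there exponents of
    every sign are available, and comparison with [expR (2 * |z|)] gives decay like [4 ^ (- K)]. *)
Lemma cvg_expect_cos (phi xi eta : R) :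
  cvg_expect (fun p => cos (phi + (xi * p.1 + eta * p.2)) * expR (p.1 + p.2)).
Proof.
have mono k : cvg_expect (fun p => (xi * p.1 + eta * p.2) ^+ k * expR (p.1 + p.2)).
  apply: cvg_expect_ext (@cvg_expect_monomial xi eta k 0 _); last by rewrite normr0 mul0r.
  by move=> p; rewrite /zexp mul0r addr0.
have iz (c : R) : Q.-integrable [set: T']
    (fun w => (expR ((Y w).1 + (Y w).2 + c * (xi * (Y w).1 + eta * (Y w).2)))%:E).
  rewrite (_ : (fun _ => _) = (fun w => (expR ((1 + c * xi) * (Y w).1 + (1 + c * eta) * (Y w).2))%:E)).
    exact: expY.
  by apply/funext => w; congr (expR _)%:E; ring.
pose M := E (fun p => expR (p.1 + p.2 + 2 * (xi * p.1 + eta * p.2))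
                    + expR (p.1 + p.2 + (-2) * (xi * p.1 + eta * p.2))).
have M0 : 0 <= M by apply: expectY_ge0 => p; rewrite addr_ge0 ?expR_ge0.
apply: cvg_expect_approx => [|e e0].
  apply: measurable_funM; last first.
    by have [+ _ _ _] := mono 0%N; under eq_fun do rewrite mul1r.
  apply: (@measurableT_comp _ _ _ _ _ _ (@cos R) _ (fun p : R * R => phi + (xi * p.1 + eta * p.2))).
    by apply: continuous_measurable_fun; exact: continuous_cos.
  by apply: measurable_funD => //; apply: measurable_funD; apply: measurable_funM.
have [K hK] : exists K, M * 4^-1 ^+ K <= e.
  have [K K1] : exists K : nat, M / e <= K%:R.
    by exists (Num.truncn (M / e)).+1; apply: ltW; exact: truncnS_gt.
  exists K; have K4 : K%:R <= 4 ^+ K :> R.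
    rewrite -natrX ler_nat; apply: ltnW; exact: ltn_expl.
  have p4 : (0 : R) < 4 ^+ K by rewrite exprn_gt0.
  rewrite exprVn ler_pdivrMr// mulrC -ler_pdivrMr//.
  exact: le_trans K1 K4.
exists (fun p => \sum_(i < 2 * K) cos (phi + i%:R * (pi / 2)) / i`!%:R *
   ((xi * p.1 + eta * p.2) ^+ i * expR (p.1 + p.2))).
exists (fun p => (2 * K)`!%:R^-1 * ((xi * p.1 + eta * p.2) ^+ (2 * K) * expR (p.1 + p.2))).
have f0 : 0 < (2 * K)`!%:R :> R by rewrite ltr0n fact_gt0.
split.
- by apply: cvg_expect_sum => i; exact: cvg_expectZ.
- exact: cvg_expectZ.
- move=> p; set z := xi * p.1 + eta * p.2; set B := expR _.
  have B0 : 0 <= B by exact: expR_ge0.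
  have -> : \sum_(i < 2 * K) cos (phi + i%:R * (pi / 2)) / i`!%:R * (z ^+ i * B) =
    (\sum_(i < 2 * K) cos (phi + i%:R * (pi / 2)) / i`!%:R * z ^+ i) * B.
    by rewrite mulr_suml; apply: eq_bigr => i _; rewrite mulrA.
  rewrite -mulrBl normrM (ger0_norm B0) mulrA ler_wpM2r//.
  apply: le_trans (cos_taylor phi (2 * K) z) _.
  by rewrite mulrC -normrX ger0_norm// exprM exprn_ge0// sqr_ge0.
- apply: le_trans hK.
  have -> : M * 4^-1 ^+ K = E (fun p => 4^-1 ^+ K *
      (expR (p.1 + p.2 + 2 * (xi * p.1 + eta * p.2))
       + expR (p.1 + p.2 + (-2) * (xi * p.1 + eta * p.2)))).
    by rewrite /E RintegralZl 1?mulrC//; exact: (integrableD measurableT (iz 2) (iz (-2))).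
  apply: expectY_le.
  + exact: cvg_expectZ.
  + exact: (integrableZl measurableT _ (integrableD measurableT (iz 2) (iz (-2)))).
  move=> p; set z := xi * p.1 + eta * p.2; set A := p.1 + p.2.
  rewrite !(expRD A) -mulrDr; set B := expR A.
  have B0 : 0 <= B by exact: expR_ge0.
  rewrite mulrA [leRHS]mulrCA [leRHS]mulrC ler_wpM2r//.
  have := @exprn_le_fact_expR R (2 * `|z|) (2 * K) ltac:(by rewrite mulr_ge0).
  rewrite exprMn => h.
  have p4 : (0 : R) < 4 ^+ K by rewrite exprn_gt0.
  rewrite exprVn [leRHS]mulrC ler_pdivlMr// -mulrA ler_pdivrMl// mulrC.
  have e4 : (2 : R) ^+ (2 * K) = 4 ^+ K by rewrite exprM; congr (_ ^+ _); ring.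
  have ez : `|z| ^+ (2 * K) = z ^+ (2 * K).
    by rewrite -normrX ger0_norm// exprM exprn_ge0// sqr_ge0.
  rewrite e4 ez in h; apply: le_trans h _; rewrite ler_wpM2l ?(ltW f0)//.
  have [z0|z0] := leP 0 z; first by rewrite ger0_norm// lerDl expR_ge0.
  by rewrite ltr0_norm// mulrN -mulNr lerDr expR_ge0.
Qed.

Lemma cvg_expect_trig (t : R * R -> R) : trig_sum t ->
  cvg_expect (fun p => t p * expR (p.1 + p.2)).
Proof.
elim=> {t} [phi xi eta|f g _ IHf _ IHg|c f _ IHf].
- exact: cvg_expect_cos.
- by apply: cvg_expect_ext (cvg_expectD IHf IHg) => p; rewrite mulrDl.
- by apply: cvg_expect_ext (cvg_expectZ c IHf) => p; rewrite mulrA.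
Qed.

Lemma cvg_expect_compact (f : R * R -> R) (rho M : R) : continuous f -> 0 < rho ->
  (forall p, rho < `|p.1| -> f p = 0) -> (forall p, rho < `|p.2| -> f p = 0) ->
  (forall p, `|f p| <= M) -> cvg_expect f.
Proof.
move=> cf rho0 f1 f2 fM.
have M0 : 0 <= M by exact: le_trans (fM (0, 0)).
pose g (p : R * R) := f p * expR (- (p.1 + p.2)).
have cg : continuous g.
  move=> p; apply: cvgM; first exact: cf.
  apply: (@cvg_comp _ _ _ (fun p : R * R => - (p.1 + p.2)) (@expR R)).
    by apply: cvgN; apply: cvgD; [exact: cvg_fst|exact: cvg_snd].
  exact: continuous_expR.
pose Mg := M * expR (2 * rho).
have Mg0 : 0 <= Mg by rewrite mulr_ge0 ?expR_ge0.
have gM p : `|g p| <= Mg.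
  rewrite /g normrM (ger0_norm (expR_ge0 _)).
  have [h1|h1] := ltP rho `|p.1|; first by rewrite f1// normr0 mul0r.
  have [h2|h2] := ltP rho `|p.2|; first by rewrite f2// normr0 mul0r.
  apply: ler_pM => //; rewrite ler_expR.
  by move: h1 h2; rewrite !ler_norml; lra.
have g1 p : rho < `|p.1| -> g p = 0 by move=> h; rewrite /g f1// mul0r.
have g2 p : rho < `|p.2| -> g p = 0 by move=> h; rewrite /g f2// mul0r.
(* When a coordinate exceeds [L] in absolute value, raising or lowering its exponent by 1 gains
   [expR (- L)] over [expR (p.1 + p.2)]. Starting from exponents (1, 1), this stays in the quadrant,
   so the dominating function is in the class. *)
pose W (p : R * R) := expR (2 * p.1 + 1 * p.2) + expR (0 * p.1 + 1 * p.2)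
  + expR (1 * p.1 + 2 * p.2) + expR (1 * p.1 + 0 * p.2).
have cW : cvg_expect W.
  by apply: cvg_expectD; [apply: cvg_expectD; [apply: cvg_expectD|]|];
    apply: cvg_expect_exp.
have cA : cvg_expect (fun p => expR (1 * p.1 + 1 * p.2)) by exact: cvg_expect_exp.
set A := E (fun p => expR (1 * p.1 + 1 * p.2)).
have A0 : 0 <= A by apply: expectY_ge0 => p; exact: expR_ge0.
have W0 p : 0 <= W p by rewrite !addr_ge0 ?expR_ge0.
have B0 : 0 <= E W by exact: expectY_ge0.
apply: cvg_expect_approx => [|e e0]; first exact: continuous_measurable_prod.
have e2 : 0 < e / 2 by rewrite divr_gt0.
(* [Mg] bounds the approximants on the whole plane, whatever the box, so [L] can be fixed before the
   approximant. *)
have [L [Lrho LB]] : exists L, rho < L /\ 2 * Mg * expR (- L) * E W <= e / 2.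
  pose c := 2 * Mg * E W / (e / 2).
  have c0 : 0 <= c by apply: divr_ge0; [rewrite !mulr_ge0|exact: ltW].
  exists (rho + 1 + c); split; first lra.
  have h : c <= expR (rho + 1 + c) by have := expR_ge1Dx (rho + 1 + c); lra.
  rewrite ler_pdivrMr// in h.
  by rewrite mulrAC expRN ler_pdivrMr ?expR_gt0// [leRHS]mulrC.
have A1 : 0 < A + 1 by lra.
have e'0 : 0 < e / 2 / (A + 1) by rewrite divr_gt0.
have [t [tt tM tapp]] := trig_approx cg rho0 Lrho e'0 g1 g2 gM.
exists (fun p => t p * expR (p.1 + p.2)).
exists (fun p => e / 2 / (A + 1) * expR (1 * p.1 + 1 * p.2) + 2 * Mg * expR (- L) * W p).
split.
- exact: cvg_expect_trig.
- by apply: cvg_expectD; exact: cvg_expectZ.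
- move=> p; have -> : f p = g p * expR (p.1 + p.2).
    by rewrite /g -mulrA -expRD addNr expR0 mulr1.
  rewrite -mulrBl normrM (ger0_norm (expR_ge0 _)) !mul1r.
  have q0 : 0 <= e / 2 / (A + 1) * expR (p.1 + p.2) by rewrite mulr_ge0 ?expR_ge0// ltW.
  have WL0 : 0 <= 2 * Mg * expR (- L) * W p by rewrite !mulr_ge0 ?expR_ge0.
  have far : expR (p.1 + p.2) <= expR (- L) * W p ->
     `|g p - t p| * expR (p.1 + p.2) <= e / 2 / (A + 1) * expR (p.1 + p.2)
        + 2 * Mg * expR (- L) * W p.
    move=> h; have gt : `|g p - t p| <= 2 * Mg.
      by have := ler_normB (g p) (t p); have := gM p; have := tM p; lra.
    have h1 := ler_wpM2r (expR_ge0 (p.1 + p.2)) gt.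
    have h2 := ler_wpM2l (mulr_ge0 (ler0n _ 2) Mg0) h.
    by apply: le_trans h1 _; apply: le_trans h2 _; rewrite mulrA lerDr.
  have [p1|p1] := leP `|p.1| L; last first.
    apply: far; rewrite /W !mulrDr -!expRD !mul1r !mul0r !add0r !addr0.
    have [x0|x0] := leP 0 p.1.
      rewrite ger0_norm// in p1; rewrite -!addrA ler_wpDr ?addr_ge0 ?expR_ge0//.
      by rewrite ler_expR; lra.
    rewrite ltr0_norm// in p1; rewrite -!addrA ler_wpDl ?expR_ge0//.
    by rewrite ler_wpDr ?addr_ge0 ?expR_ge0// ler_expR; lra.
  have [p2|p2] := leP `|p.2| L; last first.
    apply: far; rewrite /W !mulrDr -!expRD !mul1r !mul0r !add0r !addr0.
    have [x0|x0] := leP 0 p.2.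
      rewrite ger0_norm// in p2; rewrite ler_wpDr ?expR_ge0//.
      by rewrite ler_wpDl ?addr_ge0 ?expR_ge0// ler_expR; lra.
    rewrite ltr0_norm// in p2; rewrite ler_wpDl ?addr_ge0 ?expR_ge0//.
    by rewrite ler_expR; lra.
  by rewrite ler_wpDr// ler_wpM2r ?expR_ge0// tapp.
- rewrite (expectYD (cvg_expectZ _ cA) (cvg_expectZ _ cW)) (expectYZ _ cA) (expectYZ _ cW).
  rewrite -/A [leRHS](splitr e); apply: lerD => //.
  by rewrite mulrAC ler_pdivrMr// ler_wpM2l ?(ltW e2)// lerDl.
Qed.

(** The truncation error is at most [M * (1 - chi)], and [1 - chi] belongs to the class, being a
    constant minus a compactly supported function. Smallness of the tails under [Q] thus carries
    over to [P n], which is tightness. *)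
Lemma cvg_expect_continuous (f : R * R -> R) (M : R) : continuous f ->
  (forall p, `|f p| <= M) -> cvg_expect f.
Proof.
move=> cf fM; have M0 : 0 <= M by exact: le_trans (fM (0, 0)).
pose cut (rho x : R) : R := Num.max 0 (Num.min 1 (rho + 1 - `|x|)).
have cut01 rho x : 0 <= cut rho x <= 1.
  by rewrite /cut le_max lexx/= ge_max ler01 ge_min lexx.
have cut_far rho x : rho + 1 < `|x| -> cut rho x = 0.
  move=> h; rewrite /cut max_l// ge_min; apply/orP; right; lra.
have cut_near rho x : `|x| <= rho -> cut rho x = 1.
  by move=> h; rewrite /cut min_l ?max_r//; lra.
have ccut rho : continuous (cut rho).
  move=> x; apply: (@continuous_max R R (fun=> 0) (fun x => Num.min 1 (rho + 1 - `|x|)) x).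
    exact: cvg_cst.
  apply: (@continuous_min R R (fun=> 1) (fun x => rho + 1 - `|x|) x); first exact: cvg_cst.
  by apply: cvgB; [exact: cvg_cst|exact: norm_continuous].
pose chi rho (p : R * R) := cut rho p.1 * cut rho p.2.
have chi01 rho p : 0 <= chi rho p <= 1.
  rewrite /chi; have /andP[a0 a1] := cut01 rho p.1; have /andP[b0 b1] := cut01 rho p.2.
  by rewrite mulr_ge0//= mulr_ile1.
have cchi rho : continuous (chi rho).
  move=> p; apply: cvgM.
    by apply: (@cvg_comp _ _ _ (@fst R R) (cut rho)); [exact: cvg_fst|exact: ccut].
  by apply: (@cvg_comp _ _ _ (@snd R R) (cut rho)); [exact: cvg_snd|exact: ccut].
have chi1 rho (p : R * R) : rho + 1 < `|p.1| -> chi rho p = 0.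
  by move=> h; rewrite /chi cut_far// mul0r.
have chi2 rho (p : R * R) : rho + 1 < `|p.2| -> chi rho p = 0.
  by move=> h; rewrite /chi (cut_far _ p.2)// mulr0.
(* Negative exponents are admissible here, as this function is integrated against [Q] alone. *)
pose W (p : R * R) := expR (1 * p.1 + 0 * p.2) + expR ((-1) * p.1 + 0 * p.2)
  + expR (0 * p.1 + 1 * p.2) + expR (0 * p.1 + (-1) * p.2).
have W0 p : 0 <= W p by rewrite !addr_ge0 ?expR_ge0.
have iW : Q.-integrable [set: T'] (fun w => (W (Y w))%:E).
  exact: (integrableD measurableT (integrableD measurableT (integrableD measurableT
    (expY 1 0) (expY (-1) 0)) (expY 0 1)) (expY 0 (-1))).
have B0 : 0 <= E W by exact: expectY_ge0.
apply: cvg_expect_approx => [|e e0]; first exact: continuous_measurable_prod.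
have [rho [rho0 rhoB]] : exists rho, 0 < rho /\ M * (expR (- rho) * E W) <= e.
  pose c := M * E W / e.
  have c0 : 0 <= c by apply: divr_ge0; [rewrite !mulr_ge0|exact: ltW].
  exists (1 + c); split; first lra.
  have h : c <= expR (1 + c) by have := expR_ge1Dx (1 + c); lra.
  rewrite ler_pdivrMr// in h.
  by rewrite mulrCA expRN ler_pdivrMl ?expR_gt0.
have r1 : 0 < rho + 1 by lra.
have cchiE : cvg_expect (chi rho).
  apply: (@cvg_expect_compact _ (rho + 1) 1 (cchi rho) r1 (chi1 rho) (chi2 rho)) => p.
  by have /andP[a b] := chi01 rho p; rewrite ger0_norm.
have c1 : cvg_expect (fun=> 1).
  apply: (@cvg_expect_ext (fun p => expR (0 * p.1 + 0 * p.2))).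
    by move=> p; rewrite !mul0r addr0 expR0.
  exact: cvg_expect_exp.
exists (fun p => f p * chi rho p), (fun p => M * (1 + (-1) * chi rho p)); split.
- apply: (@cvg_expect_compact _ (rho + 1) M) => //.
  + by move=> p; apply: cvgM; [exact: cf|exact: cchi].
  + by move=> p h; rewrite chi1// mulr0.
  + by move=> p h; rewrite chi2// mulr0.
  + move=> p; have /andP[a b] := chi01 rho p.
    by rewrite normrM (ger0_norm a) -[leRHS]mulr1 ler_pM.
- by apply: cvg_expectZ; apply: cvg_expectD => //; exact: cvg_expectZ.
- move=> p; have /andP[a b] := chi01 rho p.
  rewrite mulN1r -{1}[f p]mulr1 -mulrBr normrM (ger0_norm (_ : 0 <= 1 - chi rho p)).
    by rewrite ler_wpM2r// subr_ge0.
  by rewrite subr_ge0.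
- apply: le_trans rhoB.
  have -> : M * (expR (- rho) * E W) = E (fun p => M * (expR (- rho) * W p)).
    by rewrite /E !RintegralZl//; exact: (integrableZl measurableT _ iW).
  apply: expectY_le.
  + by apply: cvg_expectZ; apply: cvg_expectD => //; exact: cvg_expectZ.
  + exact: (integrableZl measurableT _ (integrableZl measurableT _ iW)).
  move=> p; rewrite ler_wpM2l// mulN1r.
  have WL0 : 0 <= expR (- rho) * W p by rewrite mulr_ge0 ?expR_ge0.
  have /andP[a b] := chi01 rho p.
  have far : 1 <= expR (- rho) * W p -> 1 - chi rho p <= expR (- rho) * W p by lra.
  have [p1|p1] := leP `|p.1| rho; last first.
    apply: far; rewrite /W !mulrDr -!expRD !mul1r !mul0r !mulN1r !add0r !addr0.
    rewrite -[leLHS](expR0 R).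
    have [x0|x0] := leP 0 p.1.
      rewrite ger0_norm// in p1; rewrite -!addrA ler_wpDr ?addr_ge0 ?expR_ge0//.
      by rewrite ler_expR; lra.
    rewrite ltr0_norm// in p1; rewrite -!addrA ler_wpDl ?expR_ge0//.
    by rewrite ler_wpDr ?addr_ge0 ?expR_ge0// ler_expR; lra.
  have [p2|p2] := leP `|p.2| rho; last first.
    apply: far; rewrite /W !mulrDr -!expRD !mul1r !mul0r !mulN1r !add0r !addr0.
    rewrite -[leLHS](expR0 R).
    have [x0|x0] := leP 0 p.2.
      rewrite ger0_norm// in p2; rewrite ler_wpDr ?expR_ge0//.
      by rewrite ler_wpDl ?addr_ge0 ?expR_ge0// ler_expR; lra.
    rewrite ltr0_norm// in p2; rewrite ler_wpDl ?addr_ge0 ?expR_ge0//.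
    by rewrite ler_expR; lra.
  by rewrite /chi !cut_near// mulr1 subrr.
Qed.

Lemma cvg_in_law_of_exp_moments : cvg_in_law P X Q Y.
Proof.
split=> // f cf bf.
have [M fM] : exists M, forall p, `|f p| <= M.
  have [M [_ hM]] := bf; exists (M + 1) => p.
  by apply: (hM (M + 1)) => //; rewrite ltrDl.
have [_ iQ iP cE] := cvg_expect_continuous cf fM.
have EQ : ('E_Q[f \o Y] = (E f)%:E)%E.
  by rewrite unlock /E /Rintegral fineK// integrable_fin_num.
rewrite EQ; apply/fine_cvgP; split.
  by apply: filterS iP => n iPn; rewrite unlock integrable_fin_num.
apply: cvg_trans cE; apply: near_eq_cvg; apply: nearW => n /=.
by rewrite unlock.
Qed.

End moment_class.

(** * Characteristic polynomial and normal limit *)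

Section normal_exponential_moments.
Context (R : realType) d (T : measurableType d) (Q : probability T R).
Local Open Scope ereal_scope.

(** Completing the square turns the tilted density into [expR (l ^+ 2 / 2)] times the normal density
    centred at [l], which has total mass one. *)
Lemma standard_normal_expR (N : {RV Q >-> R}) (l : R) : standard_normal N ->
  \int[distribution Q N]_x (expR (l * x))%:E = (expR (l ^+ 2 / 2))%:E.
Proof.
move=> hN.
have mN : measurable_fun [set: T] (N : T -> measurableTypeR R).
  have mN0 : measurable_fun [set: T] (N : T -> R) by exact: measurable_funP.
  exact: mN0.
(* [normal_prob] is a measure on [measurableTypeR R], whose display differs
   from that of [R]; the law of [N] is moved there. *)
pose N' : {RV Q >-> measurableTypeR R} :=
  HB.pack (N : T -> measurableTypeR R) (isMeasurableFun.Build _ _ _ _ _ mN).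
have mpdf : measurable_fun [set: measurableTypeR R] (@normal_pdf R 0 1).
  exact: (@measurable_normal_pdf R 0 1).
have mexp : measurable_fun [set: measurableTypeR R] (fun x : R => (expR (l * x))%:E).
  apply/measurable_EFinP; apply: (measurableT_comp (@measurable_expR R)).
  exact: measurable_funM.
have mexp' : measurable_fun [set: R] (fun x : R => (expR (l * x))%:E).
  apply/measurable_EFinP; apply: (measurableT_comp (@measurable_expR R)).
  exact: measurable_funM.
have e0 (x : R) : 0 <= (expR (l * x))%:E by rewrite lee_fin expR_ge0.
rewrite ge0_integral_distribution//.
transitivity (\int[distribution Q N']_x (expR (l * x))%:E).
  by rewrite ge0_integral_distribution.
have nuE : forall A : set (measurableTypeR R), measurable A ->
  distribution Q N' A = \int[lebesgue_measure]_(x in A) (normal_pdf 0 1 x)%:E.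
  by move=> A mA; exact: (hN A mA).
rewrite (ge0_integral_density mpdf (normal_pdf_ge0 0 1) nuE)//.
transitivity ((expR (l ^+ 2 / 2))%:E * \int[lebesgue_measure]_x (normal_pdf l 1 x)%:E); last first.
  by rewrite integral_normal_pdf mule1.
rewrite -ge0_integralZl//; last 2 first.
- by apply/measurable_EFinP; exact: measurable_normal_pdf.
- by move=> x _; rewrite lee_fin normal_pdf_ge0.
apply: eq_integral => x _; rewrite -!EFinM; congr EFin.
rewrite /normal_pdf oner_eq0 /normal_fun mulrCA [RHS]mulrCA; congr (_ * _)%R.
by rewrite -!expRD; congr expR; field.
Qed.

(** Independence determines the joint law on rectangles, hence everywhere by uniqueness of the
    product measure; Tonelli's theorem then separates the variables. *)
Lemma independent_normal_expR (N1 N2 : {RV Q >-> R}) (l m : R) :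
  standard_normal N1 -> standard_normal N2 -> independent_RV N1 N2 ->
  \int[Q]_w (expR (l * N1 w + m * N2 w))%:E = (expR ((l ^+ 2 + m ^+ 2) / 2))%:E.
Proof.
move=> h1 h2 hind.
pose Z (w : T) : R * R := (N1 w, N2 w).
have mZ : measurable_fun [set: T] Z by apply/measurable_fun_pair.
pose f (p : R * R) : \bar R := (expR (l * p.1 + m * p.2))%:E.
have mf : measurable_fun [set: R * R] f.
  by apply/measurable_EFinP; exact: measurable_exp_lin.
have f0 p : 0 <= f p by rewrite lee_fin expR_ge0.
transitivity (\int[pushforward Q Z]_p f p).
  by rewrite ge0_integral_pushforward.
transitivity (\int[(distribution Q N1 \x distribution Q N2)]_p f p).
  apply: eq_measure_integral => A mA _; apply/esym.
  exact: (product_measure_unique _ mA).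
rewrite fubini_tonelli1//.
transitivity (\int[distribution Q N1]_x ((expR (l * x))%:E * (expR (m ^+ 2 / 2))%:E)).
  apply: eq_integral => x _; rewrite -(standard_normal_expR m h2) /fubini_F/=.
  rewrite -ge0_integralZl//; last first.
    apply/measurable_EFinP; apply: (measurableT_comp (@measurable_expR R)).
    exact: measurable_funM.
  by apply: eq_integral => y _; rewrite /f /= expRD EFinM.
rewrite ge0_integralZr//; last first.
  apply/measurable_EFinP; apply: (measurableT_comp (@measurable_expR R)).
  exact: measurable_funM.
by rewrite standard_normal_expR// -EFinM -expRD; congr (expR _)%:E; field.
Qed.

End normal_exponential_moments.

(** * Derivatives of the characteristic polynomial at 1 and -1 *)

Section characteristic_polynomial.
Variable R : realType.

(** One differentiation leaves a multiple of the next lower power of ['X - c%:P], with cofactor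
    [k.+1] times [q] at [c]; induction with [q] free accumulates the factorial. *)
Lemma derivn_root_horner (K : comNzRingType) (c : K) (q : {poly K}) k :
  (('X - c%:P) ^+ k * q)^`(k).[c] = k`!%:R * q.[c].
Proof.
elim: k q => [|k IH] q; first by rewrite derivn0 mul1r fact0 mul1r.
rewrite derivSn.
have -> : (('X - c%:P) ^+ k.+1 * q)^`() =
    ('X - c%:P) ^+ k * (q *+ k.+1 + ('X - c%:P) * q^`()).
  rewrite derivM deriv_exp derivXsubC mul1r /=.
  by rewrite mulrDr mulrnAl mulrnAr exprSr mulrA.
rewrite IH hornerD hornerMn hornerM !hornerE subrr mul0r addr0.
by rewrite factS natrM -mulr_natl; ring.
Qed.

Let char_factor1 (th : R) :
  (1 - expi th) * (1 - expi (- th)) = real_complex R (2 * (1 - cos th)).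
Proof.
rewrite /expi cosN sinN; have h := cos2Dsin2 th.
apply/eqP; rewrite eq_complex /=; apply/andP; split; apply/eqP; last by ring.
transitivity (1 - 2 * cos th + (cos th ^+ 2 + sin th ^+ 2)); first by ring.
by rewrite h; ring.
Qed.

Let char_factorN1 (th : R) :
  (-1 - expi th) * (-1 - expi (- th)) = real_complex R (2 * (1 + cos th)).
Proof.
rewrite /expi cosN sinN; have h := cos2Dsin2 th.
apply/eqP; rewrite eq_complex /=; apply/andP; split; apply/eqP; last by ring.
transitivity (1 + 2 * cos th + (cos th ^+ 2 + sin th ^+ 2)); first by ring.
by rewrite h; ring.
Qed.

Lemma Z_at1E pp pm n (t : n.-tuple R) :
  Z_at1 pp pm t = (2 * pp)`!%:R * 2 ^+ (2 * pm) * 2 ^+ n * prod_onem t.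
Proof.
suff -> : Z_at1 pp pm t = complex.Re (real_complex R
    ((2 * pp)`!%:R * 2 ^+ (2 * pm) * 2 ^+ n * prod_onem t)) by [].
congr complex.Re; rewrite /spectral_char_poly -polyC1 -mulrA derivn_root_horner.
rewrite hornerM horner_exp horner_prod hornerD hornerX hornerC.
have -> : \prod_(k < n) (('X - (expi (tnth t k))%:P) *
    ('X - (expi (- tnth t k))%:P)).[1] = real_complex R (2 ^+ n * prod_onem t).
  rewrite -[in 2 ^+ n](card_ord n) -prodr_const -big_split/= rmorph_prod.
  by apply: eq_bigr => k _; rewrite hornerM !hornerXsubC char_factor1.
by rewrite -[1 + 1]/(2%:R) !rmorphM !rmorphXn !rmorph_nat !mulrA.
Qed.

Lemma Z_atN1E pp pm n (t : n.-tuple R) :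
  Z_atN1 pp pm t = (2 * pm)`!%:R * 2 ^+ (2 * pp) * 2 ^+ n * prod_oneD t.
Proof.
suff -> : Z_atN1 pp pm t = complex.Re (real_complex R
    ((2 * pm)`!%:R * 2 ^+ (2 * pp) * 2 ^+ n * prod_oneD t)) by [].
congr complex.Re; rewrite /spectral_char_poly [_ * ('X + 1) ^+ _]mulrC -[X in X^`(_)]mulrA.
have -> : ('X + 1 : {poly R[i]}) = 'X - (-1)%:P by rewrite polyCN opprK.
rewrite derivn_root_horner -polyC1 hornerM horner_exp horner_prod hornerXsubC.
have -> : \prod_(k < n) (('X - (expi (tnth t k))%:P) *
    ('X - (expi (- tnth t k))%:P)).[-1] = real_complex R (2 ^+ n * prod_oneD t).
  rewrite -[in 2 ^+ n](card_ord n) -prodr_const -big_split/= rmorph_prod.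
  by apply: eq_bigr => k _; rewrite hornerM !hornerXsubC char_factorN1.
have -> : (-1 - 1) ^+ (2 * pp) = 2 ^+ (2 * pp) :> R[i].
  by rewrite -opprD exprNn exprM sqrrN expr1n expr1n mul1r.
by rewrite !rmorphM !rmorphXn !rmorph_nat !mulrA.
Qed.

Lemma so_weightE pp pm n :
  @so_weight R pp pm n = selberg_weight (2 * pp)%:R (2 * pm)%:R.
Proof.
apply/funext => t; congr (_ * _); apply: eq_bigr => j _.
by rewrite /beta_weight !powR_mulrn ?onem_cos_ge0 ?oneD_cos_ge0.
Qed.

Lemma usp_weightE pp pm n :
  @usp_weight R pp pm n = selberg_weight (2 * pp + 1)%:R (2 * pm + 1)%:R.
Proof.
apply/funext => t; congr (_ * _); apply: eq_bigr => j _.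
by rewrite /beta_weight !powR_mulrn ?onem_cos_ge0 ?oneD_cos_ge0.
Qed.

End characteristic_polynomial.

(** The exponents [a], [b] of the density are kept apart from the multiplicities [pp], [pm], which
    enter the derivatives only through constant factors. One statement thus serves both groups, with
    [a = 2 * pp] or [a = 2 * pp + 1]. *)
Lemma selberg_angles_cvg_in_law (R : realType) (a b pp pm : nat) d' (T' : measurableType d')
    (Q : probability T' R) (N1 N2 : {RV Q >-> R})
    (d : nat -> measure_display) (T : forall n, measurableType (d n))
    (P : forall n, probability (T n) R) (theta : forall n, {RV (P n) >-> n.-tuple R}) :
  standard_normal N1 -> standard_normal N2 -> independent_RV N1 N2 ->
  (forall n, (0 < n)%N ->
    density_proportional (theta n) (@angle_domain R n) (selberg_weight a%:R b%:R)) ->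
  cvg_in_law P
    (fun n w =>
      (normalized_log (a%:R - 2^-1) n (Z_at1 pp pm (theta n w)),
       normalized_log (b%:R - 2^-1) n (Z_atN1 pp pm (theta n w))))
    Q (fun w => (N1 w, N2 w)).
Proof.
move=> h1 h2 hind hdens.
have mgfQ l m := independent_normal_expR l m h1 h2 hind.
have C10 : 0 < (2 * pp)`!%:R * 2 ^+ (2 * pm) :> R.
  by rewrite mulr_gt0 ?exprn_gt0// ltr0n fact_gt0.
have C20 : 0 < (2 * pm)`!%:R * 2 ^+ (2 * pp) :> R.
  by rewrite mulr_gt0 ?exprn_gt0// ltr0n fact_gt0.
apply: cvg_in_law_of_exp_moments.
- move=> n; apply/measurable_fun_pair => /=.
    under eq_fun do rewrite Z_at1E.
    have h := @measurable_normalized_prod_onem R (a%:R - 2^-1) ((2 * pp)`!%:R * 2 ^+ (2 * pm)) n.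
    exact: (measurableT_comp h (measurable_funP _)).
  under eq_fun do rewrite Z_atN1E.
  have h := @measurable_normalized_prod_oneD R (b%:R - 2^-1) ((2 * pm)`!%:R * 2 ^+ (2 * pp)) n.
  exact: (measurableT_comp h (measurable_funP _)).
- by apply/measurable_fun_pair.
- move=> l m; apply/integrableP; split.
    apply/measurable_EFinP; apply: (measurableT_comp (@measurable_expR R)).
    by apply: measurable_funD; apply: measurable_funM.
  under eq_integral do rewrite /= ger0_norm ?expR_ge0//.
  by rewrite mgfQ ltry.
- move=> l m l0 m0 /=; rewrite mgfQ.
  have := mgf_angles_cvg (ler0n _ a) (ler0n _ b) C10 C20 hdens l0 m0.
  apply: cvg_trans; apply: near_eq_cvg; apply: nearW => n /=.
  by apply: eq_integral => w _; rewrite Z_at1E Z_atN1E.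
Qed.

Theorem corollary5p4 (R : realType) (pp pm : nat)
    (d' : measure_display) (T' : measurableType d') (Q : probability T' R)
    (N1 N2 : {RV Q >-> R})
    (hN1 : standard_normal N1) (hN2 : standard_normal N2)
    (hN : independent_RV N1 N2) :
  (forall (d : nat -> measure_display) (T : forall n, measurableType (d n))
      (P : forall n, probability (T n) R)
      (theta : forall n, {RV (P n) >-> n.-tuple R}),
    (forall n, (0 < n)%N -> so_cond_haar pp pm (theta n)) ->
    cvg_in_law P
      (fun n w =>
        (normalized_log ((2 * pp)%:R - 2^-1) n (Z_at1 pp pm (theta n w)),
         normalized_log ((2 * pm)%:R - 2^-1) n (Z_atN1 pp pm (theta n w))))
      Q (fun w => (N1 w, N2 w)))
  /\
  (forall (d : nat -> measure_display) (T : forall n, measurableType (d n))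
      (P : forall n, probability (T n) R)
      (theta : forall n, {RV (P n) >-> n.-tuple R}),
    (forall n, (0 < n)%N -> usp_cond_haar pp pm (theta n)) ->
    cvg_in_law P
      (fun n w =>
        (normalized_log ((2 * pp)%:R + 2^-1) n (Z_at1 pp pm (theta n w)),
         normalized_log ((2 * pm)%:R + 2^-1) n (Z_atN1 pp pm (theta n w))))
      Q (fun w => (N1 w, N2 w))).
Proof.
split=> d T P theta hdens.
  apply: selberg_angles_cvg_in_law => // n n0.
  by have := hdens n n0; rewrite /so_cond_haar so_weightE.
have shift k : (2 * k)%:R + 2^-1 = (2 * k + 1)%:R - 2^-1 :> R by rewrite natrD; field.
rewrite !shift; apply: selberg_angles_cvg_in_law => // n n0.
by have := hdens n n0; rewrite /usp_cond_haar usp_weightE.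
Qed.
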